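(* Let $0<\lambda<1$ and let $d=1$. For each positive integer $n$, suppose that in the $n$-queue supermarket model with parameters $\lambda$ and $d=1$ the queue-lengths vector $X_0^{(n)}$ is in the stationary distribution (and thus so is the maximum queue length $M_t^{(n)}=\|X_t^{(n)}\|_\infty$ for each $t\ge0$). (a) For each nonnegative integer $m$ (and each $t\ge 0$), $$\Pr(M_t^{(n)}\le m)=(1-\lambda^{m+1})^n.$$ Thus if $m=m(n)$ is a sequence of nonnegative integers and $n\to\infty$, then $M_t^{(n)}\ge m(n)$ a.a.s. if and only if $m(n)-\frac{\ln n}{\ln(1/\lambda)}\to-\infty$; and $M_t^{(n)}\le m(n)$ a.a.s. if and only if $m(n)-\frac{\ln n}{\ln(1/\lambda)}\to+\infty$. (b) For any subexponential time $\tau=\tau(n)\ge0$ (i.e. $\tau=e^{n^{o(1)}}$), $$\Big(\min_{0\le t\le\tau}M_t^{(n)}\Big)\frac{\ln(1/\lambda)}{\ln n}\to1\quad\text{in probability as }n\to\infty.$$ (c) For any constant $K>0$, $$\Big(\max_{0\le t\le n^K}M_t^{(n)}\Big)\frac{\ln(1/\lambda)}{\ln n}\to K+1\quad\text{in probability as }n\to\infty.$$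
   Context: Supermarket model with parameters $\lambda$ and $d=1$: there are $n$ queues, each with a single server. Customers arrive in a Poisson process of rate $\lambda n$. On arrival each customer chooses one queue uniformly at random and joins it. Service is first-come-first-served, and service times are independent exponential random variables with mean 1. $X_t^{(n)}=(X_t^{(n)}(1),\dots,X_t^{(n)}(n))$ is the queue-lengths vector at time $t$, where $X^{(n)}_t(j)$ is the number of customers in queue $j$ at time $t$ (including the one in service); sample paths are right-continuous. This is an ergodic continuous-time Markov chain with a unique stationary distribution. Events $A_n$ hold a.a.s. (asymptotically almost surely) if $\Pr(A_n)\to1$ as $n\to\infty$. The condition $\tau=e^{n^{o(1)}}$ means $\tau(n)\le e^{n^{\varepsilon_n}}$ for some sequence $\varepsilon_n\to0$. *)

(* Defs.v *)
From HB Require Import structures.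
From mathcomp Require Import all_boot all_order all_algebra finmap.
From mathcomp Require Import all_classical all_reals all_analysis.

Set Implicit Arguments.
Unset Strict Implicit.
Unset Printing Implicit Defensive.

Import Order.TTheory GRing.Theory Num.Theory.
Import numFieldNormedType.Exports.

Local Open Scope classical_set_scope.
Local Open Scope ring_scope.

Definition mutually_independent d (T : measurableType d) (R : realType)
    (P : probability T R) (I : Type) (F : I -> set (set T)) : Prop :=
  forall (k : nat) (e : 'I_k -> I) (A : 'I_k -> set T),
    injective e -> (forall i, F (e i) (A i)) ->
    P (\bigcap_i A i) = (\prod_(i < k) P (A i))%E.

(* The equality of laws is required on measurable sets only, since the value of
   a measure is unspecified on the other ones. *)
Definition has_exponential_law d (T : measurableType d) (R : realType)
    (P : probability T R) (X : {RV P >-> R}) (rate : R) : Prop :=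
  forall B : set R, measurable B ->
    distribution P X B = exponential_prob rate B.

(* Random inputs of the n-queue system on the probability space (T, P).
   The customers are those present at time 0, numbered by their position i in
   the queue j, and those who arrive later, numbered k = 0, 1, 2, ... in the
   order of arrival; each customer has a service time of his own.
   [initial_service j i] is only used for i smaller than the initial length of
   queue j.  Queue choices are natural numbers, the queues being 0, ..., n-1, so
   that the type also makes sense for n = 0. *)
Record supermarket_input d (T : measurableType d) (R : realType)
    (P : probability T R) (n : nat) := SupermarketInput {
  initial_state : T -> {ffun 'I_n -> nat};
  interarrival : nat -> {RV P >-> R};
  queue_choice : nat -> {RV P >-> nat};
  service : nat -> {RV P >-> R};
  initial_service : 'I_n -> nat -> {RV P >-> R}
}.

Variant input_index (n : nat) :=
  | InitialState
  | Interarrival of nat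
  | QueueChoice of nat
  | Service of nat
  | InitialService of 'I_n & nat.

Section supermarket.
Context d (T : measurableType d) (R : realType) (P : probability T R) (n : nat).
Variable S : supermarket_input P n.

Definition arrival_time (k : nat) (w : T) : R :=
  \sum_(i < k.+1) interarrival S i w.

Definition initial_departure (j : 'I_n) (i : nat) (w : T) : R :=
  \sum_(l < i.+1) initial_service S j l w.

(* Time at which queue j has served all its initial customers and all those
   among the arriving customers 0, ..., k-1 who joined it: a customer starts
   service at his arrival or when his predecessor leaves, whichever is later. *)
Fixpoint clearing_time (j : 'I_n) (k : nat) (w : T) : R :=
  match k with
  | 0%N => \sum_(l < initial_state S w j) initial_service S j l w
  | k'.+1 =>
      if queue_choice S k' w == j :> nat then
        Num.max (arrival_time k' w) (clearing_time j k' w) + service S k' w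
      else clearing_time j k' w
  end.

(* X_t(j).  An arriving customer k who joins queue j leaves it at time
   [clearing_time j k.+1]. *)
Definition queue_length (t : R) (w : T) (j : 'I_n) : nat :=
  (\sum_(i < initial_state S w j) (t < initial_departure j i w)%R +
   #|` fset_set [set k : nat | queue_choice S k w = j :> nat /\
                   (arrival_time k w <= t < clearing_time j k.+1 w)%R] |)%N.

Definition queue_vector (t : R) (w : T) : {ffun 'I_n -> nat} :=
  [ffun j => queue_length t w j].

Definition max_queue (t : R) (w : T) : nat :=
  (\max_(j < n) queue_vector t w j)%N.

Definition input_sigma_algebra (v : input_index n) : set (set T) :=
  match v with
  | InitialState => [set initial_state S @^-1` B | B in setT]
  | Interarrival k => g_sigma_algebra_preimage (interarrival S k)
  | QueueChoice k => g_sigma_algebra_preimage (queue_choice S k)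
  | Service k => g_sigma_algebra_preimage (service S k)
  | InitialService j i => g_sigma_algebra_preimage (initial_service S j i)
  end.

(* The n-queue supermarket model with parameters lambda and d = 1, n > 0.
   The last field chooses the version of the arrival process with finitely many
   arrivals in bounded time for every outcome (rather than almost every one);
   then every sample path of [queue_vector] is right-continuous. *)
Record is_supermarket (lambda : R) : Prop := IsSupermarket {
  measurable_initial_state :
    forall x, measurable (initial_state S @^-1` [set x]);
  interarrival_law :
    forall k, has_exponential_law (interarrival S k) (lambda * n%:R);
  queue_choice_law :
    forall k (j : 'I_n), P [set w | queue_choice S k w = j :> nat]
                         = (n%:R^-1)%:E;
  service_law : forall k, has_exponential_law (service S k) 1;
  initial_service_law :
    forall j i, has_exponential_law (initial_service S j i) 1;
  input_independent : mutually_independent P input_sigma_algebra;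
  arrivals_locally_finite :
    forall w, (fun k => arrival_time k w) @ \oo --> +oo
}.

(* The law of X_0 is a stationary distribution of the Markov chain X: if X_0 has
   this law then so does X_t, for every t. *)
Definition stationary : Prop :=
  forall (t : R) (x : {ffun 'I_n -> nat}), 0 <= t ->
    P [set w | queue_vector t w = x] = P [set w | initial_state S w = x].

(* As max_queue is nat-valued and bounded on bounded time intervals, this inf
   and this sup are a minimum and a maximum when 0 <= tau. *)
Definition min_max_queue (tau : R) (w : T) : R :=
  inf [set (max_queue t w)%:R | t in `[0, tau]].

Definition max_max_queue (tau : R) (w : T) : R :=
  sup [set (max_queue t w)%:R | t in `[0, tau]].

End supermarket.

Section asymptotics.
Context (R : realType) (d : nat -> measure_display)
  (T : forall n, measurableType (d n)) (P : forall n, probability (T n) R).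

Definition aas (A : forall n, set (T n)) : Prop :=
  (fun n => P n (A n)) @ \oo --> 1%E.

Definition cvg_in_probability (Y : forall n, T n -> R) (c : R) : Prop :=
  forall e : R, 0 < e ->
    (fun n => P n [set w | e < `|Y n w - c|]) @ \oo --> 0%E.

End asymptotics.

Definition subexponential (R : realType) (tau : nat -> R) : Prop :=
  exists eps : nat -> R, eps @ \oo --> 0 /\
    \forall n \near \oo, tau n <= expR (n%:R `^ eps n).

(* Main.v *)
(* With [d = 1] the queues are independent M/M/1 queues fed by Poisson streams
   of rate [lambda]. Expanding the state at a small time [h] to first order in
   [h] turns stationarity into the balance equations, whose only summable
   solution is a product of geometric laws; hence (a).
   In (b) and (c) unions are taken over a fine mesh of times, between whose
   points the maximum changes little: the stationary probability of a short
   maximum, about [exp (- n lambda^m)], is tiny for [m] below the typical value,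
   while that of a long maximum, about [n lambda^m], is of order [n^-K] for [m]
   close to [(K + 1) ln n / ln (1/lambda)].
   For the lower bound in (c), the maximum is observed at the ends of about
   [n^K] disjoint blocks of arrivals. A block of duration [n^o(1)] started from
   the stationary law empties every queue of its initial customers with
   overwhelming probability (Chernoff), so that the queues seen at its end are
   those of a system fed by this block alone; the blocks being independent and
   identically distributed, the probability that all of them fail to produce a
   long queue is that of one block raised to the number of blocks. *)

Require Import Defs.
From HB Require Import structures.
From mathcomp Require Import all_boot all_order all_algebra finmap.
From mathcomp Require Import all_classical all_reals all_analysis measurable_realfun.
From mathcomp Require Import ring lra zify.

Set Implicit Arguments.
Unset Strict Implicit.
Unset Printing Implicit Defensive.

Import Order.TTheory GRing.Theory Num.Theory.
Import numFieldNormedType.Exports.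

Local Open Scope classical_set_scope.
Local Open Scope ring_scope.

(** * Sample paths *)

(** Everything is therefore phrased through events on the independent inputs instead of conditioning
    on the state at a later time. Between mesh points the queues are controlled by short services or
    by bursts of arrivals, which are input events. The blocks are consecutive groups of B customers
    rather than time intervals, so that they use disjoint inputs with the same joint law, and
    stationarity enters the lower bound in (c) only through the first block. Two pathwise
    comparisons take the place of restarting the chain: a queue fed by one block alone, from an
    empty start, is never longer than the true queue ([waiting_shift]), and for the first block it
    is at least as long as the true queue once the initial work is absorbed ([waiting_forget]). *)

Section paths.
Context {R : realType}.
Implicit Types (xi s sig : nat -> R) (c : nat -> nat) (v t u L : R).

Definition arrival xi (k : nat) : R := \sum_(i < k.+1) xi i.

(** The recursion of [clearing_time] on deterministic sequences, with the initial work [v] as a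
    parameter, so that it also applies to a shifted input and to an empty start. *)
Fixpoint clearing xi s c (j : nat) v (k : nat) : R :=
  match k with
  | 0%N => v
  | k'.+1 => if c k' == j then
               Num.max (arrival xi k') (clearing xi s c j v k') + s k'
             else clearing xi s c j v k'
  end.

Lemma clearingS xi s c j v k : clearing xi s c j v k.+1 =
  if c k == j then Num.max (arrival xi k) (clearing xi s c j v k) + s k
  else clearing xi s c j v k.
Proof. by []. Qed.

#[local] Arguments clearing : simpl never.

(** A sum of booleans truncated at N customers instead of a cardinal, which makes induction,
    comparison and measurability direct; [queue_lengthE] relates it to the model. *)
Definition waiting xi s c j v (N : nat) t : nat :=
  (\sum_(k < N) [&& c k == j, (arrival xi k <= t)%R
                  & (t < clearing xi s c j v k.+1)%R])%N.

Definition initial_waiting sig (x : nat) t : nat :=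
  (\sum_(i < x) (t < \sum_(l < i.+1) sig l)%R)%N.

Lemma arrivalD xi b k :
  arrival xi (b + k) = \sum_(i < b) xi i + arrival (fun i => xi (b + i)%N) k.
Proof. by rewrite /arrival -addnS big_split_ord. Qed.

Lemma arrival_homo xi : (forall k, 0 <= xi k) -> {homo arrival xi : k l / (k <= l)%N >-> k <= l}.
Proof.
move=> xi0 k l /subnK <-; elim: (l - k)%N => // m IH.
by rewrite addSn (le_trans IH)// /arrival [leRHS]big_ord_recr/= lerDl.
Qed.

(* A server that just finished a service of length > delta cannot finish two
   of them in a time interval of length delta: the number of departures is
   dominated at every stage of the recursion by [t < clearing k]. *)
Lemma one_departure xi s sig c j v (x N : nat) delta t u :
  v = \sum_(l < x) sig l ->
  0 <= delta -> t <= u <= t + delta ->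
  (forall i, (i < x)%N -> delta < sig i) ->
  (forall k, (k < N)%N -> delta < s k) ->
  (initial_waiting sig x t + waiting xi s c j v N t
   <= (initial_waiting sig x u + waiting xi s c j v N u).+1)%N.
Proof.
move=> vE d0 /andP[tu ud] hsig hs.
pose di := (\sum_(i < x) (t < \sum_(l < i.+1) sig l <= u)%R)%N.
pose dw := (\sum_(k < N) ((c k == j) && (t < clearing xi s c j v k.+1 <= u)%R))%N.
have hi : (initial_waiting sig x t <= initial_waiting sig x u + di)%N.
  rewrite -big_split/=; apply: leq_sum => i _.
  by case: (t < _) => //=; case: (ltP u).
have hw : (waiting xi s c j v N t <= waiting xi s c j v N u + dw)%N.
  rewrite -big_split/=; apply: leq_sum => k _.
  case: (c k == j) => //=; have [at_|//] := leP (arrival xi k) t.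
  rewrite (le_trans at_ tu)/=.
  by case: (t < _) => //=; case: (ltP u).
suff : (di + dw <= 1)%N by lia.
have Hdi : (di <= (t < v)%R)%N.
  rewrite {}vE /di; clear di dw hi hw; elim: x hsig => [|x IH] hsig.
    by rewrite !big_ord0.
  rewrite big_ord_recr/= [in leqRHS]big_ord_recr/=.
  have := IH (fun i ix => hsig i (ltnW ix)).
  have := hsig x (ltnSn x).
  set a := \sum_(i < x) sig i; set b := (\sum_(i < x) _)%N => hx.
  rewrite big_ord_recr/= -/a.
  (* If the previous clearing time exceeds t, the next one exceeds u; otherwise nobody has been
     counted so far. *)
  have [ta|ta] := ltP t a.
    have -> : (a + sig x <= u)%R = false by lra.
    rewrite andbF addn0.
    by have -> : (t < a + sig x)%R = true by lra.
  by rewrite leqn0 => /eqP ->; case: (t < _) => //; case: (_ <= u).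
suff : (di + dw <= (t < clearing xi s c j v N)%R)%N by case: (t < _) => /=; lia.
rewrite /dw; clear dw hw; elim: N hs => [|N IH] hs; first by rewrite big_ord0 addn0.
rewrite big_ord_recr/= clearingS addnA.
have := IH (fun i ix => hs i (ltnW ix)); have := hs N (ltnSn N).
set C := clearing xi s c j v N; set b := (di + _)%N => hN.
case: (c N == j) => //=; last by rewrite addn0.
have CM : C <= Num.max (arrival xi N) C by rewrite le_max lexx orbT.
have [ta|ta] := ltP t C.
  have -> : (Num.max (arrival xi N) C + s N <= u)%R = false by lra.
  rewrite andbF addn0.
  by have -> : (t < Num.max (arrival xi N) C + s N)%R = true by lra.
by rewrite leqn0 => /eqP ->; case: (t < _) => //; case: (_ <= u).
Qed.

Lemma waiting_le_arrivals xi s sig c j v (x N : nat) t u : t <= u ->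
  (initial_waiting sig x u + waiting xi s c j v N u
   <= initial_waiting sig x t + waiting xi s c j v N t
      + \sum_(k < N) ((c k == j) && (t < arrival xi k <= u)%R))%N.
Proof.
move=> tu; rewrite -addnA leq_add//.
  by apply: leq_sum => i _; have [/(le_lt_trans tu)->|] := ltP u.
rewrite -big_split/=; apply: leq_sum => k _.
case: (c k == j) => //=; case: (leP (arrival xi k) t) => [at_|] //=.
  by rewrite (le_trans at_ tu)/=; have [/(le_lt_trans tu)->|] := ltP u.
by case: (_ <= u) => //=; case: (u < _).
Qed.

(** Earlier customers can only delay those from b on. The clearing times are compared up to a
    maximum with the start [off] of the block, since the true queue may have cleared before; this
    loses nothing at times [off + L] with L nonnegative. *)
Lemma waiting_shift xi s c j v (b B N : nat) L :
  (forall k, 0 <= xi k) -> 0 <= L -> (b + B <= N)%N ->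
  (waiting (fun i => xi (b + i)%N) (fun i => s (b + i)%N)
     (fun i => c (b + i)%N) j 0 B L
   <= waiting xi s c j v N (\sum_(i < b) xi i + L))%N.
Proof.
move=> xi0 L0 bBN; set off := \sum_(i < b) xi i.
set xi' := fun i => _; set s' := fun i => _; set c' := fun i => _.
have off_arr k : off <= arrival xi (b + k).
  rewrite arrivalD lerDl; apply: sumr_ge0 => i _; exact: xi0.
have key k : off + clearing xi' s' c' j 0 k
             <= Num.max off (clearing xi s c j v (b + k)).
  elim: k => [|k IH]; first by rewrite addr0 le_max lexx.
  rewrite addnS !clearingS -/(c' k); case: ifP => // _.
  rewrite le_max addrA; apply/orP; right; rewrite lerD2r.
  rewrite addr_maxr -arrivalD ge_max le_max lexx/=.
  move: IH; have := off_arr k; rewrite !le_max => oa /orP[|->]; last by rewrite orbT.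
  by move=> /le_trans/(_ oa) ->.
rewrite /waiting -(subnKC bBN) -addnA big_split_ord/= (leq_trans _ (leq_addl _ _))//.
rewrite big_split_ord/= (leq_trans _ (leq_addr _ _))//.
apply: leq_sum => k _; rewrite -/(c' k) arrivalD lerD2l.
case: (c' k == j) (key k.+1) => //=; rewrite addnS.
case: (_ <= L) => //=; have [|//] := ltP L (clearing xi' s' c' j 0 k.+1).
rewrite /= => LC; rewrite le_max => /orP[].
  by rewrite gerDl => /(lt_le_trans LC); rewrite ltNge L0.
by move=> /(lt_le_trans _) -> //; rewrite ltrD2l.
Qed.

(* If the work brought to the queue by its initial customers and by the
   customers 0, ..., k0-1 is less than the arrival time A of customer k0, then
   the initial customers only influence clearing times up to A. *)
Lemma waiting_forget xi s sig c j v (x N k0 : nat) L :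
  v = \sum_(l < x) sig l ->
  (forall k, 0 <= xi k) -> (forall k, 0 <= s k) -> (forall k, 0 <= sig k) ->
  v + \sum_(i < k0) (if c i == j then s i else 0) <= arrival xi k0 ->
  arrival xi k0 <= L ->
  (initial_waiting sig x L + waiting xi s c j v N L
   <= waiting xi s c j 0 N L)%N.
Proof.
move=> vE xi0 s0 sig0; set A := arrival xi k0 => WA AL.
pose W k := v + \sum_(i < k) (if c i == j then s i else 0).
have WS k : W k <= W k.+1.
  by rewrite /W big_ord_recr/= addrA lerDl; case: ifP.
have WkA k : (k <= k0)%N -> W k <= A.
  move=> kk0; apply: le_trans WA; move: kk0 => /subnK <-.
  by elim: (_ - _)%N => // m IH; apply: (le_trans IH); rewrite addSn WS.
have v0 : 0 <= v by rewrite vE; apply: sumr_ge0 => i _; exact: sig0.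
(* Either the server has never been idle and the clearing time is the total work [W k], or an idle
   period has erased the effect of the initial work. *)
have early k : clearing xi s c j v k <= Num.max (clearing xi s c j 0 k) (W k).
  elim: k => [|k IH]; first by rewrite /W big_ord0 addr0 le_max lexx orbT.
  rewrite !clearingS [W k.+1]/W big_ord_recr/= addrA -/(W k).
  case: ifP => _; last by rewrite addr0.
  rewrite -addr_maxl lerD2r ge_max !le_max lexx/=.
  by move: IH; rewrite le_max => /orP[] ->; rewrite ?orbT.
(* From customer k0 on, arrival times are at least A, so A is absorbed by the maximum taken in the
   recursion. *)
have key k : clearing xi s c j v k <= Num.max (clearing xi s c j 0 k) A.
  have [kk0|/ltnW] := leqP k k0.
    by rewrite (le_trans (early k))// ge_max !le_max lexx WkA ?orbT.
  move=> /subnK <-; elim: (k - k0)%N => [|m IH].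
    by rewrite add0n (le_trans (early _))// ge_max !le_max lexx WkA ?orbT.
  rewrite addSn !clearingS; case: ifP => // _; rewrite le_max lerD2r.
  rewrite ge_max le_max lexx/=; apply/orP; left.
  move: IH; rewrite !le_max => /orP[->|/le_trans->//]; rewrite ?orbT//.
  by apply: arrival_homo => //; rewrite leq_addl.
rewrite (_ : initial_waiting sig x L = 0)%N ?add0n.
  apply: leq_sum => k _; case: (c k == j) => //=; case: (_ <= L) => //=.
  have := key k.+1.
  set C := (X in X <= _); have [LC|//] := ltP L C; rewrite le_max => /orP[|].
    by move=> /(lt_le_trans LC) ->.
  by move=> /(lt_le_trans LC); rewrite ltNge AL.
apply: big1 => -[i ix] _ /=; apply/eqP; rewrite eqb0 -leNgt.
apply: le_trans AL; apply: le_trans (WkA 0%N isT); rewrite /W big_ord0 addr0 vE.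
rewrite -(subnKC ix) big_split_ord/= lerDl; apply: sumr_ge0 => l _; exact: sig0.
Qed.

End paths.

(** * Measurability and right-continuity of queue lengths *)

Lemma countable_bigcup_measurable d (T : measurableType d) (U : countType)
    (A : set U) (F : U -> set T) :
  (forall x, A x -> measurable (F x)) -> measurable (\bigcup_(x in A) F x).
Proof.
move=> mF; rewrite bigcup_mkcond.
apply: countable_bigcupT_measurable => [|x]; first exact: countableP.
by case: ifPn => // /set_mem; exact: mF.
Qed.

Section measurability.
Context d (T : measurableType d) (R : realType).

Lemma measurable_natr_bool (b : T -> bool) :
  measurable_fun setT b -> measurable_fun setT (fun w => (b w)%:R : R).
Proof.
move=> mb; rewrite (_ : (fun w => _) = fun w => if b w then 1 else 0 : R).
  exact: measurable_fun_ifT.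
by apply/funext => w; case: (b w).
Qed.

Variables (xi s : nat -> T -> R) (c : nat -> T -> nat) (j : nat) (v : T -> R).
Hypotheses (mxi : forall k, measurable_fun setT (xi k))
  (ms : forall k, measurable_fun setT (s k))
  (mc : forall k, measurable [set w | c k w = j])
  (mv : measurable_fun setT v).

Lemma measurable_arrival k :
  measurable_fun setT (fun w => arrival (xi ^~ w) k).
Proof. exact: measurable_sum. Qed.

Lemma measurable_choice k : measurable_fun setT (fun w => c k w == j).
Proof.
apply: (measurable_fun_bool true); rewrite setTI.
rewrite (_ : _ @^-1` _ = [set w | c k w = j])//.
by apply/seteqP; split => w /= /eqP.
Qed.

Lemma measurable_clearing k :
  measurable_fun setT
    (fun w => clearing (xi ^~ w) (s ^~ w) (c ^~ w) j (v w) k).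
Proof.
elim: k => [//|k IH]; rewrite /=; apply: measurable_fun_ifT => //.
  exact: measurable_choice.
apply: measurable_funD => //; apply: measurable_maxr => //.
exact: measurable_arrival.
Qed.

Lemma measurable_waiting N t :
  measurable_fun setT
    (fun w => (waiting (xi ^~ w) (s ^~ w) (c ^~ w) j (v w) N t)%:R : R).
Proof.
under eq_fun do rewrite /waiting natr_sum.
apply: measurable_sum => k; apply: measurable_natr_bool.
apply: measurable_and; first exact: measurable_choice.
apply: measurable_and.
  by apply: measurable_fun_ler => //; exact: measurable_arrival.
by apply: measurable_fun_ltr => //; exact: measurable_clearing.
Qed.

End measurability.

Section queue_paths.
Context d (T : measurableType d) (R : realType) (P : probability T R) (n : nat).
Variable S : supermarket_input P n.

Local Notation xi := (interarrival S).
Local Notation sv := (service S).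
Local Notation ch := (queue_choice S).
Local Notation sg := (initial_service S).
Local Notation X0 := (initial_state S).

Lemma clearing_timeE (j : 'I_n) k w : clearing_time S j k w =
  clearing (xi ^~ w) (sv ^~ w) (ch ^~ w) j (\sum_(l < X0 w j) sg j l w) k.
Proof. by elim: k => [//|k /= ->]. Qed.

Definition number_waiting (N : nat) (t : R) (w : T) (j : 'I_n) : nat :=
  (initial_waiting (sg j ^~ w) (X0 w j) t +
   waiting (xi ^~ w) (sv ^~ w) (ch ^~ w) j (\sum_(l < X0 w j) sg j l w) N t)%N.

Lemma queue_lengthE N t w (j : 'I_n) :
  (forall k, (N <= k)%N -> t < arrival_time S k w) ->
  queue_length S t w j = number_waiting N t w j.
Proof.
move=> hN; rewrite /queue_length /number_waiting; congr (_ + _)%N.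
pose p k := [&& ch k w == j :> nat, arrival_time S k w <= t
               & t < clearing_time S j k.+1 w].
rewrite (_ : fset_set _ = seq_fset tt [seq k <- iota 0 N | p k]).
  rewrite size_seq_fset undup_id ?filter_uniq ?iota_uniq// size_filter.
  have -> : count p (iota 0 N) = (\sum_(k < N) p k)%N.
    by rewrite -sumn_count sumnE big_map -(big_mkord xpredT (fun k => nat_of_bool (p k))) /index_iota subn0.
  by apply: eq_bigr => k _; rewrite /p clearing_timeE.
apply/fsetP => k; rewrite seq_fsetE mem_filter mem_iota add0n/=.
set A := [set k | _].
(* [fset_set] is meaningful on finite sets only, and here every member arrives among the first N
   customers. *)
have AN : A `<=` `I_N.
  by move=> i /= [_ /andP[it _]]; rewrite ltnNge; apply/negP => /hN; rewrite ltNge it.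
rewrite in_fset_set; last exact: (sub_finite_set AN).
apply/idP/andP => [/set_mem Ak|[/and3P[/eqP pk1 pk2 pk3] _]].
  split; last exact: AN.
  by move: Ak => [/eqP h1 /andP[h2 h3]]; apply/and3P.
by apply/mem_set; split => //; apply/andP.
Qed.

Lemma queue_vectorE t w j : queue_vector S t w j = queue_length S t w j.
Proof. by rewrite ffunE. Qed.

Lemma leq_max_queue t w j : (queue_length S t w j <= max_queue S t w)%N.
Proof. by rewrite -queue_vectorE; exact: leq_bigmax. Qed.

Lemma max_queue_leP t w m :
  (max_queue S t w <= m)%N <-> forall j, (queue_length S t w j <= m)%N.
Proof.
split=> [H j|H]; first exact: leq_trans (leq_max_queue t w j) H.
by apply/bigmax_leqP => j _; rewrite queue_vectorE.
Qed.

Lemma max_queue_arg t w : (0 < n)%N ->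
  exists j, max_queue S t w = queue_length S t w j.
Proof.
move=> n0; have n1 : (0 < #|'I_n|)%N by rewrite card_ord.
have [j jE] := bigop.eq_bigmax (fun j => queue_vector S t w j) n1.
by exists j; rewrite /max_queue jE queue_vectorE.
Qed.

Variable lambda : R.
Hypothesis HS : is_supermarket S lambda.

Lemma arrivals_after t w :
  exists N, forall k, (N <= k)%N -> t < arrival_time S k w.
Proof.
have /cvgryPgt/(_ t) [N _ hN] := arrivals_locally_finite HS w.
by exists N => k Nk; exact: hN.
Qed.

Lemma measurable_initial_event (A : set {ffun 'I_n -> nat}) :
  measurable (X0 @^-1` A).
Proof.
rewrite (_ : _ @^-1` _ = \bigcup_(x in A) (X0 @^-1` [set x])).
  by apply: countable_bigcup_measurable => x _; exact: (measurable_initial_state HS).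
apply/seteqP; split => [w Aw|w [x Ax /= wx]]; last by rewrite /= wx.
by exists (X0 w).
Qed.

(** The number of terms in the initial work is random; on each of the countably many initial states
    it is constant. *)
Lemma measurable_by_initial d' (U : measurableType d') (f : {ffun 'I_n -> nat} -> T -> U) :
  (forall x, measurable_fun setT (f x)) ->
  measurable_fun setT (fun w => f (X0 w) w).
Proof.
move=> mf _ B mB; rewrite setTI.
rewrite (_ : _ @^-1` _ =
  \bigcup_x ((X0 @^-1` [set x]) `&` (f x @^-1` B))).
  apply: countable_bigcup_measurable => x _.
  apply: measurableI; first exact: measurable_initial_event.
  by rewrite -[X in measurable X]setTI; exact: mf.
by apply/seteqP; split => [w Bw|w [x _ [/= ->]]//]; exists (X0 w).
Qed.

Lemma measurable_queue_choice k (j : nat) : measurable [set w | ch k w = j].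
Proof.
exact: (@measurable_funPTI _ _ _ _ (ch k) [set j]).
Qed.

Lemma measurable_number_waiting N t j :
  measurable_fun setT (fun w => (number_waiting N t w j)%:R : R).
Proof.
pose f (x : {ffun 'I_n -> nat}) w : R := (initial_waiting (sg j ^~ w) (x j) t)%:R
  + (waiting (xi ^~ w) (sv ^~ w) (ch ^~ w) j (\sum_(l < x j) sg j l w) N t)%:R.
apply: (eq_measurable_fun (fun w => f (X0 w) w)).
  by move=> w _; rewrite /f /number_waiting natrD.
apply: measurable_by_initial => x; apply: measurable_funD.
  under eq_fun do rewrite /initial_waiting natr_sum.
  apply: measurable_sum => i; apply: measurable_natr_bool.
  apply: measurable_fun_ltr => //; apply: measurable_sum => l.
  exact: measurable_funPT.
apply: measurable_waiting => [k|k|k|]; first exact: measurable_funPT.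
- exact: measurable_funPT.
- exact: measurable_queue_choice.
- by apply: measurable_sum => l; exact: measurable_funPT.
Qed.

(** The truncation level required by [queue_lengthE] depends on the outcome, so the queue length is
    the pointwise limit of the truncated counts, each sequence being eventually constant. *)
Lemma measurable_queue_length t j :
  measurable_fun setT (fun w => (queue_length S t w j)%:R : R).
Proof.
apply: (@measurable_fun_cvg _ _ _ _ (fun N w => (number_waiting N t w j)%:R)).
  by move=> N; exact: measurable_number_waiting.
move=> w _; have [N hN] := arrivals_after t w.
apply: cvg_near_cst; exists N => // M /= NM.
by rewrite (@queue_lengthE M)// => k Mk; apply: hN; exact: leq_trans Mk.
Qed.

Lemma measurable_queue_length_event t j (A : set nat) :
  measurable [set w | A (queue_length S t w j)].
Proof.
rewrite (_ : [set w | _] = \bigcup_(m in A)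
  ((fun w => (queue_length S t w j)%:R : R) @^-1` [set m%:R])).
  apply: bigcup_measurable => m _; rewrite -[X in measurable X]setTI.
  exact: measurable_queue_length.
by apply/seteqP; split => [w Aw|w [m Am /= /eqP]];
  [exists (queue_length S t w j)|rewrite eqr_nat => /eqP ->].
Qed.

Lemma measurable_queue_vector t x : measurable [set w | queue_vector S t w = x].
Proof.
rewrite (_ : [set w | _] =
    \bigcap_(j in [set: 'I_n]) [set w | queue_length S t w j = x j]).
  apply: fin_bigcap_measurable; first exact: finite_finset.
  by move=> j _; exact: (measurable_queue_length_event t j [set x j]).
apply/seteqP; split => [w /= <- j _ /=|w h]; first by rewrite queue_vectorE.
by apply/ffunP => j; rewrite queue_vectorE; exact: h.
Qed.

Lemma measurable_queue_vector_event t (A : set {ffun 'I_n -> nat}) :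
  measurable [set w | A (queue_vector S t w)].
Proof.
rewrite (_ : [set w | _] = \bigcup_(x in A) [set w | queue_vector S t w = x]).
  by apply: countable_bigcup_measurable => x _; exact: measurable_queue_vector.
apply/seteqP; split => [w Aw|w [x Ax /= wx]]; last by rewrite /= wx.
by exists (queue_vector S t w).
Qed.

Lemma measurable_max_queue_event t (A : set nat) :
  measurable [set w | A (max_queue S t w)].
Proof.
exact: (measurable_queue_vector_event t
  [set x : {ffun 'I_n -> nat} | A (\max_(j < n) x j)%N]).
Qed.

Lemma measurable_max_queue t :
  measurable_fun setT (fun w => (max_queue S t w)%:R : R).
Proof.
move=> _ B mB; rewrite setTI.
exact: (measurable_max_queue_event t [set m | B m%:R]).
Qed.

(** Up to time t + 1 the state depends on finitely many comparisons [u < a] or [a <= u] with fixed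
    instants a, and each keeps its value just to the right of t. *)
Lemma queue_vector_right_continuous t w :
  \forall u \near t^'+, queue_vector S u w = queue_vector S t w.
Proof.
have [N hN] := arrivals_after (t + 1) w.
have lt_right (a : R) : \forall u \near t^'+, (u < a) = (t < a).
  have [ta|at_] := ltP t a.
    by near=> u; near: u; exact: nbhs_right_lt.
  by near=> u; apply/negbTE; rewrite -leNgt (le_trans at_)// ltW.
have le_right (a : R) : \forall u \near t^'+, (a <= u) = (a <= t).
  have := lt_right a; apply: filterS => u.
  by rewrite !leNgt => ->.
have hx (j : 'I_n) : \forall u \near t^'+, forall i : 'I_(X0 w j),
    (u < \sum_(l < i.+1) sg j l w) = (t < \sum_(l < i.+1) sg j l w).
  by apply: filter_forall => i; exact: lt_right.
have ha : \forall u \near t^'+, forall k : 'I_N,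
    (arrival (xi ^~ w) k <= u) = (arrival (xi ^~ w) k <= t).
  by apply: filter_forall => i; exact: le_right.
have hc (j : 'I_n) : \forall u \near t^'+, forall k : 'I_N,
    (u < clearing_time S j k.+1 w) = (t < clearing_time S j k.+1 w).
  by apply: filter_forall => i; exact: lt_right.
have hu : \forall u \near t^'+, forall j : 'I_n,
    number_waiting N u w j = number_waiting N t w j.
  apply: filter_forall => j.
  near=> u; have h1 := near (hx j) u; have h2 := near ha u.
  have h3 := near (hc j) u; rewrite /number_waiting.
  congr (_ + _)%N; apply: eq_bigr => i _; congr nat_of_bool.
    by rewrite h1//; near: u.
  by rewrite -!clearing_timeE h2 ?h3//; near: u.
near=> u; apply/ffunP => j; rewrite !queue_vectorE.
rewrite (@queue_lengthE N); last first.
  by move=> k /hN; apply: le_lt_trans; near: u; apply: nbhs_right_le; rewrite ltrDl.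
rewrite (@queue_lengthE N); last first.
  by move=> k /hN; apply: lt_trans; rewrite ltrDl.
by move: j; near: u.
Unshelve. all: by end_near. Qed.

End queue_paths.

(** * Extremes of a path over a time interval *)

Section extremal_paths.
Context d (T : measurableType d) (R : realType) (P : probability T R) (n : nat).
Variables (S : supermarket_input P n) (lambda : R).
Hypothesis HS : is_supermarket S lambda.
Implicit Types (t tau x : R) (w : T).

(** An enumeration of the nonnegative rationals, cut at tau: right-continuity says nothing inside
    the interval about the endpoint, so the cut puts tau itself in the sequence. *)
Definition dense_time tau (k : nat) : R :=
  Num.min tau `|ratr (odflt 0 (choice.unpickle k : option rat))|.

Lemma dense_time_itv tau k : 0 <= tau -> 0 <= dense_time tau k <= tau.
Proof. by move=> t0; rewrite /dense_time le_min t0 normr_ge0 ge_min lexx. Qed.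

(** A path is constant on a short interval to the right of each time, so each of its values is taken
    at a rational time or at tau. The extremes thus become countable ones, hence measurable. *)
Lemma max_queue_dense tau w : 0 <= tau ->
  [set ((max_queue S t w)%:R : R) | t in `[0, tau]]
  = range (fun k => (max_queue S (dense_time tau k) w)%:R).
Proof.
move=> tau0; apply/seteqP; split => [_ [t + <-]|_ [k _ <-]]; last first.
  by exists (dense_time tau k) => //=; rewrite in_itv/= dense_time_itv.
rewrite /= in_itv/= => /andP[t0 ttau].
suff [q [q0 qE]] : exists q : rat, 0 <= ratr q :> R /\
    max_queue S (Num.min tau (ratr q)) w = max_queue S t w.
  exists (choice.pickle q) => //; rewrite /dense_time choice.pickleK/=.
  by rewrite ger0_norm// qE.
move: ttau; rewrite le_eqVlt => /predU1P[->|ttau].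
  have [q /= /andP[tq _]] := @rat_in_itvoo R tau (tau + 1) (ltac:(by rewrite ltrDl)).
  by exists q; rewrite (min_idPl (ltW tq)) (le_trans tau0 (ltW tq)).
have [e /= e0 he] := queue_vector_right_continuous HS t w.
have lt_te : t < Num.min tau (t + e) by rewrite lt_min ttau ltrDl.
have [q] := @rat_in_itvoo R _ _ lt_te.
rewrite in_itv/= lt_min => /and3P[tq qtau qe].
exists q; rewrite (le_trans t0 (ltW tq)) (min_idPr (ltW qtau)); split => //.
rewrite /max_queue he// /ball/= ltr_norml; apply/andP; split; last by lra.
by lra.
Qed.

Lemma number_waiting_le N t w j :
  (number_waiting S N t w j <= initial_state S w j + N)%N.
Proof.
rewrite /number_waiting /initial_waiting /waiting.
by rewrite leq_add// -[leqRHS]card_ord -sum1_card; apply: leq_sum => i _; exact: leq_b1.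
Qed.

(** [sup] has a default value on unbounded sets. Local finiteness of the arrivals bounds the path by
    the initial customers plus those who arrive by time tau. *)
Lemma max_queue_has_ubound tau w :
  has_ubound [set ((max_queue S t w)%:R : R) | t in `[0, tau]].
Proof.
have [N hN] := arrivals_after HS tau w.
exists ((\sum_(j < n) initial_state S w j + N)%N%:R) => _ [t /= + <-].
rewrite in_itv/= => /andP[_ ttau]; rewrite ler_nat.
apply/max_queue_leP => j; rewrite (@queue_lengthE _ _ _ _ _ _ N).
  apply: leq_trans (number_waiting_le _ _ _ _) _; rewrite leq_add2r.
  by rewrite (bigD1 j)//= leq_addr.
by move=> k /hN; exact: le_lt_trans.
Qed.

Lemma max_queue_has_lbound tau w :
  has_lbound [set ((max_queue S t w)%:R : R) | t in `[0, tau]].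
Proof. by exists 0 => _ [t _ <-]. Qed.

Lemma min_max_queue_le tau t w : 0 <= t <= tau ->
  min_max_queue S tau w <= (max_queue S t w)%:R.
Proof.
move=> ttau; apply: ge_inf; first exact: max_queue_has_lbound.
by exists t => //=; rewrite in_itv.
Qed.

Lemma min_max_queue_ge tau x w : 0 <= tau ->
  (forall t, 0 <= t <= tau -> x <= (max_queue S t w)%:R) ->
  x <= min_max_queue S tau w.
Proof.
move=> tau0 H; apply: lb_le_inf.
  by exists (max_queue S 0 w)%:R, 0 => //=; rewrite in_itv/= lexx.
by move=> _ [t + <-]; rewrite /= in_itv; exact: H.
Qed.

Lemma max_max_queue_ge tau t w : 0 <= t <= tau ->
  (max_queue S t w)%:R <= max_max_queue S tau w.
Proof.
move=> ttau; apply: ub_le_sup; first exact: max_queue_has_ubound.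
by exists t => //=; rewrite in_itv.
Qed.

Lemma max_max_queue_le tau x w : 0 <= tau ->
  (forall t, 0 <= t <= tau -> (max_queue S t w)%:R <= x) ->
  max_max_queue S tau w <= x.
Proof.
move=> tau0 H; apply: ge_sup.
  by exists (max_queue S 0 w)%:R, 0 => //=; rewrite in_itv/= lexx.
by move=> _ [t + <-]; rewrite /= in_itv; exact: H.
Qed.

Lemma measurable_min_max_queue tau : 0 <= tau ->
  measurable_fun setT (min_max_queue S tau : T -> R).
Proof.
move=> tau0.
pose h k w : R := (max_queue S (dense_time tau k) w)%:R.
apply: (eq_measurable_fun (fun w => infs (h ^~ w) 0%N)).
  move=> w _; rewrite /min_max_queue max_queue_dense// /infs/= /sdrop.
  by congr inf; apply/seteqP; split => _ [k _ <-]; exists k.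
apply: measurable_fun_infs; first by move=> w _; exists 0 => _ [k _ <-].
by move=> k; exact: measurable_max_queue HS _.
Qed.

Lemma measurable_max_max_queue tau : 0 <= tau ->
  measurable_fun setT (max_max_queue S tau : T -> R).
Proof.
move=> tau0.
pose h k w : R := (max_queue S (dense_time tau k) w)%:R.
apply: (eq_measurable_fun (fun w => sups (h ^~ w) 0%N)).
  move=> w _; rewrite /max_max_queue max_queue_dense// /sups/= /sdrop.
  by congr sup; apply/seteqP; split => _ [k _ <-]; exists k.
apply: measurable_fun_sups => [w _|k]; last exact: measurable_max_queue HS _.
have := max_queue_has_ubound tau w.
by rewrite max_queue_dense.
Qed.

End extremal_paths.

(** * Expectations of products of independent variables *)

Section independence.
Context d (T : measurableType d) (R : realType) (P : probability T R).

Lemma mutually_independent_seq (I : eqType) (F : I -> set (set T))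
    (s : seq I) (A : I -> set T) :
  mutually_independent P F -> uniq s -> (forall i, i \in s -> F i (A i)) ->
  P (\bigcap_(i in [set` s]) A i) = (\prod_(i <- s) P (A i))%E.
Proof.
move=> indF us FA; pose t := in_tuple s.
rewrite (big_tnth _ _ s) -(indF _ (tnth t) (fun i => A (tnth t i))).
- congr (P _); apply/seteqP; split => [w h i _|w h i /= /seq_tnthP[k ->]].
    by apply: h; rewrite /= -/(in_tuple s); exact: mem_tnth.
  exact: h.
- exact/tuple_uniqP.
- by move=> i; apply: FA; exact: mem_tnth.
Qed.

End independence.

Section density.
Context d d' (T : measurableType d) (U : measurableType d') (R : realType).
Local Open Scope ereal_scope.
Import HBNNSimple.

Lemma integral_mul_indic (mu : {measure set T -> \bar R}) (A : set T)
    (Z : T -> \bar R) :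
  \int[mu]_w ((\1_A w)%:E * Z w) = \int[mu]_(w in A) Z w.
Proof.
rewrite [RHS]integral_mkcond epatch_indic.
by apply: eq_integral => w _; rewrite muleC.
Qed.

(** The hypothesis says that the measure of density Z, pushed forward by g, is c times nu; simple
    functions and monotone convergence pass from sets to f. It serves both for independence (nu the
    law of g, c the mean of Z) and for exponential laws (g the identity, Z the density, c = 1). *)
Lemma integral_density (mu : {measure set T -> \bar R})
    (nu : {measure set U -> \bar R}) (g : T -> U) (Z : T -> R)
    (c : \bar R) (f : U -> R) :
  measurable_fun setT g ->
  measurable_fun setT Z -> (forall w, 0 <= Z w)%R ->
  measurable_fun setT f -> (forall x, 0 <= f x)%R ->
  c \is a fin_num ->
  (forall B : set U, measurable B ->
     \int[mu]_(w in g @^-1` B) (Z w)%:E = nu B * c) ->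
  \int[mu]_w (f (g w) * Z w)%:E = \int[nu]_x (f x)%:E * c.
Proof.
move=> mg mZ Z0 mf f0 finc gZ.
have mfE : measurable_fun setT (EFin \o f) by exact/measurable_EFinP.
pose phi k : {nnsfun U >-> R} := nnsfun_approx measurableT mfE k.
have phi0 k x : (0 <= phi k x)%R by [].
have mZE : measurable_fun setT (EFin \o Z) by exact/measurable_EFinP.
have mphig k : measurable_fun setT (fun w => phi k (g w)).
  exact: measurableT_comp.
have mphigE k : measurable_fun setT (fun w => (phi k (g w))%:E).
  exact/measurable_EFinP.
have phi_nd x : {homo (fun k => phi k x) : m l / (m <= l)%N >-> (m <= l)%R}.
  by move=> m l ml; exact: (lefP _ _ (nd_nnsfun_approx measurableT mfE ml)).
have key k : \int[mu]_w (phi k (g w) * Z w)%:E = \int[nu]_x (phi k x)%:E * c.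
  pose s : seq R := fset_set (range (phi k)).
  pose A y := phi k @^-1` [set y].
  have mA y : measurable (A y) by exact: measurable_sfunP.
  have mgA y : measurable (g @^-1` A y).
    by rewrite -[X in measurable X]setTI; apply: mg.
  (* The values taken are nonnegative; [Num.max y 0] makes the coefficients nonnegative for every
     real y, as linearity for nonnegative integrands requires. *)
  have phiE x : (phi k x)%:E = \sum_(y <- s) ((Num.max y 0)%:E * (\1_(A y) x)%:E).
    rewrite fimfunE fsbig_finite//= -sumEFin big_seq [RHS]big_seq.
    apply: eq_bigr => y; rewrite in_fset_set// => /set_mem[z _ <-].
    by rewrite (max_idPl (phi0 _ _)).
  have m0 y : (0 <= Num.max y 0 :> R)%R by rewrite le_max lexx orbT.
  have mI y : measurable_fun setT (fun x => (\1_(A y) x)%:E : \bar R).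
    exact/measurable_EFinP/measurable_indic.
  have mIg y : measurable_fun setT (fun w => (\1_(g @^-1` A y) w)%:E : \bar R).
    exact/measurable_EFinP/measurable_indic.
  transitivity (\sum_(y <- s) (Num.max y 0)%:E * \int[mu]_(w in g @^-1` A y) (Z w)%:E).
    under eq_integral => w _.
      rewrite EFinM phiE ge0_sume_distrl; last by move=> y _; rewrite mule_ge0 ?lee_fin.
      under eq_bigr do rewrite -muleA.
      over.
    rewrite ge0_integral_sum//; last first.
    - by move=> y w _; rewrite !mule_ge0// lee_fin.
    - by move=> y; apply: measurable_funeM; apply: emeasurable_funM => //; exact: mIg.
    apply: eq_bigr => y _; rewrite ge0_integralZl_EFin//.
    - by rewrite -[in RHS]integral_mul_indic.
    - by move=> w _; rewrite mule_ge0// lee_fin.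
    - by apply: emeasurable_funM => //; exact: mIg.
  transitivity (\sum_(y <- s) (Num.max y 0)%:E * nu (A y) * c).
    by apply: eq_bigr => y _; rewrite gZ ?muleA.
  rewrite -ge0_sume_distrl; last by move=> y _; rewrite mule_ge0 ?lee_fin.
  congr (_ * _); under eq_integral do rewrite phiE.
  rewrite ge0_integral_sum//; last first.
  - by move=> y w _; rewrite mule_ge0 ?lee_fin.
  - by move=> y; exact: measurable_funeM.
  apply: eq_bigr => y _; rewrite ge0_integralZl_EFin//.
    by rewrite integral_indic// setIT.
have lim_phi x : EFin \o (phi ^~ x) @ \oo --> (f x)%:E.
  by rewrite -[(f x)%:E]/((EFin \o f) x); apply: cvg_nnsfun_approx => // y _; rewrite lee_fin.
have L : \int[mu]_w (phi k (g w) * Z w)%:E @[k --> \oo] --> \int[mu]_w (f (g w) * Z w)%:E.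
  have -> : \int[mu]_w (f (g w) * Z w)%:E
          = \int[mu]_w limn (fun k => (phi k (g w) * Z w)%:E).
    apply: eq_integral => w _; apply/esym/cvg_lim => //.
    under eq_fun do rewrite EFinM; rewrite EFinM; apply: cvgeZr => //.
    exact: lim_phi.
  apply: (@cvg_monotone_convergence _ _ _ mu setT measurableT
    (fun k w => (phi k (g w) * Z w)%:E)) => [k|k w _|w _ k l kl].
  - by apply/measurable_EFinP; exact: measurable_funM.
  - by rewrite lee_fin mulr_ge0.
  - by rewrite lee_fin ler_wpM2r// phi_nd.
have L' : \int[nu]_x (phi k x)%:E @[k --> \oo] --> \int[nu]_x (f x)%:E.
  have -> : \int[nu]_x (f x)%:E = \int[nu]_x limn (fun k => (phi k x)%:E).
    by apply: eq_integral => x _; apply/esym/cvg_lim => //; exact: lim_phi.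
  apply: (@cvg_monotone_convergence _ _ _ nu setT measurableT
    (fun k x => (phi k x)%:E)) => [k|k x _|x _ k l kl].
  - exact/measurable_EFinP.
  - by rewrite lee_fin.
  - by rewrite lee_fin phi_nd.
move: L' => /(cvgeZr finc) L'; rewrite -(cvg_lim _ L)// -(cvg_lim _ L')//.
by congr (limn _); apply/funext => k; rewrite key.
Qed.

End density.

Section product_of_independent.
Context d (T : measurableType d) (R : realType) (P : probability T R).
Local Open Scope ereal_scope.

Lemma integral_mul_indep (g Z : T -> R) :
  measurable_fun setT g -> (forall w, 0 <= g w)%R ->
  measurable_fun setT Z -> (forall w, 0 <= Z w)%R ->
  \int[P]_w (Z w)%:E \is a fin_num ->
  (forall B : set R, measurable B ->
     \int[P]_(w in g @^-1` B) (Z w)%:E = P (g @^-1` B) * \int[P]_w (Z w)%:E) ->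
  \int[P]_w (g w * Z w)%:E = \int[P]_w (g w)%:E * \int[P]_w (Z w)%:E.
Proof.
move=> mg g0 mZ Z0 finZ gZ.
pose X : {RV P >-> R} := HB.pack g (isMeasurableFun.Build _ _ _ _ g mg).
(* The identity on the values of g, made nonnegative on the whole line. *)
pose f (x : R) : R := Num.max x 0%R.
have mf : measurable_fun setT f by apply: measurable_maxr.
have f0 x : (0 <= f x)%R by rewrite le_max lexx orbT.
have fg w : f (g w) = g w by rewrite /f (max_idPl (g0 w)).
have := @integral_density _ _ _ _ _ P (distribution P X) g Z _ f mg mZ Z0 mf f0 finZ gZ.
under eq_integral do rewrite fg.
move=> ->; congr (_ * _); rewrite ge0_integral_distribution/=.
- by apply: eq_integral => w _ /=; rewrite fg.
- exact/measurable_EFinP.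
- by move=> x; rewrite lee_fin.
Qed.

(** Tilting the density of rate r by exp (theta x) gives r / (r - theta) times the density of rate r
    - theta, whose integral is 1. *)
Lemma exponential_mgf (X : {RV P >-> R}) (rate theta : R) :
  (0 < rate)%R -> (theta < rate)%R -> has_exponential_law X rate ->
  \int[P]_w (expR (theta * X w)%R)%:E = (rate / (rate - theta))%:E.
Proof.
move=> rate0 thr hX; pose f (x : R) := expR (theta * x)%R.
have mf : measurable_fun setT f.
  by apply: measurableT_comp => //; apply: measurable_funM.
have pdf0 (r : R) : (0 < r)%R -> forall x, (0 <= exponential_pdf r x)%R.
  by move=> r0 x; rewrite exponential_pdf_ge0// ltW.
transitivity (\int[distribution P X]_x (f x)%:E).
  rewrite ge0_integral_distribution//; first exact/measurable_EFinP.
  by move=> x; rewrite lee_fin expR_ge0.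
have one_fin : (1 : \bar R) \is a fin_num by [].
have := @integral_density _ _ _ _ _ lebesgue_measure (distribution P X)
   idfun (exponential_pdf rate) _ f _ (measurable_exponential_pdf rate) (pdf0 _ rate0)
   mf (fun x => expR_ge0 _) one_fin.
rewrite mule1 => <-//; last by move=> B mB; rewrite mule1; exact/esym/hX.
transitivity (\int[lebesgue_measure]_x
    ((rate / (rate - theta))%:E * (exponential_pdf (rate - theta) x)%:E)).
  apply: eq_integral => x _; rewrite -EFinM /=; congr EFin.
  rewrite /exponential_pdf /patch; case: ifPn => _; last by rewrite !mulr0.
  rewrite [RHS]mulrA divfK ?gt_eqF ?subr_gt0// mulrCA /f -expRD.
  by congr (_ * expR _)%R; ring.
rewrite ge0_integralZl_EFin//.
- by rewrite integral_exponential_pdf ?mule1 ?subr_gt0.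
- by move=> x _; rewrite lee_fin pdf0// subr_gt0.
- by apply/measurable_EFinP; exact: measurable_exponential_pdf.
- by apply: divr_ge0; rewrite ?subr_ge0 ltW.
- exact: measurable_id.
Qed.

End product_of_independent.

Section expectation_prod.
Context d (T : measurableType d) (R : realType) (P : probability T R).
Variables (I : eqType) (F : I -> set (set T)).
Hypotheses (indF : mutually_independent P F)
  (mF : forall v A, F v A -> measurable A).
Variables (f : I -> T -> R) (e : I -> R).
Hypotheses (Ff : forall v (B : set R), measurable B -> F v (f v @^-1` B))
  (f0 : forall v w, 0 <= f v w)
  (fe : forall v, (\int[P]_w (f v w)%:E = (e v)%:E)%E).

Let mf v : measurable_fun setT (f v).
Proof. by move=> _ B mB; rewrite setTI; apply: mF (Ff _ _). Qed.

Let measurable_bigcap_seq (s : seq I) (A : I -> set T) :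
  (forall v, v \in s -> F v (A v)) -> measurable (\bigcap_(v in [set` s]) A v).
Proof.
by move=> FA; apply: fin_bigcap_measurable => // v vs; apply: mF (FA v vs).
Qed.

(** The induction must carry events on further indices: to separate [f v] from the remaining
    product, this product is integrated over events about [f v], which is the induction hypothesis
    with v moved to the list of events. *)
Let integral_prod_setI (s1 s2 : seq I) (A : I -> set T) :
  uniq (s1 ++ s2) -> (forall v, v \in s2 -> F v (A v)) ->
  (\int[P]_(w in \bigcap_(v in [set` s2]) A v) (\prod_(v <- s1) f v w)%:E
   = (\prod_(v <- s1) e v)%:E * \prod_(v <- s2) P (A v))%E.
Proof.
elim: s1 s2 A => [|v s1 IH] s2 A.
  move=> us FA; under eq_integral do rewrite big_nil.
  rewrite integral_cst ?big_nil ?mul1e; last exact: measurable_bigcap_seq.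
  exact: (mutually_independent_seq indF).
move=> us FA.
set D := \bigcap_(_ in _) _.
have mD : measurable D by exact: measurable_bigcap_seq.
pose Z w := \1_D w * \prod_(u <- s1) f u w.
have mP (s : seq I) : measurable_fun setT (fun w => \prod_(u <- s) f u w).
  by apply: measurable_prod => u _; exact: mf.
have mZ : measurable_fun setT Z by apply: measurable_funM => //.
have P0 (s : seq I) w : 0 <= \prod_(u <- s) f u w by apply: prodr_ge0.
have Z0 w : 0 <= Z w by rewrite /Z mulr_ge0.
have us1 : uniq (s1 ++ s2) by move: us => /= /andP[].
have EZ : (\int[P]_w (Z w)%:E = (\prod_(u <- s1) e u)%:E * \prod_(u <- s2) P (A u))%E.
  by rewrite -IH// -[RHS]integral_mul_indic; apply: eq_integral => w _; rewrite EFinM.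
have finZ : (\int[P]_w (Z w)%:E)%E \is a fin_num.
  rewrite EZ fin_numM//; rewrite big_seq; apply: prode_fin_num => u us2; apply: fin_num_measure.
  by apply: mF; exact: FA us2.
transitivity (\int[P]_w (f v w * Z w)%:E)%E.
  rewrite -integral_mul_indic; apply: eq_integral => w _.
  by rewrite big_cons /Z -EFinM mulrCA.
rewrite (integral_mul_indep _ _ _ _ finZ)//; last first.
  move=> B mB; pose A' u := if u == v then f v @^-1` B else A u.
  have vs2 : v \notin s2.
    by move: us; rewrite /= mem_cat negb_or => /andP[/andP[]].
  have A's2 u : u \in s2 -> A' u = A u.
    by rewrite /A'; case: eqP => // -> ; rewrite (negbTE vs2).
  have := IH (v :: s2) A'; rewrite big_cons {3}/A' eqxx.
  have -> : (\prod_(u <- s2) P (A' u) = \prod_(u <- s2) P (A u))%E.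
    by rewrite big_seq [RHS]big_seq; apply: eq_bigr => u /A's2 ->.
  rewrite muleCA -EZ => <-.
  - rewrite -integral_mul_indic -[RHS]integral_mul_indic.
    apply: eq_integral => w _; rewrite /Z -!EFinM mulrA; congr (_ * _)%:E.
    rewrite -[LHS]/((\1_(f v @^-1` B) \* \1_D) w) -indicI; congr (\1_ _ _).
    apply/seteqP; split => [u [Bu Du] i|u Hu].
      rewrite /= inE => /predU1P[->|is2]; first by rewrite /A' eqxx.
      by rewrite A's2//; exact: Du.
    split; first by have := Hu v; rewrite /A' eqxx /=; apply; rewrite inE eqxx.
    by move=> i is2; rewrite -A's2//; apply: Hu; rewrite /= inE is2 orbT.
  - by rewrite (uniq_catCA s1 [:: v] s2).
  - move=> u; rewrite inE => /predU1P[->|us2]; first by rewrite /A' eqxx; exact: Ff.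
    by rewrite A's2//; exact: FA.
by rewrite fe EZ big_cons EFinM muleA.
Qed.

Lemma expectation_prod (s : seq I) : uniq s ->
  (\int[P]_w (\prod_(v <- s) f v w)%:E = (\prod_(v <- s) e v)%:E)%E.
Proof.
move=> us; have := @integral_prod_setI s [::] (fun=> setT).
rewrite cats0 us big_nil mule1 => <-//.
by congr integral; apply/seteqP; split.
Qed.

End expectation_prod.

(** * Probabilities as real numbers *)

Section real_probability.
Context d (T : measurableType d) (R : realType) (P : probability T R).
Implicit Types A B : set T.

Definition pr A : R := fine (P A).

Lemma prE A : measurable A -> P A = (pr A)%:E.
Proof. by move=> mA; rewrite /pr fineK// fin_num_measure. Qed.

Lemma pr_ge0 A : 0 <= pr A. Proof. exact/fine_ge0. Qed.

Lemma pr_le1 A : measurable A -> pr A <= 1.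
Proof. by move=> mA; rewrite -lee_fin -prE// probability_le1. Qed.

Lemma le_pr A B : measurable A -> measurable B -> A `<=` B -> pr A <= pr B.
Proof. by move=> mA mB AB; rewrite -lee_fin -!prE//; apply: le_measure => //; rewrite inE. Qed.

Lemma pr_setT : pr setT = 1. Proof. by rewrite /pr probability_setT. Qed.

Lemma pr_set0 : pr set0 = 0. Proof. by rewrite /pr measure0. Qed.

Lemma pr_setC A : measurable A -> pr (~` A) = 1 - pr A.
Proof.
move=> mA; apply: EFin_inj; rewrite -prE; last exact: measurableC.
by rewrite probability_setC// prE// EFinB.
Qed.

Lemma pr_setU_le A B : measurable A -> measurable B ->
  pr (A `|` B) <= pr A + pr B.
Proof.
move=> mA mB; have mAB := measurableU _ _ mA mB.
by rewrite -lee_fin EFinD -!prE// measureU2.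
Qed.

Lemma pr_bigcup_le (I : eqType) (s : seq I) (A : I -> set T) :
  (forall i, i \in s -> measurable (A i)) ->
  pr (\bigcup_(i in [set` s]) A i) <= \sum_(i <- s) pr (A i).
Proof.
elim: s => [|i s IH] mA.
  rewrite big_nil (_ : [set` [::]] = set0) ?bigcup_set0 ?pr_set0//.
  by apply/seteqP; split.
have mAi : measurable (A i) by apply: mA; rewrite inE eqxx.
have mAs j : j \in s -> measurable (A j) by move=> js; apply: mA; rewrite inE js orbT.
have mU : measurable (\bigcup_(i in [set` s]) A i).
  by apply: fin_bigcup_measurable => //= j; exact: mAs.
rewrite big_cons (_ : [set` i :: s] = i |` [set` s]); last first.
  apply/seteqP; split => j /=; first by rewrite inE => /predU1P.
  by rewrite inE => /predU1P.
rewrite bigcup_setU1.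
apply: le_trans (pr_setU_le _ _) _ => //.
by rewrite lerD2l IH.
Qed.

Lemma pr_bigcup_ord_le (N : nat) (A : nat -> set T) :
  (forall i, (i < N)%N -> measurable (A i)) ->
  pr (\bigcup_(i in `I_N) A i) <= \sum_(i < N) pr (A i).
Proof.
move=> mA; rewrite -(big_mkord xpredT (fun i => pr (A i))).
rewrite -(_ : [set` index_iota 0 N] = `I_N); last first.
  by apply/seteqP; split => i /=; rewrite mem_index_iota.
by apply: pr_bigcup_le => i; rewrite mem_index_iota; exact: mA.
Qed.

Lemma pr_bigcap_seq (I : eqType) (F : I -> set (set T)) (s : seq I)
    (A : I -> set T) :
  mutually_independent P F -> uniq s ->
  (forall i, i \in s -> F i (A i) /\ measurable (A i)) ->
  pr (\bigcap_(i in [set` s]) A i) = \prod_(i <- s) pr (A i).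
Proof.
move=> indF us FA; rewrite /pr (mutually_independent_seq indF us); last first.
  by move=> i /FA[].
have mA i : i \in s -> measurable (A i) by move=> /FA[].
elim: s {us FA} mA => [|i s IH] mA; first by rewrite !big_nil.
rewrite !big_cons fineM ?fin_num_measure//; last 2 first.
- by apply: mA; rewrite inE eqxx.
- rewrite big_seq; apply: prode_fin_num => j js; apply: fin_num_measure.
  by apply: mA; rewrite inE js orbT.
by rewrite IH// => j js; apply: mA; rewrite inE js orbT.
Qed.

(** A linear relation between indicators that may fail on B only is integrated into a relation
    between probabilities, with an error of order pr B. In the balance equations B is the event of
    two changes in a short time. *)
Lemma pr_combination (I : Type) (s : seq I) (c : I -> R) (A : I -> set T)
    (B : set T) :
  (forall i, measurable (A i)) -> measurable B ->
  (forall w, ~ B w -> \sum_(i <- s) c i * \1_(A i) w = 0) ->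
  `|\sum_(i <- s) c i * pr (A i)| <= (\sum_(i <- s) `|c i|) * pr B.
Proof.
move=> mA mB AB.
have EP C : measurable C -> (\int[P]_w (\1_C w)%:E = (pr C)%:E :> \bar R)%E.
  by move=> mC; rewrite integral_indic// setIT; exact: prE.
have I1 C : measurable C -> P.-integrable setT (EFin \o (\1_C : T -> R)).
  by move=> mC; exact: integrable_indic.
have IE : (\int[P]_w (\sum_(i <- s) c i * \1_(A i) w)%:E
          = (\sum_(i <- s) c i * pr (A i))%:E)%E.
  under eq_integral do rewrite -sumEFin.
  rewrite integral_sum//; last first.
    move=> i; under eq_fun do rewrite EFinM.
    by apply: integrableZl => //; exact: I1.
  rewrite -sumEFin; apply: eq_bigr => i _.
  under eq_integral do rewrite EFinM.
  by rewrite integralZl// ?EP//; exact: I1.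
have mS : measurable_fun setT (fun w => \sum_(i <- s) c i * \1_(A i) w).
  by apply: measurable_sum => i; apply: measurable_funM => //.
rewrite -lee_fin -abse_EFin -IE.
apply: (le_trans (le_abse_integral _ _ _)) => //; first exact/measurable_EFinP.
have mBE : measurable_fun setT (fun w => (\1_B w)%:E : \bar R).
  exact/measurable_EFinP/measurable_indic.
rewrite EFinM -EP// -ge0_integralZl//; last first.
  by rewrite lee_fin sumr_ge0.
apply: ge0_le_integral => //.
- by apply/measurable_EFinP/measurableT_comp.
- exact: measurable_funeM.
move=> w _ /=; rewrite lee_fin.
have [Bw|nBw] := pselect (B w); last first.
  by rewrite AB// normr0 indicE memNset// mulr0.
rewrite [\1_B w]indicE mem_set// mulr1.
apply: le_trans (ler_norm_sum _ _ _) _; apply: ler_sum => i _.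
by rewrite normrM ler_piMr// indicE; case: (_ \in _); rewrite ?normr1 ?normr0.
Qed.

Lemma exponential_law_le (X : {RV P >-> R}) (rate h : R) :
  0 < rate -> 0 < h -> has_exponential_law X rate ->
  pr (X @^-1` `]-oo, h]) = 1 - expR (- rate * h).
Proof.
move=> r0 h0 hX; apply: EFin_inj; rewrite -prE; last exact: measurable_funPTI.
rewrite -[LHS]/(distribution P X `]-oo, h]) hX// EFinB.
rewrite -exponential_prob_itv0c// /exponential_prob.
rewrite (itv_bndbnd_setU (x := BLeft 0)) ?bnd_simp//; last exact: ltW.
rewrite ge0_integral_setU//=.
- rewrite integral0_eq ?add0e// => x; rewrite /= in_itv/= => x0.
  by rewrite lt0_exponential_pdf.
- by apply/measurable_EFinP/measurable_funTS; exact: measurable_exponential_pdf.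
- by move=> x _; rewrite lee_fin exponential_pdf_ge0// ltW.
- apply/disj_setPS => x [] /=; rewrite !in_itv/= => x0 /andP[].
  by rewrite leNgt x0.
Qed.

Lemma exponential_law_ge0 (X : {RV P >-> R}) (rate : R) :
  has_exponential_law X rate -> pr (X @^-1` `]-oo, 0[) = 0.
Proof.
move=> hX; rewrite /pr -[P _]/(distribution P X `]-oo, 0[) hX// /exponential_prob.
rewrite integral0_eq// => x; rewrite /= in_itv/= => x0.
by rewrite lt0_exponential_pdf.
Qed.

End real_probability.

(** An injection that gives [input_index] a decidable equality, on which duplicate-free lists of
    inputs rely. *)
Definition input_code n (v : input_index n) : nat * nat * nat :=
  match v with
  | InitialState => (0, 0, 0)
  | Interarrival k => (1, k, 0)
  | QueueChoice k => (2, k, 0)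
  | Service k => (3, k, 0)
  | InitialService j i => (4, val j, i)
  end%N.

Lemma input_code_inj n : injective (@input_code n).
Proof.
by move=> [|k|k|k|j i] [|l|l|l|j' i'] //= [] => [->|->|->|/val_inj -> ->].
Qed.

HB.instance Definition _ n :=
  Equality.copy (input_index n) (inj_type (@input_code_inj n)).

(** * The exponential clocks *)

Section clocks.
Context d (T : measurableType d) (R : realType) (P : probability T R) (n : nat).
Variables (S : supermarket_input P n) (lambda : R).
Hypotheses (HS : is_supermarket S lambda) (lambda0 : 0 < lambda) (n0 : (0 < n)%N).

Local Notation F := (input_sigma_algebra S).
Local Notation X0 := (initial_state S).
Local Notation pr := (pr P).

Definition clock (v : input_index n) (w : T) : R :=
  match v with
  | Interarrival k => interarrival S k w
  | Service k => service S k w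
  | InitialService j i => initial_service S j i w
  | _ => 0
  end.

Definition clock_rate (v : input_index n) : R :=
  if v is Interarrival _ then lambda * n%:R else 1.

Definition is_clock (v : input_index n) : bool :=
  match v with InitialState | QueueChoice _ => false | _ => true end.

Lemma rate_gt0 v : 0 < clock_rate v.
Proof. by case: v => //= k; rewrite mulr_gt0// ltr0n. Qed.

Lemma input_measurable v A : F v A -> measurable A.
Proof.
case: v => [|k|k|k|j i] /=.
- by move=> [B _ <-]; exact: measurable_initial_event HS _.
- by move=> [B mB <-]; rewrite setTI; exact: measurable_funPTI.
- by move=> [B mB <-]; rewrite setTI; exact: measurable_funPTI.
- by move=> [B mB <-]; rewrite setTI; exact: measurable_funPTI.
- by move=> [B mB <-]; rewrite setTI; exact: measurable_funPTI.
Qed.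

Lemma input_setT v : F v setT.
Proof. by case: v => [|k|k|k|j i] /=; exists setT; rewrite ?setTI. Qed.

Lemma input_set0 v : F v set0.
Proof.
by case: v => [|k|k|k|j i] /=; exists set0; rewrite ?setI0 ?preimage_set0.
Qed.

Lemma clock_input v (B : set R) : measurable B -> F v (clock v @^-1` B).
Proof.
move=> mB; case: v => [|k|k|k|j i] /=.
- rewrite preimage_cst; case: ifPn => _; first exact: (input_setT (InitialState n)).
  exact: (input_set0 (InitialState n)).
- by exists B; rewrite ?setTI.
- rewrite preimage_cst; case: ifPn => _; first exact: (input_setT (QueueChoice n k)).
  exact: (input_set0 (QueueChoice n k)).
- by exists B; rewrite ?setTI.
- by exists B; rewrite ?setTI.
Qed.

Lemma choice_input k (B : set nat) : F (QueueChoice n k) (queue_choice S k @^-1` B).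
Proof. by exists B; rewrite ?setTI. Qed.

Lemma initial_input (B : set {ffun 'I_n -> nat}) : F (InitialState n) (X0 @^-1` B).
Proof. by exists B. Qed.

Definition short (v : input_index n) (h : R) : set T := clock v @^-1` `]-oo, h].

Lemma short_input v h : F v (short v h).
Proof. by apply: clock_input; exact: measurable_itv. Qed.

Lemma measurable_short v h : measurable (short v h).
Proof. exact: input_measurable (short_input v h). Qed.

Lemma pr_short v h : is_clock v -> 0 < h ->
  pr (short v h) = 1 - expR (- clock_rate v * h).
Proof.
case: v => [|k|k|k|j i] //= _ h0; rewrite /short /=.
- apply: (@exponential_law_le _ _ _ P (interarrival S k)) => //.
    by rewrite mulr_gt0// ltr0n.
  exact: interarrival_law HS k.
- apply: (@exponential_law_le _ _ _ P (service S k)) => //.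
  exact: service_law HS k.
- apply: (@exponential_law_le _ _ _ P (initial_service S j i)) => //.
  exact: initial_service_law HS j i.
Qed.

Lemma pr_short_le v h : is_clock v -> 0 < h -> pr (short v h) <= clock_rate v * h.
Proof.
move=> cv h0; rewrite pr_short//.
by have := expR_ge1Dx (- clock_rate v * h); lra.
Qed.

(** An exponential law gives nonnegative values only almost surely, whereas the pathwise lemmas need
    them everywhere; this event of probability 1 is where those lemmas apply. *)
Definition nonneg_clocks : set T := [set w | forall v, 0 <= clock v w].

Let negative_clock (k : nat) : set T :=
  (clock (Interarrival n k) @^-1` `]-oo, 0[ `|` clock (Service n k) @^-1` `]-oo, 0[)
  `|` \bigcup_(j in [set` enum 'I_n]) clock (InitialService j k) @^-1` `]-oo, 0[.

Let measurable_neg v : measurable (clock v @^-1` `]-oo, 0[).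
Proof. by apply: input_measurable (clock_input v _). Qed.

Let measurable_negative_clock k : measurable (negative_clock k).
Proof.
by apply: measurableU; [exact: measurableU|exact: fin_bigcup_measurable].
Qed.

Let nonneg_clocksE : ~` nonneg_clocks = \bigcup_k negative_clock k.
Proof.
apply/seteqP; split => w /=.
  move=> /existsNP[v] /negP; rewrite -ltNge => cv.
  case: v cv => [|k|k|k|j i] /=; rewrite ?ltxx// => cv.
  - by exists k => //; left; left; rewrite /= in_itv.
  - by exists k => //; left; right; rewrite /= in_itv.
  - by exists i => //; right; exists j; rewrite /= ?in_itv// mem_enum.
have neg v : (clock v @^-1` `]-oo, 0[) w -> ~ nonneg_clocks w.
  by rewrite /= in_itv/= => h /(_ v); rewrite leNgt h.
by move=> [k _ [[/neg|/neg]|[j _ /neg]]].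
Qed.

Lemma measurable_nonneg_clocks : measurable nonneg_clocks.
Proof.
rewrite -[X in measurable X]setCK nonneg_clocksE.
by apply: measurableC; exact: bigcup_measurable.
Qed.

Lemma pr_nonneg_clocksC : pr (~` nonneg_clocks) = 0.
Proof.
have neg0 v : is_clock v -> P (clock v @^-1` `]-oo, 0[) = 0%E.
  move=> cv; rewrite prE//; congr EFin.
  case: v cv => [|k|k|k|j i] //= _.
  - exact: (exponential_law_ge0 (interarrival_law HS k)).
  - exact: (exponential_law_ge0 (service_law HS k)).
  - exact: (exponential_law_ge0 (initial_service_law HS j i)).
suff : P.-negligible (~` nonneg_clocks).
  move=> /negligibleP H; rewrite /pr H//.
  exact: measurableC measurable_nonneg_clocks.
rewrite nonneg_clocksE; apply: negligible_bigcup => k.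
have ng v : is_clock v -> P.-negligible (clock v @^-1` `]-oo, 0[).
  by move=> cv; apply/negligibleP => //; exact: neg0.
apply: negligibleU; first by apply: negligibleU; exact: ng.
rewrite (_ : \bigcup_(j in _) _ = \bigcup_k0
   (if insub k0 is Some j then clock (InitialService j k) @^-1` `]-oo, 0[ else set0)).
  apply: negligible_bigcup => i; case: insub => [j|]; first exact: ng.
  exact: negligible_set0.
apply/seteqP; split => w [i _ Hi]; first by exists (val i) => //; rewrite valK.
by move: Hi; case: insub => // j Hj; exists j => //=; rewrite mem_enum.
Qed.

End clocks.

(** * The stationary law *)

Section small_times.
Context {R : realType}.
Implicit Types (sig : nat -> R) (h : R).

Let sum_ge sig (m i : nat) : (m < i)%N -> (forall l, 0 <= sig l) ->
  sig m <= \sum_(l < i) sig l.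
Proof.
move=> mi s0; rewrite (bigD1 (Ordinal mi))//= lerDl.
by apply: sumr_ge0 => l _.
Qed.

Lemma initial_waiting_none sig x h : (forall l, 0 <= sig l) -> h < sig 0%N ->
  initial_waiting sig x h = x.
Proof.
move=> s0 h0; rewrite /initial_waiting -[RHS]card_ord -sum1_card.
apply: eq_bigr => i _; apply/eqP; rewrite eqb1.
exact: lt_le_trans h0 (sum_ge _ s0).
Qed.

Lemma initial_waiting_one sig x h : (forall l, 0 <= sig l) ->
  sig 0%N <= h -> h < sig 1%N -> initial_waiting sig x h = x.-1.
Proof.
move=> s0 h0 h1; rewrite /initial_waiting; case: x => [|x]; first by rewrite big_ord0.
rewrite big_ord_recl big_ord1 ltNge h0 add0n -[RHS]card_ord -sum1_card.
apply: eq_bigr => i _; apply/eqP; rewrite eqb1.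
exact: lt_le_trans h1 (sum_ge _ s0).
Qed.

End small_times.

Section local_expansion.
Context d (T : measurableType d) (R : realType) (P : probability T R) (n : nat).
Variables (S : supermarket_input P n) (lambda : R).
Hypotheses (HS : is_supermarket S lambda) (lambda0 : 0 < lambda) (n0 : (0 < n)%N).

Local Notation F := (input_sigma_algebra S).
Local Notation X0 := (initial_state S).
Local Notation pr := (pr P).
Local Notation state := {ffun 'I_n -> nat}.

Definition push (j : 'I_n) (x : state) : state := [ffun i => (x i + (i == j))%N].
(** The subtraction is truncated: the clock of an empty queue may ring without effect, so all the
    servers have rate 1 in every state. *)
Definition pop (j : 'I_n) (x : state) : state := [ffun i => (x i - (i == j))%N].

Let A0 := Interarrival n 0.
Let A1 := Interarrival n 1.
Let S0 := Service n 0.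
Let I0 (j : 'I_n) := InitialService j 0.
Let I1 (j : 'I_n) := InitialService j 1.

(** The first arrival and the first initial service of each queue are the changes of order h; the
    other clocks must also ring before h for a second arrival or a second departure to occur. *)
Definition first_clocks : seq (input_index n) :=
  [:: A0; A1; S0] ++ [seq I0 j | j <- enum 'I_n] ++ [seq I1 j | j <- enum 'I_n].

Definition clock_pairs :=
  [seq p <- [seq (v, v') | v <- first_clocks, v' <- first_clocks] | p.1 != p.2].

Definition two_short (h : R) : set T :=
  ~` nonneg_clocks S `|`
  \bigcup_(p in [set` clock_pairs]) (short S p.1 h `&` short S p.2 h).

Lemma first_clocks_is_clock v : v \in first_clocks -> is_clock v.
Proof.
rewrite !mem_cat !in_cons in_nil orbF -!orbA => /or4P[/eqP->|/eqP->|/eqP->|] //.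
by move=> /orP[] /mapP[j _ ->].
Qed.

Lemma measurable_two_short h : measurable (two_short h).
Proof.
apply: measurableU; first exact/measurableC/(measurable_nonneg_clocks HS).
by apply: fin_bigcup_measurable => // p _; apply: measurableI; exact: measurable_short HS _ _.
Qed.

Lemma pr_two_short : exists2 C, 0 <= C & forall h, 0 < h -> pr (two_short h) <= C * h ^+ 2.
Proof.
exists (\sum_(p <- clock_pairs) (clock_rate lambda p.1 * clock_rate lambda p.2)).
  by apply: sumr_ge0 => p _; rewrite mulr_ge0// ltW// (rate_gt0 lambda0 n0).
move=> h h0; apply: le_trans (pr_setU_le _ _ _) _.
- exact/measurableC/(measurable_nonneg_clocks HS).
- by apply: fin_bigcup_measurable => // p _; apply: measurableI; exact: measurable_short HS _ _.
rewrite (pr_nonneg_clocksC HS) add0r; apply: le_trans (pr_bigcup_le _ _) _.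
  by move=> p _; apply: measurableI; exact: measurable_short HS _ _.
rewrite mulr_suml big_seq [leRHS]big_seq; apply: ler_sum => -[v v'].
rewrite mem_filter => /andP[vv' /allpairsP[[a b] [/= ha hb [va vb]]]].
have ca := first_clocks_is_clock ha; have cb := first_clocks_is_clock hb.
rewrite -va -vb in ca cb.
rewrite (_ : _ `&` _ = \bigcap_(u in [set` [:: v; v']]) short S u h); last first.
  apply/seteqP; split => w /=.
    by move=> [h1 h2] u /=; rewrite !in_cons in_nil orbF => /orP[] /eqP ->.
  by move=> H; split; apply: H; rewrite /= !in_cons eqxx ?orbT.
rewrite (pr_bigcap_seq (input_independent HS)).
- rewrite !big_cons big_nil mulr1 expr2 mulrACA.
  by apply: ler_pM; rewrite ?pr_ge0//; exact: (pr_short_le HS lambda0 n0).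
- by rewrite /= andbT inE vv'.
- by move=> u _; split; [exact: short_input|exact: measurable_short HS _ _].
Qed.

Lemma no_arrival_length h w (j : 'I_n) : nonneg_clocks S w ->
  h < interarrival S 0 w ->
  queue_length S h w j = initial_waiting (initial_service S j ^~ w) (X0 w j) h.
Proof.
move=> nn hA; rewrite (@queue_lengthE _ _ _ _ _ _ 0).
  by rewrite /number_waiting /waiting big_ord0 addn0.
move=> k _; apply: lt_le_trans hA _; rewrite /arrival_time big_ord_recl lerDl.
by apply: sumr_ge0 => i _; exact: (nn (Interarrival n _)).
Qed.

Lemma one_arrival_length h w (j : 'I_n) : nonneg_clocks S w ->
  interarrival S 0 w <= h -> h < interarrival S 1 w -> h < service S 0 w ->
  queue_length S h w j = (initial_waiting (initial_service S j ^~ w) (X0 w j) h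
                          + (queue_choice S 0 w == j))%N.
Proof.
move=> nn hA0 hA1 hS; rewrite (@queue_lengthE _ _ _ _ _ _ 1).
  rewrite /number_waiting /waiting big_ord1; congr (_ + _)%N.
  rewrite clearingS; case: eqP => //= _; rewrite /arrival big_ord1 hA0/=.
  rewrite (lt_le_trans hS)// lerDr le_max.
  by apply/orP; left; exact: (nn A0).
move=> [//|k] _; apply: lt_le_trans hA1 _.
rewrite /arrival_time big_ord_recl big_ord_recl/= addrCA lerDl.
rewrite addr_ge0 ?(nn A0)//.
by apply: sumr_ge0 => i _; exact: (nn (Interarrival n _)).
Qed.

Lemma single_short h w v v' : ~ two_short h w -> v \in first_clocks ->
  v' \in first_clocks -> v != v' -> clock S v w <= h -> h < clock S v' w.
Proof.
move=> /not_orP[_ H] vf v'f vv' vh; rewrite ltNge; apply/negP => v'h; apply: H.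
exists (v, v'); last by split; rewrite /short /= in_itv.
by rewrite /= mem_filter vv'; apply/allpairsP; exists (v, v').
Qed.

(* Off the event that two of the first clocks ring before h, the state at time
   h is determined by the one clock that rang. *)
Lemma state_change h w y : ~ two_short h w ->
  (queue_vector S h w == y)%:R - (X0 w == y)%:R
  = \sum_(j <- enum 'I_n) ((clock S A0 w <= h)%R && (queue_choice S 0 w == j :> nat))%:R
       * ((push j (X0 w) == y)%:R - (X0 w == y)%:R)
  + \sum_(j <- enum 'I_n) (clock S (I0 j) w <= h)%R%:R
       * ((pop j (X0 w) == y)%:R - (X0 w == y)%:R) :> R.
Proof.
move=> ntw; have nn : nonneg_clocks S w by move: ntw => /not_orP[/contrapT].
have mA0 : A0 \in first_clocks by rewrite !in_cons eqxx.
have mA1 : A1 \in first_clocks by rewrite !in_cons eqxx ?orbT.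
have mS0 : S0 \in first_clocks by rewrite !in_cons eqxx ?orbT.
have mI0 j : I0 j \in first_clocks.
  by rewrite !(in_cons, mem_cat) map_f ?orbT// mem_enum.
have mI1 j : I1 j \in first_clocks.
  by rewrite !(in_cons, mem_cat) (map_f I1) ?orbT// mem_enum.
have I0inj j j' : j != j' -> I0 j != I0 j'.
  by apply: contra => /eqP[->].
have I01 j j' : I0 j != I1 j' by apply/eqP.
have nnI j l : 0 <= initial_service S j l w by exact: (nn (InitialService j l)).
have [A0h|A0h] := leP (clock S A0 w) h.
  have hI j : h < clock S (I0 j) w by apply: (single_short ntw mA0) => //; apply/eqP.
  rewrite [X in _ = _ + X]big1 ?addr0; last first.
    by move=> j _; rewrite leNgt hI mul0r.
  have qE : queue_vector S h w = [ffun j => (X0 w j + (queue_choice S 0 w == j :> nat))%N].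
    apply/ffunP => j; rewrite queue_vectorE ffunE one_arrival_length//.
    - by rewrite initial_waiting_none//; exact: hI.
    - by apply: (single_short ntw mA0 mA1) => //; apply/eqP.
    - by apply: (single_short ntw mA0 mS0) => //; apply/eqP.
  have [[j jE]|nj] := pselect (exists j : 'I_n, queue_choice S 0 w = j).
    rewrite (_ : queue_vector S h w = push j (X0 w)); last first.
      rewrite qE; apply/ffunP => i; rewrite !ffunE jE; congr (_ + _)%N.
      by rewrite eq_sym val_eqE.
    rewrite big_enum (bigD1 j)//= jE eqxx mul1r big1 ?addr0// => i ij.
    by rewrite val_eqE eq_sym (negbTE ij) mul0r.
  have nchj (j : 'I_n) : (queue_choice S 0 w == j :> nat) = false.
    by apply/eqP => jE; apply: nj; exists j.
  rewrite big1 => [|j _]; last by rewrite nchj mul0r.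
  rewrite (_ : queue_vector S h w = X0 w) ?subrr//.
  by rewrite qE; apply/ffunP => j; rewrite ffunE nchj addn0.
rewrite [X in _ = X + _]big1 ?add0r; last by move=> j _; rewrite mul0r.
have [[j jh]|nj] := pselect (exists j, clock S (I0 j) w <= h).
  have hI i : i != j -> h < clock S (I0 i) w.
    by move=> ij; apply: (single_short ntw (mI0 j)) => //; rewrite eq_sym I0inj.
  rewrite (_ : queue_vector S h w = pop j (X0 w)); last first.
    apply/ffunP => i; rewrite queue_vectorE no_arrival_length// ffunE.
    have [->|ij] := eqVneq i j.
      rewrite initial_waiting_one// ?subn1//.
      exact: (single_short ntw (mI0 j) (mI1 j)).
    by rewrite initial_waiting_none ?subn0//; exact: hI.
  rewrite big_enum (bigD1 j)//= jh mul1r big1 ?addr0// => i ij.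
  by rewrite leNgt hI// mul0r.
rewrite big1 => [|j _]; last first.
  by have [jh|] := leP (clock S (I0 j) w) h; rewrite ?mul0r//; case: nj; exists j.
suff -> : queue_vector S h w = X0 w by rewrite subrr.
apply/ffunP => j; rewrite queue_vectorE no_arrival_length// initial_waiting_none//.
by rewrite ltNge; apply/negP => jh; apply: nj; exists j.
Qed.

End local_expansion.

(** * Balance equations *)

Section balance.
Context d (T : measurableType d) (R : realType) (P : probability T R) (n : nat).
Variables (S : supermarket_input P n) (lambda : R).
Hypotheses (HS : is_supermarket S lambda) (lambda0 : 0 < lambda) (n0 : (0 < n)%N).

Local Notation F := (input_sigma_algebra S).
Local Notation X0 := (initial_state S).
Local Notation pr := (pr P).
Local Notation state := {ffun 'I_n -> nat}.

Lemma pr_choice k (j : 'I_n) : pr (queue_choice S k @^-1` [set val j]) = n%:R^-1.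
Proof. by rewrite /pr (queue_choice_law HS k j). Qed.

Lemma pr_short_arrival h (j : 'I_n) (B : set state) :
  pr (short S (Interarrival n 0) h `&`
      (queue_choice S 0 @^-1` [set val j] `&` X0 @^-1` B))
  = pr (short S (Interarrival n 0) h) * n%:R^-1 * pr (X0 @^-1` B).
Proof.
pose A (v : input_index n) := match v with
  | InitialState => X0 @^-1` B
  | QueueChoice _ => queue_choice S 0 @^-1` [set val j]
  | v => short S v h end.
pose s := [:: Interarrival n 0; QueueChoice n 0; InitialState n].
have us : uniq s by [].
have := pr_bigcap_seq (A := A) (input_independent HS) us.
rewrite !big_cons big_nil mulr1 /= pr_choice mulrA => <-.
  congr (pr _); apply/seteqP; split => w.
    move=> [h1 [h2 h3]] v /=; rewrite !in_cons in_nil orbF.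
    by move=> /or3P[] /eqP ->.
  move=> H; split; first by apply: (H (Interarrival n 0)); rewrite /= !in_cons eqxx.
  split; first by apply: (H (QueueChoice n 0)); rewrite /= !in_cons eqxx ?orbT.
  by apply: (H (InitialState n)); rewrite /= !in_cons eqxx ?orbT.
move=> v; rewrite !in_cons in_nil orbF => vs.
suff FA : F v (A v) by split => //; exact: (input_measurable HS FA).
move: vs => /or3P[] /eqP ->; [exact: short_input|exact: choice_input|].
exact: initial_input.
Qed.

Lemma pr_short_initial h (j : 'I_n) (B : set state) :
  pr (short S (InitialService j 0) h `&` X0 @^-1` B)
  = pr (short S (InitialService j 0) h) * pr (X0 @^-1` B).
Proof.
pose A (v : input_index n) := match v with
  | InitialState => X0 @^-1` B | v => short S v h end.
pose s := [:: InitialService j 0; InitialState n].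
have us : uniq s by [].
have := pr_bigcap_seq (A := A) (input_independent HS) us.
rewrite !big_cons big_nil mulr1 /= => <-.
  congr (pr _); apply/seteqP; split => w.
    by move=> [h1 h2] v /=; rewrite !in_cons in_nil orbF => /orP[] /eqP ->.
  move=> H; split; first by apply: (H (InitialService j 0)); rewrite /= !in_cons eqxx.
  by apply: (H (InitialState n)); rewrite /= !in_cons eqxx ?orbT.
move=> v; rewrite !in_cons in_nil orbF => vs.
suff FA : F v (A v) by split => //; exact: (input_measurable HS FA).
by move: vs => /orP[] /eqP ->; [exact: short_input|exact: initial_input].
Qed.

(** Names for the indicators in the identity [state_change], so that [pr_combination] applies. None
    stands for the state at time h or 0 and Some j for a change at queue j; the first boolean
    separates arrivals from departures, the second the new state from the old one. *)
Let term : Type := (option 'I_n * bool * bool)%type.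

Let event h (y : state) (i : term) : set T :=
  match i with
  | (None, _, true) => [set w | queue_vector S h w = y]
  | (None, _, false) => X0 @^-1` [set y]
  | (Some j, true, b) => short S (Interarrival n 0) h `&`
      (queue_choice S 0 @^-1` [set val j] `&`
       X0 @^-1` [set x | (if b then push j x else x) = y])
  | (Some j, false, b) => short S (InitialService j 0) h `&`
       X0 @^-1` [set x | (if b then pop j x else x) = y]
  end.

Let coef (i : term) : R := if i.1.1 is None then (-1) ^+ ~~ i.2 else - (-1) ^+ ~~ i.2.

Let terms : seq term := [:: (None, true, true); (None, true, false)]
  ++ [seq (Some j, true, true) | j <- enum 'I_n]
  ++ [seq (Some j, true, false) | j <- enum 'I_n]
  ++ [seq (Some j, false, true) | j <- enum 'I_n]
  ++ [seq (Some j, false, false) | j <- enum 'I_n].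

Let sum_terms (f : term -> R) : \sum_(i <- terms) coef i * f i
  = (f (None, true, true) - f (None, true, false))
    - \sum_(j <- enum 'I_n) (f (Some j, true, true) - f (Some j, true, false))
    - \sum_(j <- enum 'I_n) (f (Some j, false, true) - f (Some j, false, false)).
Proof.
rewrite /terms !big_cat/= !big_cons big_nil !big_map /coef/= !expr0 !expr1.
rewrite !mul1r !opprK !sumrB.
under eq_bigr do rewrite mulN1r.
under [X in _ + (_ + (X + _))]eq_bigr do rewrite mul1r.
under [X in _ + (_ + (_ + (X + _)))]eq_bigr do rewrite mulN1r.
under [X in _ + (_ + (_ + (_ + X)))]eq_bigr do rewrite mul1r.
rewrite !sumrN; ring.
Qed.

Let measurable_event h y i : measurable (event h y i).
Proof.
case: i => [[[j|] [] ] b] /=.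
- apply: measurableI; first exact: measurable_short HS _ _.
  apply: measurableI; last exact: measurable_initial_event HS _.
  exact: measurable_queue_choice.
- apply: measurableI; first exact: measurable_short HS _ _.
  exact: measurable_initial_event HS _.
- by case: b; [exact: measurable_queue_vector HS _ _|exact: measurable_initial_event HS _].
- by case: b; [exact: measurable_queue_vector HS _ _|exact: measurable_initial_event HS _].
Qed.

Let indicP (A : set T) (b : bool) w : (A w <-> b) -> \1_A w = b%:R :> R.
Proof.
move=> Ab; rewrite indicE; congr (_ %:R); congr nat_of_bool.
by apply/idP/idP; rewrite inE; apply Ab.
Qed.

Let shortP v h w : short S v h w <-> (clock S v w <= h)%R.
Proof. by rewrite /short /= in_itv. Qed.

Let arrival_event h y j b w : \1_(event h y (Some j, true, b)) w
  = ((clock S (Interarrival n 0) w <= h)%R && (queue_choice S 0 w == j :> nat))%:R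
    * ((if b then push j (X0 w) else X0 w) == y)%:R :> R.
Proof.
rewrite -natrM mulnb; apply: indicP; split.
  by move=> [/shortP h1 [h2 h3]]; apply/andP; split; [apply/andP; split => //|]; apply/eqP.
by move=> /andP[/andP[/shortP h1 /eqP h2] /eqP h3]; split.
Qed.

Let initial_event h y j b w : \1_(event h y (Some j, false, b)) w
  = (clock S (InitialService j 0) w <= h)%R%:R
    * ((if b then pop j (X0 w) else X0 w) == y)%:R :> R.
Proof.
rewrite -natrM mulnb; apply: indicP; split.
  by move=> [/shortP h1 h3]; apply/andP; split => //; apply/eqP.
by move=> /andP[/shortP h1 /eqP h3]; split.
Qed.

Let event_sum h y w : ~ two_short S h w ->
  \sum_(i <- terms) coef i * \1_(event h y i) w = 0.
Proof.
move=> ntw; rewrite (sum_terms (fun i => \1_(event h y i) w)).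
rewrite (_ : \1_(event h y (None, true, true)) w = (queue_vector S h w == y)%:R); last first.
  by apply: indicP; split => /eqP.
rewrite (_ : \1_(event h y (None, true, false)) w = (X0 w == y)%:R); last first.
  by apply: indicP; split => /eqP.
rewrite (state_change y ntw).
apply/eqP; rewrite -addrA -opprD subr_eq0; apply/eqP; congr (_ + _).
  by apply: eq_bigr => j _; rewrite !arrival_event mulrBr.
by apply: eq_bigr => j _; rewrite !initial_event mulrBr.
Qed.

Definition stat (B : set state) : R := pr (X0 @^-1` B).

Hypothesis stS : stationary S.

Lemma stationary_expansion y : exists2 C, 0 <= C & forall h, 0 < h ->
  `|(1 - expR (- (lambda * n%:R) * h)) * n%:R^-1
      * (\sum_(j < n) (stat [set x | push j x = y] - stat [set y]))
    + (1 - expR (- 1 * h))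
      * (\sum_(j < n) (stat [set x | pop j x = y] - stat [set y]))| <= C * h ^+ 2.
Proof.
have [C C0 hC] := pr_two_short HS lambda0 n0.
exists ((\sum_(i <- terms) `|coef i|) * C).
  by rewrite mulr_ge0// sumr_ge0.
move=> h h0; have := pr_combination P (fun i => measurable_event h y i)
  (measurable_two_short HS h) (@event_sum h y).
rewrite (sum_terms (fun i => pr (event h y i))) /= => H.
have eq0 : pr [set w | queue_vector S h w = y] = pr (X0 @^-1` [set y]).
  by rewrite /pr (stS y (ltW h0)).
have : (\sum_(i <- terms) `|coef i|) * pr (two_short S h)
       <= (\sum_(i <- terms) `|coef i|) * C * h ^+ 2.
  by rewrite -mulrA ler_wpM2l ?hC// sumr_ge0.
apply: le_trans; apply: le_trans H; rewrite eq0 subrr add0r -opprD normrN.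
rewrite le_eqVlt; apply/orP; left; apply/eqP; congr (`| _ + _ |).
  rewrite !mulr_sumr big_enum/=; apply: eq_bigr => j _.
  by rewrite !pr_short_arrival (pr_short HS)// -mulrBr.
rewrite !mulr_sumr big_enum/=; apply: eq_bigr => j _.
by rewrite !pr_short_initial (pr_short HS)// -mulrBr.
Qed.

Lemma one_sub_expN (x : R) : 0 <= x -> 0 <= x - (1 - expR (- x)) <= x ^+ 2.
Proof.
move=> x0; have := expR_ge1Dx (- x); have := expR_ge1Dx x => h1 h2.
have e0 : 0 < expR (- x) by exact: expR_gt0.
have : expR (- x) * expR x = 1 by rewrite -expRD addNr expR0.
move: (expR x) (expR (- x)) h1 h2 e0 => a b h1 h2 b0 ab.
by apply/andP; split; [lra|nra].
Qed.

(** Stationarity cancels the terms of order 0 in the expansion. What remains, divided by h, does not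
    depend on h and is at most a constant times h, so it is 0. *)
Lemma stationary_balance y :
  lambda * (\sum_(j < n) (stat [set x | push j x = y] - stat [set y]))
  + \sum_(j < n) (stat [set x | pop j x = y] - stat [set y]) = 0.
Proof.
have [C C0 hC] := stationary_expansion y.
move: hC; set A := \sum_(j < n) _; set B := \sum_(j < n) _ => hC.
have nR : 0 < n%:R :> R by rewrite ltr0n.
(* C comes from the expansion; the other two terms come from replacing 1 - exp (- x) by x, with
   error at most x^2, for the arrival and the service clocks. *)
have key h : 0 < h -> `|lambda * A + B| <= (C + lambda ^+ 2 * n%:R * `|A| + `|B|) * h.
  move=> h0; rewrite -(ler_pM2r h0) -[h in `|_| * h]gtr0_norm// -normrM.
  have := hC h h0; rewrite mulNr mul1r.
  have /andP[a1 a2] := one_sub_expN (ltW (mulr_gt0 (mulr_gt0 lambda0 nR) h0)).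
  have /andP[b1 b2] := one_sub_expN (ltW h0).
  rewrite mulNr; set u := 1 - _ in a1 a2 *; set v := 1 - _ in b1 b2 * => H.
  have -> : (lambda * A + B) * h = (u * n%:R^-1 * A + v * B)
     + ((lambda * n%:R * h - u) * n%:R^-1 * A + (h - v) * B).
    by field; rewrite gt_eqF.
  apply: le_trans (ler_normD _ _) _.
  have -> : (C + lambda ^+ 2 * n%:R * `|A| + `|B|) * h * h
    = C * h ^+ 2 + ((lambda * n%:R * h) ^+ 2 * n%:R^-1 * `|A| + h ^+ 2 * `|B|).
    by field; rewrite gt_eqF.
  apply: lerD => //; apply: le_trans (ler_normD _ _) _.
  rewrite !normrM; apply: lerD; apply: ler_wpM2r => //.
    by rewrite [X in _ * X]ger0_norm ?invr_ge0// ler_wpM2r ?invr_ge0// ger0_norm.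
  by rewrite ger0_norm.
apply/eqP; rewrite -normr_eq0 eq_le normr_ge0 andbT.
set D := (C + _ + _) in key.
have D0 : 0 <= D by rewrite !addr_ge0// mulr_ge0// mulr_ge0// sqr_ge0.
apply/ler_addgt0Pr => e e0; rewrite add0r.
have h0 : 0 < e / (D + 1) by rewrite divr_gt0// ltr_wpDl.
apply: le_trans (key _ h0) _; rewrite mulrCA -[leRHS]mulr1 ler_wpM2l ?(ltW e0)//.
by rewrite ler_pdivrMr ?mul1r ?lerDl// ltr_wpDl.
Qed.

End balance.

(** * Uniqueness of the summable solution *)

Section invariant_uniqueness.
Context (R : realType) (n : nat).
Local Notation state := {ffun 'I_n -> nat}.
Implicit Types (f g pi : state -> R) (x y : state) (j : 'I_n).

Lemma push_popK j y : (0 < y j)%N -> push j (pop j y) = y.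
Proof.
move=> yj; apply/ffunP => i; rewrite !ffunE; have [->|] := eqVneq i j.
  by rewrite subnK.
by rewrite subn0 addn0.
Qed.

Lemma pop_pushK j : cancel (push j) (pop j).
Proof. by move=> y; apply/ffunP => i; rewrite !ffunE addnK. Qed.

(* The mass at y after one arrival to, respectively one departure from queue j. *)
Definition inflow_push f j y : R := if (0 < y j)%N then f (pop j y) else 0.
Definition inflow_pop f j y : R := f (push j y) + (if y j == 0%N then f y else 0).

Definition total f : \bar R := (\esum_(x in setT) (f x)%:E)%E.

Lemma total_ge0 f : (forall x, 0 <= f x) -> (0 <= total f)%E.
Proof. by move=> f0; apply: esum_ge0 => x _; rewrite lee_fin. Qed.

Lemma le_total f g : (forall x, f x <= g x) -> (total f <= total g)%E.
Proof. by move=> fg; apply: le_esum => x _; rewrite lee_fin. Qed.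

Lemma totalD f g : (forall x, 0 <= f x) -> (forall x, 0 <= g x) ->
  total (fun x => f x + g x) = (total f + total g)%E.
Proof.
by move=> f0 g0; rewrite /total -esumD// => x _; rewrite lee_fin.
Qed.

Lemma total_sum (f : 'I_n -> state -> R) : (forall j x, 0 <= f j x) ->
  total (fun x => \sum_j f j x) = (\sum_j total (f j))%E.
Proof.
move=> f0; rewrite /total -esum_sum; last by move=> x j _ _; rewrite lee_fin.
by apply: eq_esum => x _; rewrite sumEFin.
Qed.

Lemma set_bij_push j : set_bij setT [set y : state | (0 < y j)%N] (push j).
Proof.
split.
- by move=> y _ /=; rewrite ffunE eqxx addn1.
- by move=> x y _ _ /(congr1 (pop j)); rewrite !pop_pushK.
- by move=> y /= yj; exists (pop j y) => //; exact: push_popK.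
Qed.

Lemma total_inflow_push f j : total (inflow_push f j) = total f.
Proof.
rewrite [RHS]/total.
transitivity (\esum_(y in [set y : state | (0 < y j)%N]) (f (pop j y))%:E)%E.
  rewrite /total [RHS]esum_mkcond; apply: eq_esum => y _.
  rewrite (_ : (y \in _) = (0 < y j)%N); last by apply/idP/idP; rewrite inE.
  by rewrite /inflow_push; case: ifP.
by rewrite (reindex_esum _ _ _ _ (set_bij_push j)); apply: eq_esum => y _; rewrite pop_pushK.
Qed.

(** The states where queue j is nonempty are exactly the values of [push j]; the other states are
    kept by the departure without effect. *)
Lemma total_inflow_pop f j : (forall x, 0 <= f x) ->
  total (inflow_pop f j) = total f.
Proof.
move=> f0; rewrite totalD => [|x|x]; [|exact: f0|by case: ifP].
rewrite [RHS](esumID [set y : state | (0 < y j)%N]); last first.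
  by move=> x _; rewrite lee_fin.
congr (_ + _)%E.
  by rewrite setTI (reindex_esum _ _ _ _ (set_bij_push j)).
rewrite setTI [RHS]esum_mkcond; apply: eq_esum => y _.
have [yj|yj] := eqVneq (y j) 0%N.
  by rewrite ifT// inE /= yj.
by rewrite ifF//; apply/negP; rewrite inE/= lt0n.
Qed.

Lemma total_eq0 f : (forall x, 0 <= f x) -> total f = 0%E -> forall x, f x = 0.
Proof.
move=> f0 tf x; apply/eqP; rewrite eq_le f0 andbT.
suff : ((f x)%:E <= total f)%E by rewrite tf lee_fin.
by apply: esum_ge; exists [set x]; [split|rewrite fsbig_set1].
Qed.

Lemma eq_of_total f g : (forall x, 0 <= f x) -> (forall x, f x <= g x) ->
  (total g < +oo)%E -> total f = total g -> forall x, f x = g x.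
Proof.
move=> f0 fg gfin tfg x; apply/esym/eqP; rewrite -subr_eq0; apply/eqP.
apply: (@total_eq0 (fun x => g x - f x)) => [y|]; first by rewrite subr_ge0.
have : (total f + total (fun x => g x - f x)%R = total f)%E.
  rewrite -totalD//; last by move=> y; rewrite subr_ge0.
  by rewrite [RHS]tfg; apply: eq_esum => y _; rewrite subrKC.
have ffin : total f \is a fin_num by rewrite tfg ge0_fin_numE// -tfg total_ge0.
move: ffin; case: (total f) => [a| |]// _; case: (total _) => [b| |]//= [] /eqP.
by rewrite -subr_eq0 addrAC subrr add0r => /eqP ->.
Qed.

Variable lambda : R.
Hypotheses (lambda0 : 0 < lambda) (lambda1 : lambda < 1) (n0 : (0 < n)%N).

Definition inflow f y : R :=
  \sum_(j < n) (lambda * inflow_push f j y + inflow_pop f j y).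

Definition outflow f y : R := \sum_(j < n) (lambda * f y + f y).

Lemma inflow_push_le f g j y : (forall x, f x <= g x) ->
  inflow_push f j y <= inflow_push g j y.
Proof. by move=> fg; rewrite /inflow_push; case: ifP. Qed.

Lemma inflow_pop_le f g j y : (forall x, f x <= g x) ->
  inflow_pop f j y <= inflow_pop g j y.
Proof. by move=> fg; rewrite /inflow_pop lerD//; case: ifP. Qed.

Lemma inflow_le f g y : (forall x, f x <= g x) -> inflow f y <= inflow g y.
Proof.
move=> fg; apply: ler_sum => j _; rewrite lerD ?inflow_pop_le//.
by rewrite ler_wpM2l ?inflow_push_le// ltW.
Qed.

Lemma total_inflow f : (forall x, 0 <= f x) ->
  total (inflow f) = total (outflow f).
Proof.
move=> f0.
have lf0 x : 0 <= lambda * f x by rewrite mulr_ge0// ltW.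
have push0 j y : 0 <= lambda * inflow_push f j y.
  by rewrite /inflow_push mulr_ge0 ?(ltW lambda0)//; case: ifP.
have pop0 j y : 0 <= inflow_pop f j y.
  by rewrite /inflow_pop addr_ge0//; case: ifP.
rewrite total_sum; last by move=> j x; rewrite addr_ge0.
rewrite [RHS]total_sum; last by move=> j x; rewrite addr_ge0.
apply: eq_bigr => j _; rewrite [LHS]totalD// [RHS]totalD//.
rewrite total_inflow_pop//; congr (_ + _)%E.
rewrite -[RHS](total_inflow_push _ j); apply: eq_esum => y _.
by rewrite /inflow_push; case: ifP => //; rewrite mulr0.
Qed.

Lemma outflowB f g y : outflow (fun x => f x - g x) y = outflow f y - outflow g y.
Proof. by rewrite -sumrB; apply: eq_bigr => j _; ring. Qed.

Lemma inflowB f g y : inflow (fun x => f x - g x) y = inflow f y - inflow g y.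
Proof.
rewrite -sumrB; apply: eq_bigr => j _; rewrite /inflow_push /inflow_pop.
by case: ifP; case: ifP => _ _; ring.
Qed.

Definition empty_state : state := [ffun=> 0%N].

(** A zero at y makes the outflow there vanish, hence every nonnegative term of the inflow, in
    particular the value at each [push j y]. Zeros thus spread from the empty state, by induction on
    the number of customers. *)
Lemma invariant_zero f : (forall x, 0 <= f x) ->
  (forall y, inflow f y = outflow f y) -> f empty_state = 0 ->
  forall x, f x = 0.
Proof.
move=> f0 fE fz x.
have [m] := ubnP (\sum_j x j)%N; elim: m x => // m IH x xm.
have [x0|[j xj]] : x = empty_state \/ exists j, (0 < x j)%N.
  have [[j xj]|nj] := pselect (exists j, (0 < x j)%N); [by right; exists j|left].
  apply/ffunP => j; rewrite ffunE; apply/eqP; rewrite -leqn0 leqNgt.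
  by apply/negP => xj; apply: nj; exists j.
  by rewrite x0.
have pop_lt : (\sum_i pop j x i < m)%N.
  rewrite (leq_trans _ (ltnSE xm))//.
  rewrite (bigD1 j)// [in X in (_ < X)%N](bigD1 j)//= ffunE eqxx subn1 -addSn.
  rewrite prednK// leq_add2l; apply: leq_sum => i ij.
  by rewrite ffunE leq_subr.
have fpop := IH _ pop_lt.
have := fE (pop j x); rewrite [outflow f _]/outflow big1 => [|i _]; last by rewrite fpop mulr0 addr0.
move=> /eqP; rewrite psumr_eq0 => [|i _]; last first.
  rewrite addr_ge0// ?mulr_ge0 ?(ltW lambda0)// /inflow_push /inflow_pop.
    by case: ifP.
  by rewrite addr_ge0//; case: ifP.
move=> /allP/(_ j); rewrite mem_index_enum => /(_ isT)/=.
rewrite paddr_eq0; last 2 first.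
- by rewrite mulr_ge0 ?(ltW lambda0)// /inflow_push; case: ifP.
- by rewrite /inflow_pop addr_ge0//; case: ifP.
move=> /andP[_]; rewrite /inflow_pop push_popK// paddr_eq0//; last by case: ifP.
by move=> /andP[/eqP].
Qed.

(* The minimum of two invariant functions is superinvariant, and it is invariant
   since the flow preserves the total mass; the two differences then vanish at
   the empty state. *)
Lemma invariant_unique f g : (forall x, 0 <= f x) -> (forall x, 0 <= g x) ->
  (total f < +oo)%E ->
  (forall y, inflow f y = outflow f y) -> (forall y, inflow g y = outflow g y) ->
  f empty_state = g empty_state -> forall x, f x = g x.
Proof.
move=> f0 g0 ffin fE gE fg0.
pose h x := Num.min (f x) (g x).
have h0 x : 0 <= h x by rewrite le_min f0 g0.
have hf x : h x <= f x by rewrite ge_min lexx.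
have hg x : h x <= g x by rewrite ge_min lexx orbT.
have hfin : (total h < +oo)%E by apply: le_lt_trans ffin; exact: le_total.
have c0 : 0 <= lambda + 1 by rewrite addr_ge0// ltW.
have outE (k : state -> R) y : outflow k y = n%:R * (lambda + 1) * k y.
  rewrite /outflow sumr_const card_ord -mulr_natl; ring.
have hle y : inflow h y <= outflow h y.
  have : inflow h y <= Num.min (outflow f y) (outflow g y).
    by rewrite le_min -fE -gE !inflow_le.
  by rewrite !outE /h -minr_pMr// mulr_ge0.
have inflow0 y : 0 <= inflow h y.
  apply: sumr_ge0 => j _; rewrite addr_ge0// ?mulr_ge0 ?(ltW lambda0)//.
    by rewrite /inflow_push; case: ifP.
  by rewrite /inflow_pop addr_ge0//; case: ifP.
have outfin : (total (outflow h) < +oo)%E.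
  rewrite /outflow total_sum; last by move=> j x; rewrite addr_ge0// mulr_ge0// ltW.
  apply: lte_sum_pinfty => j _; rewrite totalD//; last by move=> x; rewrite mulr_ge0// ltW.
  apply: lte_add_pinfty => //; apply: le_lt_trans hfin.
  by apply: le_total => x; rewrite ler_piMl// ltW.
have hE := eq_of_total inflow0 hle outfin (total_inflow h0).
have diff0 (k : state -> R) : (forall x, h x <= k x) ->
    (forall y, inflow k y = outflow k y) -> k empty_state = h empty_state ->
    forall x, k x = h x.
  move=> hk kE kh x; apply/eqP; rewrite -subr_eq0; apply/eqP.
  apply: (@invariant_zero (fun x => k x - h x)) => [y|y|].
  - by rewrite subr_ge0.
  - by rewrite inflowB outflowB kE hE.
  - by rewrite kh subrr.
have fz : f empty_state = h empty_state by rewrite /h fg0 minxx.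
have gz : g empty_state = h empty_state by rewrite -fg0.
by move=> x; rewrite (diff0 f hf fE fz) (diff0 g hg gE gz).
Qed.

End invariant_uniqueness.

(** * The product of geometric laws *)

Section stationary_law.
Context d (T : measurableType d) (R : realType) (P : probability T R) (n : nat).
Variables (S : supermarket_input P n) (lambda : R).
Hypotheses (lambda0 : 0 < lambda) (lambda1 : lambda < 1) (n0 : (0 < n)%N).
Hypotheses (HS : is_supermarket S lambda) (stS : stationary S).

Local Notation X0 := (initial_state S).
Local Notation pr := (pr P).
Local Notation state := {ffun 'I_n -> nat}.

Let pi (x : state) : R := stat S [set x].

Let pi_ge0 x : 0 <= pi x. Proof. exact: pr_ge0. Qed.

Let mX0 B : measurable (X0 @^-1` B). Proof. exact: measurable_initial_event HS B. Qed.

Let stat_push j y : stat S [set x | push j x = y] = inflow_push pi j y.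
Proof.
rewrite /inflow_push /pi; case: ltnP => yj.
  congr (stat S _); apply/seteqP; split => x /=; first by move=> <-; rewrite pop_pushK.
  by move=> ->; exact: push_popK.
rewrite /stat (_ : [set x | _] = set0) ?preimage_set0 ?pr_set0//.
by apply/seteqP; split => x //= xy; move: yj; rewrite -xy ffunE eqxx addn1.
Qed.

Let stat_pop j y : stat S [set x | pop j x = y] = inflow_pop pi j y.
Proof.
rewrite /inflow_pop /pi; case: eqVneq => yj; last first.
  rewrite addr0; congr (stat S _); apply/seteqP; split => x /=; last first.
    by move=> ->; exact: pop_pushK.
  move=> xy; rewrite -xy push_popK//; move: yj; rewrite -xy ffunE eqxx subn1.
  by case: (x j).
have -> : [set x | pop j x = y] = [set push j y] `|` [set y].
  apply/seteqP; split => x /=; last first.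
    move=> [->|->]; first exact: pop_pushK.
    by apply/ffunP => i; rewrite ffunE; case: (eqVneq i j) => [->|]; rewrite ?yj ?subn0.
  move=> <-; have [xj|xj] := posnP (x j); last by left; rewrite push_popK.
  right; apply/ffunP => i; rewrite ffunE.
  by case: (eqVneq i j) => [->|]; rewrite ?xj ?subn0.
rewrite /stat preimage_setU; apply: EFin_inj; rewrite EFinD -!prE//; last first.
  by apply: measurableU.
apply: measureU => //; rewrite -preimage_setI; apply/seteqP; split => w //= -[/= -> /eqP].
by move=> /eqP/ffunP/(_ j); rewrite ffunE eqxx yj addn1.
Qed.

Let pi_invariant y : inflow lambda pi y = outflow lambda pi y.
Proof.
have := stationary_balance HS lambda0 n0 stS y; rewrite /inflow /outflow.
under eq_bigr do rewrite stat_push.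
under [X in _ + X]eq_bigr do rewrite stat_pop.
rewrite -/(pi y) !big_split/= -!mulr_sumr !sumrN; lra.
Qed.

Let pi_total : (total pi < +oo)%E.
Proof.
apply: (@le_lt_trans _ _ 1%E); last by rewrite ltry.
apply: ge_ereal_sup => _ [A [finA _] <-].
rewrite (eq_fsbigr (fun x => P (X0 @^-1` [set x]))); last by move=> x _; rewrite prE.
rewrite -measure_fin_bigcup//.
- by apply: probability_le1; apply: fin_bigcup_measurable => // x _.
- by move=> x y _ _ [w [/= <- <-]].
Qed.

(** Scaled to agree with [pi] at the empty state, as [invariant_unique] requires; the value there is
    found only in [pr_all]. *)
Let geo (x : state) : R := pi (empty_state n) * \prod_j lambda ^+ x j.

Let geo_push j y : geo (push j y) = lambda * geo y.
Proof.
rewrite /geo mulrCA; congr (_ * _); rewrite (bigD1 j)//= [in RHS](bigD1 j)//= mulrA.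
congr (_ * _); first by rewrite ffunE eqxx addn1 exprS.
by apply: eq_bigr => i ij; rewrite ffunE (negbTE ij) addn0.
Qed.

(** Each queue balances by itself. When it is nonempty, arrivals bring [geo y] and departures bring
    lambda times [geo y]; when it is empty, the departure without effect supplies [geo y] in place
    of arrivals. *)
Let geo_invariant y : inflow lambda geo y = outflow lambda geo y.
Proof.
apply: eq_bigr => j _; rewrite /inflow_push /inflow_pop geo_push.
case: (posnP (y j)) => yj; first by rewrite mulr0 add0r.
by rewrite -(geo_push j (pop j y)) push_popK// addr0 addrC.
Qed.

Let pi_geo x : pi x = geo x.
Proof.
apply: (invariant_unique lambda0 lambda1) => //.
- by move=> y; rewrite /geo mulr_ge0// prodr_ge0// => j _; rewrite exprn_ge0// ltW.
- rewrite /geo big1 ?mulr1// => j _; by rewrite ffunE expr0.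
Qed.

Let box m (f : {ffun 'I_n -> 'I_m.+1}) : state := [ffun j => val (f j)].

(** For any variable with the law of the initial state, because it is applied both to the queue
    vector at time t and to the initial state itself. The sum over a box factors into n geometric
    sums. *)
Let pr_box m (X : T -> state) :
  (forall x, measurable [set w | X w = x]) ->
  (forall x, P [set w | X w = x] = P (X0 @^-1` [set x])) ->
  pr [set w | forall j, (X w j <= m)%N]
  = pi (empty_state n) / (1 - lambda) ^+ n * (1 - lambda ^+ m.+1) ^+ n.
Proof.
move=> mX PX.
rewrite (_ : [set w | _] = \bigcup_(f in [set` enum {: {ffun 'I_n -> 'I_m.+1}}])
    [set w | X w = box f]); last first.
  apply/seteqP; split => w /=.
    move=> H; exists [ffun j => inord (X w j)]; first by rewrite /= mem_enum.
    by apply/ffunP => j; rewrite !ffunE/= inordK// ltnS.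
  by move=> [f _ /= wf] j; rewrite wf ffunE -ltnS ltn_ord.
rewrite /pr measure_fin_bigcup//; last first.
  move=> f g _ _ [w [/= -> fg]]; apply/ffunP => j; apply: val_inj.
  by have /ffunP/(_ j) := fg; rewrite !ffunE.
rewrite -fsbig_seq ?enum_uniq// big_enum/=.
under eq_bigr do rewrite PX (prE P (mX0 [set _])) -/(stat S _) -/(pi _) pi_geo.
rewrite sumEFin/= /geo -mulr_sumr -mulrA; congr (_ * _).
transitivity (\sum_(f : {ffun 'I_n -> 'I_m.+1}) \prod_(j < n) lambda ^+ f j).
  by apply: eq_bigr => f _; apply: eq_bigr => j _; rewrite ffunE.
rewrite -(bigA_distr_bigA (fun (j : 'I_n) (i : 'I_m.+1) => lambda ^+ i)).
rewrite prodr_const card_ord -exprVn -exprMn; congr (_ ^+ _).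
have l1 : 1 - lambda != 0 by rewrite subr_eq0 gt_eqF.
apply: (mulfI l1); rewrite mulrA divff// mul1r.
by rewrite -(opprB lambda 1) -[RHS]opprB subrX1 mulNr.
Qed.

Let pr_max_queue_const m t : 0 <= t ->
  pr [set w | (max_queue S t w <= m)%N]
  = pi (empty_state n) / (1 - lambda) ^+ n * (1 - lambda ^+ m.+1) ^+ n.
Proof.
move=> t0; rewrite -(@pr_box m (queue_vector S t)).
- congr (pr _); apply/seteqP; split => w /=.
    by move=> /max_queue_leP H j; rewrite queue_vectorE.
  by move=> H; apply/max_queue_leP => j; rewrite -queue_vectorE.
- exact: measurable_queue_vector HS t.
- by move=> x; exact: stS.
Qed.

(** As m grows, the probability of a maximum at most m tends to 1 by continuity of the measure, and
    to this constant by the formula. *)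
Let pr_all : pi (empty_state n) / (1 - lambda) ^+ n = 1.
Proof.
set c := _ / _.
pose M m := [set w | (max_queue S 0 w <= m)%N].
have mM m : measurable (M m) by exact: (measurable_max_queue_event HS 0 [set k | (k <= m)%N]).
have UM : \bigcup_m M m = setT.
  by apply/seteqP; split => // w _; exists (max_queue S 0 w) => //; rewrite /M/=.
have H1 : P \o M @ \oo --> 1%E.
  rewrite -(probability_setT P) -UM; apply: nondecreasing_cvg_mu => //.
    by rewrite UM.
  by move=> k l kl; apply/subsetPset => w /leq_trans; exact.
have H2 : (fun m => pr (M m)) @ \oo --> c * (1 - 0) ^+ n.
  under eq_fun do rewrite pr_max_queue_const//.
  apply: cvgMl_tmp; apply: (@cvg_comp _ _ _ (fun m => 1 - lambda ^+ m.+1) (fun x : R => x ^+ n) _ (nbhs (1 - 0 : R))); last exact: exprn_continuous.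
  apply: cvgB; first exact: cvg_cst.
  by rewrite (cvg_shiftS (fun k => lambda ^+ k)); apply: cvg_expr; rewrite gtr0_norm.
move/fine_cvg : H1 => H1; have := cvg_lim (@Rhausdorff R) H2.
by rewrite subr0 expr1n mulr1 => <-; apply: cvg_lim => //; exact: Rhausdorff.
Qed.

Theorem pr_max_queue m t : 0 <= t ->
  pr [set w | (max_queue S t w <= m)%N] = (1 - lambda ^+ m.+1) ^+ n.
Proof. by move=> t0; rewrite pr_max_queue_const// pr_all mul1r. Qed.

Lemma pr_initial_le m :
  pr [set w | forall j, (X0 w j <= m)%N] = (1 - lambda ^+ m.+1) ^+ n.
Proof.
by rewrite pr_box ?pr_all ?mul1r//; exact: measurable_initial_state HS.
Qed.

End stationary_law.

(** * Chernoff bounds and independent blocks *)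

Section exponential_moments.
Context d (T : measurableType d) (R : realType) (P : probability T R) (n : nat).
Variables (S : supermarket_input P n) (lambda : R).
Hypotheses (HS : is_supermarket S lambda) (lambda0 : 0 < lambda) (n0 : (0 < n)%N).

Local Notation F := (input_sigma_algebra S).
Local Notation pr := (pr P).

(** Markov's inequality. *)
Lemma pr_le_expectation (A : set T) (Y : T -> R) (K c : R) : 0 < K ->
  measurable A -> measurable_fun setT Y -> (forall w, 0 <= Y w) ->
  (forall w, A w -> K <= Y w) ->
  (\int[P]_w (Y w)%:E = c%:E)%E -> pr A <= c / K.
Proof.
move=> K0 mA mY Y0 AY Yc; rewrite ler_pdivlMr// mulrC -lee_fin -Yc EFinM -prE//.
have mI : measurable_fun setT (fun w => (\1_A w)%:E : \bar R).
  exact/measurable_EFinP/measurable_indic.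
rewrite -(setIT A) -integral_indic// -ge0_integralZl_EFin//; last exact: ltW.
apply: ge0_le_integral => //.
- by move=> w _; rewrite mule_ge0 ?lee_fin// ltW.
- exact: measurable_funeM.
- exact/measurable_EFinP.
- move=> w _; rewrite -EFinM lee_fin indicE.
  have [/set_mem/AY|_] := boolP (w \in A); first by rewrite mulr1.
  by rewrite mulr0.
Qed.

Variables (theta : input_index n -> R) (j : 'I_n) (a b : nat -> R).
Hypotheses (thetaP : forall v, theta v < clock_rate lambda v)
  (a0 : forall k, 0 <= a k) (b0 : forall k, 0 <= b k).

(** One factor per input, so that a single expectation formula serves all the Chernoff bounds:
    clocks are tilted by theta, and a choice weighs a or b according to whether it is queue j. *)
Definition weight (v : input_index n) (w : T) : R :=
  match v with
  | InitialState => 1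
  | QueueChoice k => if queue_choice S k w == j :> nat then a k else b k
  | v => expR (theta v * clock S v w)
  end.

Definition mean_weight (v : input_index n) : R :=
  match v with
  | InitialState => 1
  | QueueChoice k => a k * n%:R^-1 + b k * (1 - n%:R^-1)
  | v => clock_rate lambda v / (clock_rate lambda v - theta v)
  end.

Lemma weight_ge0 v w : 0 <= weight v w.
Proof. by case: v => [|k|k|k|i k] //=; rewrite ?expR_ge0//; case: ifP. Qed.

Lemma weight_input v (B : set R) : measurable B -> F v (weight v @^-1` B).
Proof.
move=> mB.
have mexp u : measurable_fun setT (fun x : R => expR (theta u * x)).
  by apply: measurableT_comp => //; exact: measurable_funM.
have expin u : F u ((fun w => expR (theta u * clock S u w)) @^-1` B).
  rewrite -[_ @^-1` B]/(clock S u @^-1` ((fun x : R => expR (theta u * x)) @^-1` B)).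
  by apply: clock_input; rewrite -[X in measurable X]setTI; exact: mexp.
case: v => [|k|k|k|i k]; try exact: expin.
- rewrite (_ : weight _ = cst 1)// preimage_cst; case: ifPn => _.
    exact: input_setT.
  exact: input_set0.
- exact: (choice_input S k [set c | B (if c == j :> nat then a k else b k)]).
Qed.

Lemma measurable_weight v : measurable_fun setT (weight v).
Proof. by move=> _ B mB; rewrite setTI; exact: (input_measurable HS (weight_input v mB)). Qed.

Lemma expectation_weight v : (\int[P]_w (weight v w)%:E = (mean_weight v)%:E)%E.
Proof.
case: v => [|k|k|k|i k].
- by under eq_integral do rewrite /=; rewrite integral_cst//= probability_setT mule1.
- exact: (exponential_mgf (rate_gt0 lambda0 n0 (Interarrival n k))
    (thetaP (Interarrival n k)) (interarrival_law HS k)).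
- pose A := queue_choice S k @^-1` [set val j].
  have mA : measurable A by exact: measurable_funPTI.
  have mAc : measurable (~` A) by exact: measurableC.
  transitivity (\int[P]_w ((a k)%:E * (\1_A w)%:E + (b k)%:E * (\1_(~` A) w)%:E))%E.
    apply: eq_integral => w _; rewrite -!EFinM -EFinD/= !indicE; congr EFin.
    rewrite in_setC (_ : w \in A = (queue_choice S k w == j :> nat)).
      by case: ifP => _ /=; ring.
    by apply/idP/eqP; rewrite inE.
  have mI (B : set T) : measurable B -> measurable_fun setT (fun w => (\1_B w)%:E : \bar R).
    by move=> mB; exact/measurable_EFinP/measurable_indic.
  rewrite ge0_integralD//; last 4 first.
  - by move=> w _; rewrite -EFinM lee_fin mulr_ge0.
  - by apply: measurable_funeM; exact: mI.
  - by move=> w _; rewrite -EFinM lee_fin mulr_ge0.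
  - by apply: measurable_funeM; exact: mI.
  rewrite !ge0_integralZl_EFin//; try by [exact: mI].
  have I1 B : measurable B -> (\int[P]_w (\1_B w)%:E = (pr B)%:E :> \bar R)%E.
    by move=> mB; rewrite integral_indic// setIT; exact: prE.
  by rewrite (I1 _ mA) (I1 _ mAc) pr_setC// (pr_choice HS) -!EFinM -EFinD.
- exact: (exponential_mgf ltr01 (thetaP (Service n k)) (service_law HS k)).
- exact: (exponential_mgf ltr01 (thetaP (InitialService i k)) (initial_service_law HS i k)).
Qed.

Lemma expectation_weights s : uniq s ->
  (\int[P]_w (\prod_(v <- s) weight v w)%:E = (\prod_(v <- s) mean_weight v)%:E)%E.
Proof.
apply: (expectation_prod (input_independent HS) _ weight_input weight_ge0
  expectation_weight) => v A.
exact: (input_measurable HS).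
Qed.

End exponential_moments.

Section chernoff.
Context d (T : measurableType d) (R : realType) (P : probability T R) (n : nat).
Variables (S : supermarket_input P n) (lambda : R).
Hypotheses (HS : is_supermarket S lambda) (lambda0 : 0 < lambda) (n0 : (0 < n)%N).

Local Notation pr := (pr P).
Local Notation rate := (lambda * n%:R).

Let rate0 : 0 < rate. Proof. by rewrite mulr_gt0// ltr0n. Qed.

Let one0 (k : nat) : 0 <= (fun=> 1 : R) k. Proof. exact: ler01. Qed.

(** A negative theta bounds the probability of a small sum, a positive one that of a large sum. *)
Lemma arrival_sum_chernoff (k N : nat) (theta t : R) : theta < rate ->
  pr [set w | t <= theta * \sum_(i < N) interarrival S (k + i) w]
  <= expR (- t) * (rate / (rate - theta)) ^+ N.
Proof.
move=> th; pose th' (v : input_index n) := if v is Interarrival _ then theta else 0.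
have th'P v : th' v < clock_rate lambda v by case: v.
pose s := [seq Interarrival n (k + i) | i <- iota 0 N].
have us : uniq s by rewrite map_inj_uniq ?iota_uniq// => a b [] /addnI.
pose j0 := Ordinal n0.
have EY := expectation_weights HS lambda0 n0 j0 th'P one0 one0 us.
have sE (f : input_index n -> R) :
    \prod_(v <- s) f v = \prod_(i < N) f (Interarrival n (k + i)).
  by rewrite big_map -(big_mkord xpredT (fun i => f (Interarrival n (k + i)))) /index_iota subn0.
rewrite mulrC expRN.
apply: (pr_le_expectation (K := expR t) _ _ _ _ _ (etrans EY _)).
- exact: expR_gt0.
- rewrite -[X in measurable X]setTI.
  apply: (@measurable_fun_ler _ _ _ _ (cst t)) => //.
  apply: measurable_funM => //; apply: measurable_sum => i; exact: measurable_funPT.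
- by apply: measurable_prod => v _; exact: (measurable_weight HS).
- by move=> w; apply: prodr_ge0 => v _; exact: weight_ge0.
- move=> w /= tw; rewrite sE /= -expR_sum ler_expR -mulr_sumr//.
- by rewrite sE /= prodr_const card_ord.
Qed.

(** Choosing theta = - rate makes every factor equal to 1/2, whatever n is. *)
Lemma arrivals_fast (k N : nat) (t : R) :
  pr [set w | \sum_(i < N) interarrival S (k + i) w <= t]
  <= expR (rate * t) * 2^-1 ^+ N.
Proof.
have := @arrival_sum_chernoff k N (- rate) (- rate * t) _.
rewrite mulNr !opprK.
have -> : rate / (rate + rate) = 2^-1.
  by move: rate0; move: (rate) => x x0; field; rewrite gt_eqF ?addr_gt0.
move=> H; apply: le_trans (H _); last by have r0 := rate0; lra.
rewrite le_eqVlt; apply/orP; left; apply/eqP; congr (pr _).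
by apply/seteqP; split => w /=; rewrite mulNr lerN2 ler_pM2l.
Qed.

(** Choosing theta = rate / 2 makes every factor equal to 2. *)
Lemma arrivals_slow (k N : nat) (t : R) :
  pr [set w | t <= \sum_(i < N) interarrival S (k + i) w]
  <= expR (- (rate / 2 * t)) * 2 ^+ N.
Proof.
have := @arrival_sum_chernoff k N (rate / 2) (rate / 2 * t) _.
have -> : rate / (rate - rate / 2) = 2.
  by move: rate0; move: (rate) => x x0; field; rewrite gt_eqF//; lra.
move=> H; apply: le_trans (H _); last by have r0 := rate0; lra.
rewrite le_eqVlt; apply/orP; left; apply/eqP; congr (pr _).
by apply/seteqP; split => w /=; rewrite ler_pM2l// divr_gt0.
Qed.

Lemma choices_chernoff (j : 'I_n) (k N : nat) (theta t : R) : 0 <= theta ->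
  pr [set w | t <= (\sum_(i < N) (queue_choice S (k + i) w == j :> nat))%:R]
  <= expR (- (theta * t)) * (1 + (expR theta - 1) / n%:R) ^+ N.
Proof.
move=> th0; pose th' (v : input_index n) : R := 0.
have th'P v : th' v < clock_rate lambda v by exact: rate_gt0.
pose s := [seq QueueChoice n (k + i) | i <- iota 0 N].
have us : uniq s by rewrite map_inj_uniq ?iota_uniq// => a b [] /addnI.
have a0 (i : nat) : 0 <= (fun=> expR theta) i by exact: expR_ge0.
have EY := expectation_weights HS lambda0 n0 j th'P a0 one0 us.
have sE (f : input_index n -> R) :
    \prod_(v <- s) f v = \prod_(i < N) f (QueueChoice n (k + i)).
  by rewrite big_map -(big_mkord xpredT (fun i => f (QueueChoice n (k + i)))) /index_iota subn0.
rewrite mulrC expRN.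
apply: (pr_le_expectation (K := expR (theta * t)) _ _ _ _ _ (etrans EY _)).
- exact: expR_gt0.
- rewrite -[X in measurable X]setTI.
  apply: (@measurable_fun_ler _ _ _ _ (cst t)) => //.
  under eq_fun do rewrite natr_sum.
  apply: measurable_sum => i; apply: measurable_natr_bool.
  exact: (@measurable_choice _ T (fun k => queue_choice S k) j
    (fun k => measurable_queue_choice S k j)).
- by apply: measurable_prod => v _; exact: (measurable_weight HS).
- by move=> w; apply: prodr_ge0 => v _; exact: weight_ge0.
- move=> w /= tw; rewrite sE /=.
  rewrite (eq_bigr (fun i : 'I_N => expR (theta * (queue_choice S (k + i) w == j :> nat)%:R))).
    by rewrite -expR_sum ler_expR -mulr_sumr -natr_sum ler_wpM2l.
  by move=> i _; case: ifP; rewrite ?mulr1 ?mulr0 ?expR0.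
- rewrite sE /= prodr_const card_ord; congr (_ ^+ _)%:E.
  by ring.
Qed.

(* The weight of customer i is split according to whether he joins queue j. *)
Lemma workload_chernoff (j : 'I_n) (r k : nat) (theta : R) : 0 < theta < 1 ->
  pr [set w | \sum_(i < k.+1) interarrival S i w
     <= \sum_(l < r) initial_service S j l w
        + \sum_(i < k) (if queue_choice S i w == j :> nat then service S i w else 0)]
  <= (rate / (rate + theta)) ^+ k.+1 * (1 - theta)^-1 ^+ r
     * (n%:R^-1 / (1 - theta) + (1 - n%:R^-1)) ^+ k.
Proof.
move=> /andP[th0 th1].
(* J is a candidate for the set of customers who join queue j. The factor of a customer mixes his
   choice and his service; expanded over J, the exponential moment becomes a sum of products of
   weights of single inputs. *)
pose inJ (J : {set 'I_k}) (i : nat) := if insub i is Some i' then i' \in J else false.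
have inJE J (i : 'I_k) : inJ J i = (i \in J) by rewrite /inJ valK.
pose th' J (v : input_index n) := match v with
  | Interarrival _ => - theta
  | Service i => if inJ J i then theta else 0
  | InitialService _ _ => theta
  | _ => 0 end.
have th'P J v : th' J v < clock_rate lambda v.
  case: v => //= [k'|k']; last by case: ifP.
  by rewrite (lt_trans _ rate0)// oppr_lt0.
pose s := [seq Interarrival n i | i <- iota 0 k.+1] ++ [seq QueueChoice n i | i <- iota 0 k]
  ++ [seq Service n i | i <- iota 0 k] ++ [seq InitialService j l | l <- iota 0 r].
have us : uniq s.
  rewrite !cat_uniq !map_inj_uniq ?iota_uniq /=; try by move=> a b [].
  rewrite andbT; apply/and3P; split; rewrite ?andbT//.
  - by apply/hasPn => v /=; rewrite !mem_cat => /or3P[] /mapP[i _ ->];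
      apply/negP => /mapP[? _].
  - by apply/hasPn => v /=; rewrite !mem_cat => /orP[] /mapP[i _ ->];
      apply/negP => /mapP[? _].
  - by apply/hasPn => v /= /mapP[i _ ->]; apply/negP => /mapP[? _].
pose a J (i : nat) : R := (inJ J i)%:R; pose b J (i : nat) : R := (~~ inJ J i)%:R.
have a0 J i : 0 <= a J i by [].
have b0 J i : 0 <= b J i by [].
have EY J := expectation_weights HS lambda0 n0 j (th'P J) (a0 J) (b0 J) us.
have iotaE (N : nat) (f : nat -> R) : \prod_(i <- iota 0 N) f i = \prod_(i < N) f i.
  by rewrite -(big_mkord xpredT f) /index_iota subn0.
have sE (f : input_index n -> R) : \prod_(v <- s) f v =
    \prod_(i < k.+1) f (Interarrival n i) * \prod_(l < r) f (InitialService j l)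
    * \prod_(i < k) (f (QueueChoice n i) * f (Service n i)).
  rewrite /s !big_cat !big_map !iotaE big_split /= -[RHS]mulrA.
  by rewrite [X in _ = _ * X]mulrC -!mulrA.
pose Z J w := \prod_(v <- s) weight S (th' J) j (a J) (b J) v w.
pose Y w := \sum_(J : {set 'I_k}) Z J w.
have mZ J : measurable_fun setT (Z J).
  by apply: measurable_prod => v _; exact: (measurable_weight HS).
have Z0 J w : 0 <= Z J w by apply: prodr_ge0 => v _; exact: weight_ge0.
have YE w : Y w = \prod_(i < k.+1) expR (- theta * interarrival S i w)
    * \prod_(l < r) expR (theta * initial_service S j l w)
    * \prod_(i < k) (if queue_choice S i w == j :> nat then expR (theta * service S i w) else 1).
  rewrite /Y /Z; under eq_bigr do rewrite sE /=.
  rewrite -mulr_sumr; congr (_ * _).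
  rewrite [RHS](eq_bigr (fun i : 'I_k =>
    (queue_choice S i w == j :> nat)%:R * expR (theta * service S i w)
    + (queue_choice S i w != j :> nat)%:R)); last first.
    by move=> i _; case: ifP; rewrite ?mul1r ?mul0r ?addr0 ?add0r.
  rewrite bigA_distr; apply: eq_bigr => J _; apply: eq_bigr => i _.
  rewrite /a /b inJE; case: (i \in J) => /=.
    by case: ifP; rewrite ?mul1r ?mul0r.
  by rewrite mul0r expR0 mulr1; case: ifP.
apply: le_trans (_ : _ <= _ / 1) _; last by rewrite divr1.
apply: (pr_le_expectation (K := 1) (Y := Y)).
- exact: ltr01.
- rewrite -[X in measurable X]setTI; apply: measurable_fun_ler => //.
    by apply: measurable_sum => i; exact: measurable_funPT.
  apply: measurable_funD; apply: measurable_sum => i; first exact: measurable_funPT.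
  apply: measurable_fun_ifT => //.
  exact: (@measurable_choice _ T (fun k => queue_choice S k) j
    (fun k => measurable_queue_choice S k j)).
- by apply: measurable_sum => J; exact: mZ.
- by move=> w; apply: sumr_ge0 => J _.
- move=> w /= Hw; rewrite YE.
  rewrite [X in _ * X](eq_bigr (fun i : 'I_k => expR (theta *
     (if queue_choice S i w == j :> nat then service S i w else 0)))); last first.
    by move=> i _; case: ifP; rewrite ?mulr0 ?expR0.
  rewrite -!expR_sum -!mulr_sumr -!expRD -[leLHS]expR0 ler_expR.
  by rewrite mulNr -addrA -mulrDr addrC subr_ge0 ler_pM2l.
under eq_integral do rewrite -sumEFin.
rewrite ge0_integral_sum//; last 2 first.
- by move=> J; exact/measurable_EFinP.
- by move=> J w _; rewrite lee_fin.
under eq_bigr do rewrite EY sE /=.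
rewrite sumEFin -mulr_sumr !prodr_const !card_ord opprK; congr EFin.
congr (_ * _); first by rewrite exprVn; congr (_ * _); rewrite div1r exprVn.
(* The same expansion on the means, read backwards, gives the k-th power of one mean factor. *)
rewrite -[in RHS](card_ord k) -prodr_const bigA_distr; apply: eq_bigr => J _.
apply: eq_bigr => i _; rewrite /a /b inJE; case: (i \in J) => /=.
  by rewrite mul1r mul0r addr0 div1r.
by rewrite !(mul0r, mul1r, add0r, subr0, invr1, mulr1).
Qed.

End chernoff.

(** * Independence of blocks of arrivals *)

Section pi_lambda.
Context d (T : measurableType d) (R : realType) (P : probability T R).
Variables (Z : pointedType) (G : set (set Z)).
Hypotheses (GI : setI_closed G) (GT : G setT).

Lemma measurable_preimage_gen (phi : T -> Z) :
  (forall X, G X -> measurable (phi @^-1` X)) ->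
  forall X, <<s G >> X -> measurable (phi @^-1` X).
Proof.
move=> mG X sX.
apply: (sX [set X | measurable (phi @^-1` X)]); split; last exact: mG.
split.
- by rewrite /= preimage_set0.
- by move=> A mA; rewrite setTD; exact: (measurableC mA).
- move=> F mF; rewrite /mkset preimage_bigcup.
  by apply: bigcup_measurable => k _; exact: mF.
Qed.

(** Both sides are finite measures in X that agree on a pi-system. As X = setT gives g = P A, this
    says at once that phi is independent of A and distributed as [phi0]. *)
Lemma indep_of_generator (phi phi0 : T -> Z) (A : set T) (g : R) :
  measurable A -> 0 <= g ->
  (forall X, G X -> measurable (phi @^-1` X)) ->
  (forall X, G X -> measurable (phi0 @^-1` X)) ->
  (forall X, G X -> P (A `&` phi @^-1` X) = (g%:E * P (phi0 @^-1` X))%E) ->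
  forall X, <<s G >> X -> P (A `&` phi @^-1` X) = (g%:E * P (phi0 @^-1` X))%E.
Proof.
move=> mA g0 mphi mphi0 GE.
have mp := measurable_preimage_gen mphi; have mp0 := measurable_preimage_gen mphi0.
have gA : P A = g%:E.
  by have := GE _ GT; rewrite !preimage_setT setIT probability_setT mule1.
apply: (@dynkin_induction _ (g_sigma_algebraType G)) => //.
- exact: GE.
- move=> X mX EX; have m1 := mp _ mX; have m2 := mp0 _ mX.
  rewrite -[phi @^-1` _]/(~` (phi @^-1` X)) -[phi0 @^-1` _]/(~` (phi0 @^-1` X)).
  rewrite -setDE measureD//; last first.
    by rewrite (le_lt_trans (probability_le1 P mA))// ltry.
  rewrite [X in (_ - X)%E]EX.
  rewrite [X in (X - _)%E = _]gA probability_setC// !prE//.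
  set p := pr P _.
  by rewrite -[LHS]/((g - g * p)%:E) -[RHS]/((g * (1 - p))%:E) mulrBr mulr1.
- move=> F mF tF EF.
  rewrite !preimage_bigcup setI_bigcupr measure_semi_bigcup//; last 3 first.
  + by move=> k; apply: measurableI => //; exact: (mp _ (mF k)).
  + apply/trivIsetP => i j _ _ ij; rewrite setIACA setIid -preimage_setI.
    by move/trivIsetP : tF => ->//; rewrite preimage_set0 setI0.
  + by apply: bigcup_measurable => k _; apply: measurableI => //; exact: (mp _ (mF k)).
  rewrite measure_semi_bigcup//; last 3 first.
  + by move=> k; exact: (mp0 _ (mF k)).
  + apply/trivIsetP => i j _ _ ij; rewrite -preimage_setI.
    by move/trivIsetP : tF => ->//; rewrite preimage_set0.
  + by apply: bigcup_measurable => k _; exact: (mp0 _ (mF k)).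
  rewrite -nneseriesZl; last by move=> k _; exact: measure_ge0.
  by apply: eq_eseriesr => k _; exact: EF.
Qed.

End pi_lambda.

Section blocks.
Context d (T : measurableType d) (R : realType) (P : probability T R) (n : nat).
Variables (S : supermarket_input P n) (lambda : R).
Hypotheses (HS : is_supermarket S lambda) (lambda0 : 0 < lambda) (n0 : (0 < n)%N).

Local Notation F := (input_sigma_algebra S).
Local Notation pr := (pr P).

(** The whole input from some arrival on; the length B of a block enters through [rectangles B],
    which constrain the first B coordinates only. *)
Definition block_data : Type := nat -> R * nat * R.
HB.instance Definition _ := Pointed.on block_data.

Definition block (b : nat) (w : T) : block_data :=
  fun i => (interarrival S (b + i) w, queue_choice S (b + i) w, service S (b + i) w).

Definition rectangle (B : nat) (A1 : nat -> set R) (A2 : nat -> set nat)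
    (A3 : nat -> set R) : set block_data :=
  [set z | forall i, (i < B)%N -> [/\ A1 i (z i).1.1, A2 i (z i).1.2 & A3 i (z i).2]].

Definition rectangles (B : nat) : set (set block_data) :=
  [set X | exists A1 A2 A3, [/\ forall i, measurable (A1 i),
     forall i, measurable (A3 i) & X = rectangle B A1 A2 A3]].

Lemma rectangles_setI B : setI_closed (rectangles B).
Proof.
move=> _ _ [A1 [A2 [A3 [m1 m3 ->]]]] [B1 [B2 [B3 [k1 k3 ->]]]].
exists (fun i => A1 i `&` B1 i), (fun i => A2 i `&` B2 i), (fun i => A3 i `&` B3 i).
split; try by move=> i; exact: measurableI.
apply/seteqP; split => z.
  by move=> [h1 h2] i iB; have [? ? ?] := h1 i iB; have [? ? ?] := h2 i iB.
by move=> H; split => i iB; have [[? ?] [? ?] [? ?]] := H i iB.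
Qed.

Lemma rectangles_setT B : rectangles B setT.
Proof.
exists (fun=> setT), (fun=> setT), (fun=> setT); split => //.
by apply/seteqP; split.
Qed.

Lemma interarrival_iid k (A : set R) : measurable A ->
  pr (interarrival S k @^-1` A) = pr (interarrival S 0 @^-1` A).
Proof.
move=> mA; rewrite /pr; congr fine.
have := interarrival_law HS k mA; rewrite -(interarrival_law HS 0 mA).
by [].
Qed.

Lemma service_iid k (A : set R) : measurable A ->
  pr (service S k @^-1` A) = pr (service S 0 @^-1` A).
Proof.
move=> mA; rewrite /pr; congr fine.
by have := service_law HS k mA; rewrite -(service_law HS 0 mA).
Qed.

(** The model gives the law of a choice on the n queues only. These n masses add up to 1, so other
    numbers have probability 0 and all choices have the same law. *)
Lemma pr_choice_set k (A : set nat) :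
  pr (queue_choice S k @^-1` A) = \sum_(j < n) n%:R^-1 * (val j \in A)%:R.
Proof.
have mc B : measurable (queue_choice S k @^-1` B) by exact: measurable_funPTI.
have fin B : pr (queue_choice S k @^-1` (B `&` `I_n))
           = \sum_(j < n) n%:R^-1 * (val j \in B)%:R.
  rewrite (_ : _ @^-1` _ = \bigcup_(j in [set` [seq j <- enum 'I_n | val j \in B]])
      queue_choice S k @^-1` [set val j]); last first.
    apply/seteqP; split => w /=.
      move=> [Bw wn]; exists (Ordinal wn) => //=.
      by rewrite mem_filter mem_enum andbT; exact: mem_set.
    by move=> [j /=]; rewrite mem_filter => /andP[/set_mem Bj _] ->.
  rewrite /pr measure_fin_bigcup//; last first.
    by move=> i j _ _ [w [/= -> /val_inj ->]].
  rewrite -fsbig_seq; last by rewrite filter_uniq// enum_uniq.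
  rewrite (eq_bigr (fun=> (n%:R^-1)%:E)); last by move=> j _; exact: queue_choice_law HS k j.
  rewrite sumEFin/= big_filter big_enum_cond/= [LHS]big_mkcond/=.
  by apply: eq_bigr => j _; case: ifP => _; rewrite ?mulr1 ?mulr0.
have all1 : pr (queue_choice S k @^-1` `I_n) = 1.
  rewrite -(setTI (`I_n : set nat)) fin; under eq_bigr do rewrite in_setT mulr1.
  by rewrite sumr_const card_ord -[LHS]mulr_natl divff// pnatr_eq0 -lt0n.
rewrite -fin; apply/eqP; rewrite eq_le; apply/andP; split; last first.
  by apply: le_pr => // w [].
rewrite -[leRHS]addr0 -(subrr 1) -[X in _ + (_ - X)]all1 -(pr_setC _ (mc _)).
apply: le_trans (pr_setU_le _ _ _) => //; last exact: measurableC.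
apply: le_pr => //; first by apply: measurableU => //; exact: measurableC.
by move=> w Aw; have [wn|wn] := pselect ((queue_choice S k w < n)%N); [left|right].
Qed.

Let weight3 (A1 : set R) (A2 : set nat) (A3 : set R) : R :=
  pr (interarrival S 0 @^-1` A1) * pr (queue_choice S 0 @^-1` A2)
  * pr (service S 0 @^-1` A3).

Let pr_cylinder (N : nat) (A1 : nat -> set R) (A2 : nat -> set nat) (A3 : nat -> set R) :
  (forall i, measurable (A1 i)) -> (forall i, measurable (A3 i)) ->
  pr (block 0 @^-1` rectangle N A1 A2 A3)
  = \prod_(0 <= i < N) weight3 (A1 i) (A2 i) (A3 i).
Proof.
move=> m1 m3.
pose A (v : input_index n) := match v with
  | Interarrival k => interarrival S k @^-1` A1 k
  | QueueChoice k => queue_choice S k @^-1` A2 k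
  | Service k => service S k @^-1` A3 k
  | _ => setT end.
pose s := [seq Interarrival n i | i <- iota 0 N] ++ [seq QueueChoice n i | i <- iota 0 N]
  ++ [seq Service n i | i <- iota 0 N].
have us : uniq s.
  rewrite !cat_uniq !map_inj_uniq ?iota_uniq /=; try by move=> a b [].
  rewrite andbT; apply/andP; split.
    by apply/hasPn => v /=; rewrite !mem_cat => /orP[] /mapP[i _ ->];
      apply/negP => /mapP[? _].
  by apply/hasPn => v /= /mapP[i _ ->]; apply/negP => /mapP[? _].
have FA v : F v (A v).
  case: v => [|k|k|k|j i] /=.
  - exact: (input_setT S (InitialState n)).
  - by exists (A1 k); rewrite ?setTI.
  - by exists (A2 k); rewrite ?setTI.
  - by exists (A3 k); rewrite ?setTI.
  - exact: (input_setT S (InitialService j i)).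
have := pr_bigcap_seq (input_independent HS) us
  (fun v _ => conj (FA v) (input_measurable HS (FA v))).
rewrite !big_cat !big_map /= => H.
rewrite /weight3 !big_split /=.
have E1 : \prod_(i <- iota 0 N) pr (interarrival S i @^-1` A1 i)
        = \prod_(0 <= i < N) pr (interarrival S 0 @^-1` A1 i).
  by rewrite /index_iota subn0; apply: eq_bigr => i _; exact: interarrival_iid.
have E2 : \prod_(i <- iota 0 N) pr (queue_choice S i @^-1` A2 i)
        = \prod_(0 <= i < N) pr (queue_choice S 0 @^-1` A2 i).
  by rewrite /index_iota subn0; apply: eq_bigr => i _; rewrite !pr_choice_set.
have E3 : \prod_(i <- iota 0 N) pr (service S i @^-1` A3 i)
        = \prod_(0 <= i < N) pr (service S 0 @^-1` A3 i).
  by rewrite /index_iota subn0; apply: eq_bigr => i _; exact: service_iid.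
rewrite -E1 -E2 -E3 -mulrA -H; congr (pr _); apply/seteqP; split => w /= Hw.
  move=> v; rewrite /= !mem_cat => /or3P[] /mapP[i]; rewrite mem_iota add0n => iN ->;
    by have [] := Hw i iN.
move=> i iN; split; rewrite /= add0n.
- by apply: (Hw (Interarrival n i)); rewrite /= !mem_cat map_f// mem_iota.
- by apply: (Hw (QueueChoice n i)); rewrite /= !mem_cat (map_f (QueueChoice n)) ?orbT// mem_iota.
- by apply: (Hw (Service n i)); rewrite /= !mem_cat (map_f (Service n)) ?orbT// mem_iota.
Qed.

Lemma measurable_block B b X : <<s rectangles B >> X -> measurable (block b @^-1` X).
Proof.
apply: measurable_preimage_gen => {}X [A1 [A2 [A3 [m1 m3 ->]]]].
rewrite (_ : _ @^-1` _ = \bigcap_(i in `I_B)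
  (interarrival S (b + i) @^-1` A1 i `&` queue_choice S (b + i) @^-1` A2 i
   `&` service S (b + i) @^-1` A3 i)); last first.
  apply/seteqP; split => w /= H i iB; first by have [? ? ?] := H i iB.
  by have [[? ?] ?] := H i iB.
apply: fin_bigcap_measurable; first exact: finite_II.
by move=> i _; apply: measurableI; [apply: measurableI|]; exact: measurable_funPTI.
Qed.

Lemma block_independence (Q B : nat) (X : nat -> set block_data) : (0 < B)%N ->
  (forall q, (q < Q)%N -> <<s rectangles B >> (X q)) ->
  pr (\bigcap_(q in `I_Q) block (q * B) @^-1` X q)
  = \prod_(q < Q) pr (block 0 @^-1` X q).
Proof.
move=> B0 sX.
(* The events of the first q blocks are arbitrary and the others are rectangles. Blocks are released
   one at a time: with the other events fixed, [indep_of_generator] extends the product formula from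
   rectangles to the whole sigma-algebra. *)
pose PP q := forall X : nat -> set block_data,
  (forall k, (k < q)%N -> <<s rectangles B >> (X k)) ->
  (forall k, (q <= k < Q)%N -> rectangles B (X k)) ->
  pr (\bigcap_(q in `I_Q) block (q * B) @^-1` X q)
  = \prod_(q < Q) pr (block 0 @^-1` X q).
suff : PP Q by apply => // k /andP[]; rewrite leqNgt => /negP.
have rect_gen X' : rectangles B X' -> <<s rectangles B >> X' by exact: sub_gen_smallest.
suff : forall q, (q <= Q)%N -> PP q by exact.
elim=> [_|q IH qQ] {}X {}sX rX.
  have /choice[A HA] : forall k, exists A : (nat -> set R) * (nat -> set nat) * (nat -> set R),
      [/\ forall i, measurable (A.1.1 i), forall i, measurable (A.2 i)
        & (k < Q)%N -> X k = rectangle B A.1.1 A.1.2 A.2].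
    move=> k; have [kQ|kQ] := ltnP k Q.
      have [A1 [A2 [A3 [m1 m3 XE]]]] := rX k kQ.
      by exists (A1, A2, A3); split.
    exists (fun=> setT, fun=> setT, fun=> setT).
    by split => // i; exact: measurableT.
  (* When all the events are rectangles they form a single one over Q B arrivals, in which arrival i
     has position i mod B in block i / B. *)
  pose A1 i := (A (i %/ B)%N).1.1 (i %% B)%N.
  pose A2 i := (A (i %/ B)%N).1.2 (i %% B)%N.
  pose A3 i := (A (i %/ B)%N).2 (i %% B)%N.
  have m1 i : measurable (A1 i) by have [m _ _] := HA (i %/ B)%N; exact: m.
  have m3 i : measurable (A3 i) by have [_ m _] := HA (i %/ B)%N; exact: m.
  have divE (q i : nat) : (i < B)%N -> ((q * B + i) %/ B = q)%N.
    by move=> iB; rewrite divnMDl// divn_small// addn0.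
  have modE (q i : nat) : (i < B)%N -> ((q * B + i) %% B = i)%N.
    by move=> iB; rewrite modnMDl modn_small.
  rewrite (_ : \bigcap_(q in _) _ = block 0 @^-1` rectangle (Q * B) A1 A2 A3).
    rewrite pr_cylinder// big_nat_mul big_mkord; apply: eq_bigr => q _.
    have [n1 n3 ->//] := HA q; rewrite pr_cylinder//.
    rewrite -{1}(add0n (q * B)%N) big_addn mulSn addnK.
    rewrite !big_mkord; apply: eq_bigr => i _.
    by rewrite /A1 /A2 /A3 addnC divE// modE.
  apply/seteqP; split => w /= Hw.
    move=> i iQB; have qQ : (i %/ B < Q)%N by rewrite ltn_divLR.
    have := Hw _ qQ; have [_ _ ->//] := HA (i %/ B)%N => /(_ (i %% B)%N).
    by rewrite ltn_pmod// => /(_ isT); rewrite /= -divn_eq.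
  move=> q qQ; have [_ _ ->//] := HA q => i iB.
  have := Hw (q * B + i)%N; rewrite /A1 /A2 /A3 /= divE// modE// add0n; apply.
  by rewrite (leq_trans (n := q.+1 * B))// ?leq_mul2r ?qQ ?orbT// mulSnr ltn_add2l.
have mblock k : (k < Q)%N -> <<s rectangles B >> (X k).
  move=> kQ; have [kq|kq] := ltnP k q.+1; first exact: sX.
  by apply: rect_gen; apply: rX; rewrite kq kQ.
pose A := \bigcap_(k in [set k | (k < Q)%N /\ k != q]) block (k * B) @^-1` X k.
pose g := \prod_(k < Q | val k != q) pr (block 0 @^-1` X k).
have finD : finite_set [set k | (k < Q)%N /\ k != q].
  by apply: (sub_finite_set (B := `I_Q)) => // k [].
have mA : measurable A.
  apply: fin_bigcap_measurable => // k [kQ _].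
  exact: measurable_block (mblock k kQ).
have AE (Y : set block_data) : A `&` block (q * B) @^-1` Y
    = \bigcap_(k in `I_Q) block (k * B) @^-1` (if k == q then Y else X k).
  apply/seteqP; split => w.
    move=> [Aw Yw] k /= kQ; case: eqVneq => [->//|kq]; exact: Aw.
  move=> H; split; last by have := H q qQ; rewrite /= eqxx.
  by move=> k [kQ kq]; have := H k kQ; rewrite /= (negbTE kq).
have gE (Y : set block_data) : g * pr (block 0 @^-1` Y)
    = \prod_(k < Q) pr (block 0 @^-1` (if k == q :> nat then Y else X k)).
  rewrite [RHS](bigD1 (Ordinal qQ))//= eqxx mulrC; congr (_ * _).
  by apply: eq_big => // k kq; rewrite (negbTE kq).
have XE : \bigcap_(k in `I_Q) block (k * B) @^-1` X k = A `&` block (q * B) @^-1` X q.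
  rewrite AE; apply: eq_bigcapr => k _; by case: eqVneq => // ->.
rewrite XE; apply: EFin_inj.
have mAX Y : <<s rectangles B >> Y -> measurable (A `&` block (q * B) @^-1` Y).
  by move=> sY; apply: measurableI => //; exact: measurable_block sY.
rewrite -prE; last exact: (mAX _ (sX q (ltnSn q))).
rewrite (@indep_of_generator _ _ _ P _ _ (@rectangles_setI B) (rectangles_setT B)
  (block (q * B)) (block 0) A g mA).
- rewrite prE; last exact: measurable_block (sX q (ltnSn q)).
  rewrite -EFinM gE; congr EFin; apply: eq_bigr => k _.
  by case: eqVneq => // ->.
- by apply: prodr_ge0 => k _; exact: pr_ge0.
- by move=> Y /rect_gen; exact: measurable_block.
- by move=> Y /rect_gen; exact: measurable_block.
- move=> Y rY; rewrite prE; last exact: (mAX _ (rect_gen _ rY)).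
  rewrite prE; last exact: measurable_block (rect_gen _ rY).
  rewrite -EFinM gE AE; congr EFin.
  rewrite (IH (ltnW qQ) (fun k => if k == q then Y else X k)) => [//|k kq|k /andP[qk kQ]].
    by rewrite ltn_eqF//; apply: sX; exact: ltnW.
  case: eqVneq => [//|kq]; apply: rX.
  by rewrite kQ andbT ltn_neqAle eq_sym kq.
- exact: sX.
Qed.

End blocks.

(** * Success of a block *)

Section block_success.
Context {R : realType}.

Lemma clearing_ext (xi xi' s s' : nat -> R) (c c' : nat -> nat) j v B :
  (forall i, (i < B)%N -> [/\ xi i = xi' i, s i = s' i & c i = c' i]) ->
  forall k, (k <= B)%N -> clearing xi s c j v k = clearing xi' s' c' j v k.
Proof.
move=> H; elim=> [//|k IH] kB; rewrite !clearingS IH 1?ltnW//.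
have [_ -> ->] := H k kB; rewrite /arrival.
rewrite (eq_bigr (fun i : 'I_k.+1 => xi' i))// => i _.
by have [] := H i (leq_trans (ltn_ord i) kB).
Qed.

Lemma waiting_ext (xi xi' s s' : nat -> R) (c c' : nat -> nat) j v B t :
  (forall i, (i < B)%N -> [/\ xi i = xi' i, s i = s' i & c i = c' i]) ->
  waiting xi s c j v B t = waiting xi' s' c' j v B t.
Proof.
move=> H; apply: eq_bigr => k _; rewrite (clearing_ext j v H (ltn_ord k)).
have [_ _ ->] := H k (ltn_ord k); rewrite /arrival.
rewrite (eq_bigr (fun i : 'I_k.+1 => xi' i))// => i _.
by have [] := H i (leq_trans (ltn_ord i) (ltn_ord k)).
Qed.

Definition block_waiting (z : block_data R) (B j : nat) (L : R) : nat :=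
  waiting (fun i => (z i).1.1) (fun i => (z i).2) (fun i => (z i).1.2) j 0 B L.

Definition success (n B m : nat) (L : R) : set (block_data R) :=
  [set z | exists j : 'I_n, (m <= block_waiting z B j L)%N].

Lemma measurable_success n B m L : <<s @rectangles R B >> (success n B m L).
Proof.
pose U := g_sigma_algebraType (@rectangles R B).
(* Coordinates from B on are not measurable for [rectangles B]; replacing them by constants does not
   change [block_waiting]. *)
pose xi i (z : U) : R := if (i < B)%N then (z i).1.1 else 0.
pose s i (z : U) : R := if (i < B)%N then (z i).2 else 0.
pose c i (z : U) : nat := if (i < B)%N then (z i).1.2 else 0%N.
have mrect X : @rectangles R B X -> measurable (X : set U) by exact: sub_gen_smallest.
have mxi i : measurable_fun setT (xi i).
  rewrite /xi; case: ltnP => [iB|_]; last exact: measurable_cst.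
  move=> _ A mA; rewrite setTI; apply: mrect.
  exists (fun k => if k == i then A else setT), (fun=> setT), (fun=> setT).
  split => [k|//|]; first by case: eqP.
  apply/seteqP; split => z /= Hz; last by have [] := Hz i iB; rewrite eqxx.
  by move=> k kB; split => //; case: eqP => // ->.
have ms i : measurable_fun setT (s i).
  rewrite /s; case: ltnP => [iB|_]; last exact: measurable_cst.
  move=> _ A mA; rewrite setTI; apply: mrect.
  exists (fun=> setT), (fun=> setT), (fun k => if k == i then A else setT).
  split => [//|k|]; first by case: eqP.
  apply/seteqP; split => z /= Hz; last by have [] := Hz i iB; rewrite eqxx.
  by move=> k kB; split => //; case: eqP => // ->.
have mc i (j : nat) : measurable [set z | c i z = j].
  rewrite /c; case: ltnP => [iB|_]; last first.
    by rewrite (_ : [set _ | _] = if 0%N == j then setT else set0); [case: ifP|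
      case: eqP => h; apply/seteqP; split].
  apply: mrect; exists (fun=> setT), (fun k => if k == i then [set j] else setT), (fun=> setT).
  split => //; apply/seteqP; split => z /= Hz; last by have [] := Hz i iB; rewrite eqxx.
  by move=> k kB; split => //; case: eqP => // ->.
suff : measurable (success n B m L : set U) by [].
rewrite (_ : success n B m L = \bigcup_(j in [set` enum 'I_n])
  ((fun z : U => (waiting (xi ^~ z) (s ^~ z) (c ^~ z) j 0 B L)%:R : R) @^-1` `[m%:R, +oo[)).
  apply: fin_bigcup_measurable => // j _; rewrite -[X in measurable X]setTI.
  by apply: measurable_waiting => //; exact: measurable_cst.
have E (z : U) (j : nat) : block_waiting z B j L = waiting (xi ^~ z) (s ^~ z) (c ^~ z) j 0 B L.
  by apply: waiting_ext => i iB; rewrite /xi /s /c iB.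
apply/seteqP; split => z /=.
  by move=> [j]; rewrite E => Hj; exists j; rewrite /= ?mem_enum// in_itv/= andbT ler_nat.
by move=> [j _]; rewrite /= in_itv/= andbT ler_nat -E => Hj; exists j.
Qed.

End block_success.

Lemma bernoulli_ineq (R : realDomainType) (x : R) n : 0 <= x <= 1 ->
  1 - n%:R * x <= (1 - x) ^+ n.
Proof.
move=> /andP[x0 x1]; elim: n => [|n IH]; first by rewrite mul0r subr0 expr0.
rewrite exprS; have : (1 - x) * (1 - n%:R * x) <= (1 - x) * (1 - x) ^+ n.
  by rewrite ler_wpM2l// subr_ge0.
apply: le_trans; rewrite -natr1; have := ler0n R n; nra.
Qed.

Section success_probability.
Context d (T : measurableType d) (R : realType) (P : probability T R) (n : nat).
Variables (S : supermarket_input P n) (lambda : R).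
Hypotheses (lambda0 : 0 < lambda) (lambda1 : lambda < 1) (n0 : (0 < n)%N).
Hypotheses (HS : is_supermarket S lambda) (stS : stationary S).

Local Notation pr := (pr P).
Local Notation rate := (lambda * n%:R).

Let nn_xi w k : nonneg_clocks S w -> 0 <= interarrival S k w.
Proof. by move=> nn; exact: (nn (Interarrival n k)). Qed.

Let nn_s w k : nonneg_clocks S w -> 0 <= service S k w.
Proof. by move=> nn; exact: (nn (Service n k)). Qed.

Let nn_sig w j k : nonneg_clocks S w -> 0 <= initial_service S j k w.
Proof. by move=> nn; exact: (nn (InitialService j k)). Qed.

(** By [waiting_shift], a queue that is long when fed by the block alone is long in the true system,
    at time L after the first b arrivals. *)
Lemma success_max_queue b B m L w : nonneg_clocks S w -> 0 <= L ->
  success n B m L (block S b w) ->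
  (m <= max_queue S (\sum_(i < b) interarrival S i w + L) w)%N.
Proof.
move=> nn L0 [j mj]; set t := _ + L.
have [N hN] := arrivals_after HS t w.
apply: leq_trans (leq_max_queue S t w j).
rewrite (@queue_lengthE _ _ _ _ _ _ (N + (b + B))); last first.
  by move=> k Nk; apply: hN; rewrite (leq_trans _ Nk)// leq_addr.
rewrite /number_waiting (leq_trans mj)//.
apply: leq_trans (leq_addl _ _).
apply: waiting_shift => //; last exact: leq_addl.
by move=> k; exact: nn_xi.
Qed.

Let overload (j : 'I_n) (r k : nat) : set T := [set w | \sum_(i < k.+1) interarrival S i w
     <= \sum_(l < r) initial_service S j l w
        + \sum_(i < k) (if queue_choice S i w == j :> nat then service S i w else 0)].

(** A converse for the first block: when the work of the initial customers and of the first k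
    arrivals is absorbed before customer k arrives, [waiting_forget] removes the influence of the
    initial state. *)
Lemma max_queue_success B m L r k w : nonneg_clocks S w ->
  (forall j, (initial_state S w j <= r)%N) ->
  (forall j, ~ overload j r k w) ->
  \sum_(i < k.+1) interarrival S i w <= L ->
  L < \sum_(i < B) interarrival S i w ->
  (m <= max_queue S L w)%N -> success n B m L (block S 0 w).
Proof.
move=> nn xr nov kL LB mM.
have [j jE] := max_queue_arg S L w n0; exists j.
rewrite (leq_trans mM)// jE (@queue_lengthE _ _ _ _ _ _ B); last first.
  move=> k' Bk'; apply: lt_le_trans LB _.
  rewrite /arrival_time -(subnKC (leqW Bk')) big_split_ord/= lerDl.
  by apply: sumr_ge0 => i _; exact: nn_xi.
apply: (@waiting_forget _ _ _ _ _ j _ _ _ k) => //.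
- by move=> i; exact: nn_xi.
- by move=> i; exact: nn_s.
- by move=> i; exact: nn_sig.
have /negP := nov j; rewrite -ltNge => /ltW; apply: le_trans; rewrite lerD2r.
rewrite -[in leRHS](subnKC (xr j)) big_split_ord/= lerDl.
by apply: sumr_ge0 => i _; exact: nn_sig.
Qed.

Lemma measurable_overload j r k : measurable (overload j r k).
Proof.
rewrite -[X in measurable X]setTI.
apply: measurable_fun_ler => //.
  by apply: measurable_sum => i; exact: measurable_funPT.
apply: measurable_funD; apply: measurable_sum => i; first exact: measurable_funPT.
apply: measurable_fun_ifT => //.
exact: (@measurable_choice _ T (fun k => queue_choice S k) j
  (fun k => measurable_queue_choice S k j)).
Qed.

Lemma success_probability_ge B m L r k theta : 0 <= L -> 0 < theta < 1 ->
  1 - (1 - lambda ^+ m) ^+ n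
  - (n%:R * lambda ^+ r.+1
     + n%:R * ((rate / (rate + theta)) ^+ k.+1 * (1 - theta)^-1 ^+ r
       * (n%:R^-1 / (1 - theta) + (1 - n%:R^-1)) ^+ k)
     + expR (- (rate / 2 * L)) * 2 ^+ k.+1
     + expR (rate * L) * 2^-1 ^+ B)
  <= pr (block S 0 @^-1` success n B m L).
Proof.
move=> L0 th.
pose E1 := [set w | forall j, (initial_state S w j <= r)%N].
pose E2 := \bigcup_(j in [set` enum 'I_n]) overload j r k.
pose E3 := [set w | L <= \sum_(i < k.+1) interarrival S (0 + i) w].
pose E4 := [set w | \sum_(i < B) interarrival S (0 + i) w <= L].
pose A := [set w | (m <= max_queue S L w)%N].
have mE1 : measurable E1.
  exact: (measurable_initial_event HS [set x | forall j, (x j <= r)%N]).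
have mE2 : measurable E2.
  by apply: fin_bigcup_measurable => // j _; exact: measurable_overload.
have msum N : measurable_fun setT (fun w => \sum_(i < N) interarrival S (0 + i) w).
  by apply: measurable_sum => i; exact: measurable_funPT.
have mE3 : measurable E3.
  by rewrite -[X in measurable X]setTI; apply: measurable_fun_ler.
have mE4 : measurable E4.
  by rewrite -[X in measurable X]setTI; apply: measurable_fun_ler.
have mA : measurable A by exact: (measurable_max_queue_event HS L [set k | (m <= k)%N]).
have mN := measurable_nonneg_clocks HS.
have mS : measurable (block S 0 @^-1` success n B m L).
  by apply: measurable_block; exact: measurable_success.
have prA : pr A = 1 - (1 - lambda ^+ m) ^+ n.
  (* [pr_max_queue] concerns m - 1. For m = 0 the event is sure, and the formula agrees because 0^n
     = 0 for n positive. *)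
  have [m0|m0] := posnP m.
    rewrite (_ : A = setT) ?pr_setT; last by apply/seteqP; split => w //; rewrite /A /= m0.
    by rewrite m0 expr0 subrr expr0n eqn0Ngt n0 subr0.
  have -> : lambda ^+ m = lambda ^+ m.-1.+1 by rewrite prednK.
  rewrite -(pr_max_queue lambda0 lambda1 n0 HS stS m.-1 L0) -pr_setC.
    congr (pr _); apply/seteqP; split => w; rewrite /A /=.
      by rewrite -[in X in X -> _](prednK m0) ltnNge => /negP.
    by move=> /negP; rewrite -ltnNge prednK.
  exact: (measurable_max_queue_event HS L [set k | (k <= m.-1)%N]).
have cover : A `<=` (block S 0 @^-1` success n B m L)
    `|` (~` nonneg_clocks S `|` (~` E1 `|` (E2 `|` (E3 `|` E4)))).
  move=> w Aw; have [nn|] := pselect (nonneg_clocks S w); last by right; left.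
  have [e1|] := pselect (E1 w); last by right; right; left.
  have [|e2] := pselect (E2 w); first by right; right; right; left.
  have [|e3] := pselect (E3 w); first by right; right; right; right; left.
  have [|e4] := pselect (E4 w); first by right; right; right; right; right.
  left; apply: (max_queue_success (k := k)) Aw => //.
  - by move=> j oj; apply: e2; exists j => //=; rewrite mem_enum.
  - by move: e3 => /negP; rewrite -ltNge => /ltW.
  - by move: e4 => /negP; rewrite -ltNge.
have m3 := measurableU _ _ mE3 mE4; have m2 := measurableU _ _ mE2 m3.
have m1 := measurableU _ _ (measurableC mE1) m2.
have m0 := measurableU _ _ (measurableC mN) m1.
have := le_pr P mA (measurableU _ _ mS m0) cover; rewrite prA.
have := pr_setU_le P mS m0; have := pr_setU_le P (measurableC mN) m1.
have := pr_setU_le P (measurableC mE1) m2; have := pr_setU_le P mE2 m3.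
have := pr_setU_le P mE3 mE4.
rewrite (pr_nonneg_clocksC HS) (pr_setC P mE1) (pr_initial_le lambda0 lambda1 n0 HS stS).
have := arrivals_slow HS lambda0 n0 0 k.+1 L; rewrite -/E3.
have := arrivals_fast HS lambda0 n0 0 B L; rewrite -/E4.
have : pr E2 <= n%:R * ((rate / (rate + theta)) ^+ k.+1 * (1 - theta)^-1 ^+ r
       * (n%:R^-1 / (1 - theta) + (1 - n%:R^-1)) ^+ k).
  apply: le_trans (pr_bigcup_le _ _) _; first by move=> j _; exact: measurable_overload.
  rewrite big_enum/=; set Y := (X in _ <= n%:R * X).
  have -> : n%:R * Y = \sum_(j < n) Y by rewrite sumr_const card_ord mulr_natl.
  by apply: ler_sum => j _; exact: workload_chernoff.
have : 1 - (1 - lambda ^+ r.+1) ^+ n <= n%:R * lambda ^+ r.+1.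
  have l01 : 0 <= lambda ^+ r.+1 <= 1.
    by rewrite exprn_ge0 ?exprn_ile1 ?(ltW lambda0) ?(ltW lambda1).
  by have := bernoulli_ineq n l01; lra.
lra.
Qed.

End success_probability.

(** * Extremes over a time interval *)

Section sums_in_windows.

Lemma leq_sum_ord (g : nat -> nat) a b : (a <= b)%N ->
  (\sum_(i < a) g i <= \sum_(i < b) g i)%N.
Proof. by move=> ab; rewrite -(subnKC ab) big_split_ord/= leq_addr. Qed.

Lemma sum_window (f g : nat -> nat) (k0 M N : nat) : (forall k, (f k <= g k)%N) ->
  (forall k, (0 < f k)%N -> (k0 <= k < k0 + M)%N) ->
  (\sum_(k < N) f k <= \sum_(i < M) g (k0 + i))%N.
Proof.
move=> fg f0.
suff : (\sum_(k < N) f k <= \sum_(i < minn (N - k0) M) g (k0 + i))%N.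
  move=> /leq_trans; apply; apply: (leq_sum_ord (fun i => g (k0 + i)%N)).
  exact: geq_minr.
elim: N => [|N IH]; first by rewrite big_ord0.
rewrite big_ord_recr/=; have [fN|fN] := posnP (f N).
  rewrite fN addn0 (leq_trans IH)//.
  have le : (minn (N - k0) M <= minn (N.+1 - k0) M)%N by lia.
  exact: (leq_sum_ord (fun i => g (k0 + i)%N) le).
have /andP[k0N NM] := f0 N fN.
have -> : minn (N.+1 - k0) M = (minn (N - k0) M).+1 by lia.
rewrite big_ord_recr/= leq_add//.
have -> : (k0 + minn (N - k0) M = N)%N by lia.
exact: fg.
Qed.

End sums_in_windows.

Section extremal_bounds.
Context d (T : measurableType d) (R : realType) (P : probability T R) (n : nat).
Variables (S : supermarket_input P n) (lambda : R).
Hypotheses (lambda0 : 0 < lambda) (lambda1 : lambda < 1) (n0 : (0 < n)%N).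
Hypotheses (HS : is_supermarket S lambda) (stS : stationary S).

Local Notation pr := (pr P).
Local Notation rate := (lambda * n%:R).

Let nn_xi w k : nonneg_clocks S w -> 0 <= interarrival S k w.
Proof. by move=> nn; exact: (nn (Interarrival n k)). Qed.

Let msum (k N : nat) : measurable_fun setT (fun w => \sum_(i < N) interarrival S (k + i) w).
Proof. by apply: measurable_sum => i; exact: measurable_funPT. Qed.

Definition fast (k N : nat) (t : R) : set T :=
  [set w | \sum_(i < N) interarrival S (k + i) w <= t].

Lemma measurable_fast k N t : measurable (fast k N t).
Proof. by rewrite -[X in measurable X]setTI; apply: measurable_fun_ler. Qed.

Lemma not_fast_arrival N t w k : nonneg_clocks S w -> ~ fast 0 N t w ->
  (N <= k)%N -> t < arrival_time S k w.
Proof.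
move=> nn /negP; rewrite -ltNge => tN Nk; apply: lt_le_trans tN _.
rewrite /arrival_time -(subnKC (leqW Nk)) big_split_ord/= lerDl.
by apply: sumr_ge0 => i _; exact: nn_xi.
Qed.

Let measurable_max_event t (A : set nat) := measurable_max_queue_event HS t A.

Lemma pr_max_queue_gt m t : 0 <= t ->
  pr [set w | (m < max_queue S t w)%N] <= n%:R * lambda ^+ m.+1.
Proof.
move=> t0.
have l01 : 0 <= lambda ^+ m.+1 <= 1.
  by rewrite exprn_ge0 ?exprn_ile1 ?(ltW lambda0) ?(ltW lambda1).
have := bernoulli_ineq n l01.
rewrite -(pr_max_queue lambda0 lambda1 n0 HS stS m t0).
rewrite lerBlDl -lerBlDr -pr_setC; last exact: (measurable_max_event t [set k | (k <= m)%N]).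
rewrite (_ : ~` _ = [set w | (m < max_queue S t w)%N])//.
by apply/seteqP; split => w /=; rewrite ltnNge => /negP.
Qed.

Lemma pr_min_gt tau m : 0 <= tau ->
  pr [set w | m%:R < min_max_queue S tau w] <= n%:R * lambda ^+ m.+1.
Proof.
move=> tau0; apply: le_trans (pr_max_queue_gt m (lexx 0)).
apply: le_pr.
- rewrite -[X in measurable X]setTI; apply: measurable_fun_ltr => //.
  exact: (measurable_min_max_queue HS).
- exact: (measurable_max_event 0 [set k | (m < k)%N]).
- move=> w /= mw; rewrite -(ltr_nat R); apply: lt_le_trans mw _.
  by apply: min_max_queue_le; rewrite lexx.
Qed.

Lemma grid_point (tau delta t : R) : 0 < delta -> 0 <= t <= tau ->
  exists2 g, (g <= Num.truncn (tau / delta))%N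
    & (g%:R * delta <= t <= g%:R * delta + delta)%R.
Proof.
move=> d0 /andP[t0 ttau]; exists (Num.truncn (t / delta)).
  by apply: le_truncn; rewrite ler_pM2r// invr_gt0.
have /andP[h1 h2] : (Num.truncn (t / delta))%:R <= t / delta < (Num.truncn (t / delta)).+1%:R.
  by apply: truncn_itv; rewrite divr_ge0// ltW.
rewrite -ler_pdivlMr// h1/=.
by move: h2; rewrite ltr_pdivrMr// -natr1 mulrDl mul1r => /ltW.
Qed.

(** By [one_departure] the longest queue at a mesh point loses at most one customer before the next
    point, so a maximum of at least m + 1 at all mesh points suffices. The error terms are for a
    short maximum at a mesh point, N arrivals by tau, a service shorter than delta of an arriving or
    an initial customer, and an initial queue longer than x. *)
Lemma pr_min_lt tau delta m N x : 0 <= tau -> 0 < delta ->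
  pr [set w | min_max_queue S tau w < m%:R]
  <= (Num.truncn (tau / delta)).+1%:R * (1 - lambda ^+ m.+1) ^+ n
     + expR (rate * tau) * 2^-1 ^+ N + N%:R * delta + n%:R * x%:R * delta
     + n%:R * lambda ^+ x.+1.
Proof.
move=> tau0 d0; set G := Num.truncn _.
pose E0 := ~` nonneg_clocks S.
pose E1 := \bigcup_(g in `I_G.+1) [set w | (max_queue S (g%:R * delta) w <= m)%N].
pose E2 := fast 0 N tau.
pose E3 := \bigcup_(k in `I_N) short S (Service n k) delta.
pose E4 := \bigcup_(j in [set` enum 'I_n]) \bigcup_(i in `I_x) short S (InitialService j i) delta.
pose E5 := ~` [set w | forall j, (initial_state S w j <= x)%N].
have m0 : measurable E0 by apply: measurableC; exact: measurable_nonneg_clocks HS.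
have m1 : measurable E1.
  apply: fin_bigcup_measurable; first exact: finite_II.
  by move=> g _; exact: (measurable_max_event _ [set k | (k <= m)%N]).
have m2 : measurable E2 by exact: measurable_fast.
have m3 : measurable E3.
  by apply: fin_bigcup_measurable => [|k _]; [exact: finite_II|exact: measurable_short HS _ _].
have m4j (j : 'I_n) : measurable (\bigcup_(i in `I_x) short S (InitialService j i) delta).
  by apply: fin_bigcup_measurable => [|k _]; [exact: finite_II|exact: measurable_short HS _ _].
have m4 : measurable E4 by exact: fin_bigcup_measurable.
have mI : measurable [set w | forall j, (initial_state S w j <= x)%N].
  exact: (measurable_initial_event HS [set y | forall j, (y j <= x)%N]).
have m5 : measurable E5 by exact: measurableC.
have mmin : measurable [set w | min_max_queue S tau w < m%:R].
  rewrite -[X in measurable X]setTI; apply: measurable_fun_ltr => //.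
  exact: (measurable_min_max_queue HS).
have cover : [set w | min_max_queue S tau w < m%:R] `<=`
    E0 `|` (E1 `|` (E2 `|` (E3 `|` (E4 `|` E5)))).
  move=> w mw; have [|e0] := pselect (E0 w); first by left.
  have [|e1] := pselect (E1 w); first by right; left.
  have [|e2] := pselect (E2 w); first by right; right; left.
  have [|e3] := pselect (E3 w); first by right; right; right; left.
  have [|e4] := pselect (E4 w); first by do 4 right; left.
  have [|e5] := pselect (E5 w); first by do 5 right.
  exfalso; move: mw => /=; apply/negP; rewrite -leNgt.
  have nn : nonneg_clocks S w by exact: contrapT e0.
  have xx : forall j, (initial_state S w j <= x)%N by exact: contrapT e5.
  apply: min_max_queue_ge => // t ttau; rewrite ler_nat.
  have [g gG gt] := grid_point d0 ttau; set u := g%:R * delta in gt.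
  have mu : (m < max_queue S u w)%N.
    by rewrite ltnNge; apply/negP => H; apply: e1; exists g.
  have [j jE] := max_queue_arg S u w n0.
  apply: leq_trans (leq_max_queue S t w j); rewrite -ltnS.
  rewrite jE in mu; apply: leq_trans mu _.
  have arr v k : v <= tau -> (N <= k)%N -> v < arrival_time S k w.
    by move=> vt Nk; apply: le_lt_trans vt _; exact: not_fast_arrival Nk.
  have /andP[t0 tt] := ttau; have /andP[ut tu] := gt.
  rewrite !(@queue_lengthE _ _ _ _ _ _ N); last 2 first.
  - by move=> k; exact: arr.
  - by move=> k; apply: arr; exact: le_trans tt.
  rewrite /number_waiting; apply: (one_departure _ _ _ erefl (ltW d0) gt).
  - move=> i ix; rewrite ltNge; apply/negP => H; apply: e4.
    exists j; first by rewrite /= mem_enum.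
    by exists i; [rewrite /= (leq_trans ix)|rewrite /short/= in_itv].
  - move=> k kN; rewrite ltNge; apply/negP => H; apply: e3.
    by exists k => //; rewrite /short/= in_itv.
have c4 := measurableU _ _ m4 m5; have c3 := measurableU _ _ m3 c4.
have c2 := measurableU _ _ m2 c3; have c1 := measurableU _ _ m1 c2.
have c0 := measurableU _ _ m0 c1.
have := le_pr P mmin c0 cover.
have := pr_setU_le P m0 c1; have := pr_setU_le P m1 c2; have := pr_setU_le P m2 c3.
have := pr_setU_le P m3 c4; have := pr_setU_le P m4 m5.
rewrite (pr_nonneg_clocksC HS) (pr_setC P mI) (pr_initial_le lambda0 lambda1 n0 HS stS).
have := arrivals_fast HS lambda0 n0 0 N tau; rewrite -/(fast 0 N tau) -/E2.
have : pr E1 <= G.+1%:R * (1 - lambda ^+ m.+1) ^+ n.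
  apply: le_trans (pr_bigcup_ord_le _ _) _.
    by move=> g _; exact: (measurable_max_event _ [set k | (k <= m)%N]).
  rewrite mulr_natl -[in leRHS](card_ord G.+1) -sumr_const.
  apply: ler_sum => g _; rewrite (pr_max_queue lambda0 lambda1 n0 HS stS)//.
  by rewrite mulr_ge0// ltW.
have : pr E3 <= N%:R * delta.
  apply: le_trans (pr_bigcup_ord_le _ _) _.
    by move=> k _; exact: measurable_short HS _ _.
  rewrite mulr_natl -[in leRHS](card_ord N) -sumr_const.
  apply: ler_sum => k _; rewrite -[leRHS]mul1r.
  exact: (pr_short_le HS lambda0 n0 (v := Service n k)).
have : pr E4 <= n%:R * x%:R * delta.
  apply: le_trans (pr_bigcup_le _ _) _ => //.
  rewrite big_enum/= -mulrA mulr_natl -[in leRHS](card_ord n) -sumr_const.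
  apply: ler_sum => j _; apply: le_trans (pr_bigcup_ord_le _ _) _.
    by move=> k _; exact: measurable_short HS _ _.
  rewrite mulr_natl -[in leRHS](card_ord x) -sumr_const.
  apply: ler_sum => k _; rewrite -[leRHS]mul1r.
  exact: (pr_short_le HS lambda0 n0 (v := InitialService j k)).
have l01 : 0 <= lambda ^+ x.+1 <= 1.
  by rewrite exprn_ge0 ?exprn_ile1 ?(ltW lambda0) ?(ltW lambda1).
by have := bernoulli_ineq n l01; lra.
Qed.

Definition crowded (k W r : nat) (j : 'I_n) : set T :=
  [set w | r%:R <= (\sum_(i < W) (queue_choice S (k + i) w == j :> nat))%:R :> R].

Lemma measurable_crowded k W r j : measurable (crowded k W r j).
Proof.
rewrite -[X in measurable X]setTI.
apply: (@measurable_fun_ler _ _ _ _ (cst r%:R)) => //.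
under eq_fun do rewrite natr_sum.
apply: measurable_sum => i; apply: measurable_natr_bool.
exact: (@measurable_choice _ T (fun k => queue_choice S k) j
  (fun k => measurable_queue_choice S k j)).
Qed.

(** The uncountable family of intervals is replaced by the index k0 of the first arrival after t: if
    the W interarrival times following it exceed 1 in total, only the W + 1 customers from k0 on can
    arrive in the interval. *)
Lemma arrivals_unit_interval N W r t u (j : 'I_n) w : nonneg_clocks S w ->
  u <= t + 1 ->
  (forall k, (k < N)%N -> ~ fast k.+1 W 1 w) ->
  (forall k, (k < N)%N -> ~ crowded k W.+1 r j w) ->
  (\sum_(k < N) ((queue_choice S k w == j :> nat) &&
      (t < arrival (interarrival S ^~ w) k <= u)%R) <= r)%N.
Proof.
move=> nn ut nf nc; set a := arrival _.
have a_homo : {homo a : k l / (k <= l)%N >-> k <= l}.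
  by apply: arrival_homo => k; exact: nn_xi.
have [N' hN'] := arrivals_after HS t w.
have ex : exists k, t < a k by exists N'; exact: hN'.
case: (ex_minnP ex) => k0 tk0 mink0.
have [k0N|Nk0] := ltnP k0 N; last first.
  rewrite big1// => k _; apply/eqP; rewrite eqb0; apply/negP => /andP[_ /andP[tk _]].
  by have := mink0 k tk; rewrite leqNgt (leq_trans (ltn_ord k)).
pose f k : nat := (queue_choice S k w == j :> nat) && (t < a k <= u).
pose g k : nat := queue_choice S k w == j :> nat.
apply: leq_trans (@sum_window f g k0 W.+1 N _ _) _.
- by move=> k; rewrite /f /g; case: (_ == _) => //=; exact: leq_b1.
- move=> k; rewrite /f lt0b => /and3P[_ tk ku]; rewrite (mink0 k tk)/= ltnNge.
  apply/negP => k0k; apply: (nf k0 k0N); rewrite /fast/=.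
  have : a (k0 + W.+1)%N <= u by apply: le_trans ku; exact: a_homo.
  rewrite /a /arrival -addSn big_split_ord/= => H.
  have : t + \sum_(i < W) interarrival S (k0.+1 + i) w <= t + 1.
    apply: le_trans ut; apply: le_trans H; rewrite lerD//; first exact: ltW.
    rewrite big_ord_recr/= lerDl; exact: nn_xi.
  by rewrite lerD2l.
have /negP := nc k0 k0N; rewrite -ltNge ltr_nat; exact: ltnW.
Qed.

(** With a mesh of width 1, a queue exceeds its length at the last mesh point by at most the
    arrivals to it in between. The error terms are for a long maximum at a mesh point, N arrivals by
    tau, W arrivals in unit time, and r customers among W + 1 choosing the same queue. *)
Lemma pr_max_gt tau m N W r theta : 0 <= tau -> 0 <= theta ->
  pr [set w | (m + r)%:R < max_max_queue S tau w]
  <= (Num.truncn tau).+1%:R * (n%:R * lambda ^+ m.+1)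
     + expR (rate * tau) * 2^-1 ^+ N + N%:R * (expR rate * 2^-1 ^+ W)
     + N%:R * (n%:R * (expR (- (theta * r%:R)) * (1 + (expR theta - 1) / n%:R) ^+ W.+1)).
Proof.
move=> tau0 th0; set G := Num.truncn tau.
pose E0 := ~` nonneg_clocks S.
pose E1 := \bigcup_(g in `I_G.+1) [set w | (m < max_queue S g%:R w)%N].
pose E2 := fast 0 N tau.
pose E3 := \bigcup_(k in `I_N) fast k.+1 W 1.
pose E4 := \bigcup_(k in `I_N) \bigcup_(j in [set` enum 'I_n]) crowded k W.+1 r j.
have m0 : measurable E0 by apply: measurableC; exact: measurable_nonneg_clocks HS.
have m1 : measurable E1.
  apply: fin_bigcup_measurable; first exact: finite_II.
  by move=> g _; exact: (measurable_max_queue_event HS _ [set k | (m < k)%N]).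
have m2 : measurable E2 by exact: measurable_fast.
have m3 : measurable E3.
  by apply: fin_bigcup_measurable => [|k _]; [exact: finite_II|exact: measurable_fast].
have m4k k : measurable (\bigcup_(j in [set` enum 'I_n]) crowded k W.+1 r j).
  by apply: fin_bigcup_measurable => // j _; exact: measurable_crowded.
have m4 : measurable E4.
  by apply: fin_bigcup_measurable => [|k _]; [exact: finite_II|exact: m4k].
have mmax : measurable [set w | (m + r)%:R < max_max_queue S tau w].
  rewrite -[X in measurable X]setTI; apply: measurable_fun_ltr => //.
  exact: (measurable_max_max_queue HS).
have cover : [set w | (m + r)%:R < max_max_queue S tau w] `<=`
    E0 `|` (E1 `|` (E2 `|` (E3 `|` E4))).
  move=> w mw; have [|e0] := pselect (E0 w); first by left.
  have [|e1] := pselect (E1 w); first by right; left.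
  have [|e2] := pselect (E2 w); first by right; right; left.
  have [|e3] := pselect (E3 w); first by right; right; right; left.
  have [|e4] := pselect (E4 w); first by do 4 right.
  exfalso; move: mw => /=; apply/negP; rewrite -leNgt.
  have nn : nonneg_clocks S w by exact: contrapT e0.
  apply: max_max_queue_le => // t ttau; rewrite ler_nat; apply/max_queue_leP => j.
  have [g] := grid_point ltr01 ttau.
  rewrite divr1 mulr1 => gG /andP[gt tg].
  have mg : (queue_length S g%:R w j <= m)%N.
    apply: leq_trans (leq_max_queue S _ w j) _.
    by rewrite leqNgt; apply/negP => H; apply: e1; exists g.
  have arr v k : v <= tau -> (N <= k)%N -> v < arrival_time S k w.
    by move=> vt Nk; apply: le_lt_trans vt _; exact: (not_fast_arrival nn e2).
  have /andP[t0 tt] := ttau.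
  have qt : queue_length S t w j = number_waiting S N t w j.
    by apply: queue_lengthE => k; exact: (arr _ _ tt).
  have qg : queue_length S g%:R w j = number_waiting S N g%:R w j.
    by apply: queue_lengthE => k; exact: (arr _ _ (le_trans gt tt)).
  rewrite qt; apply: leq_trans (waiting_le_arrivals _ _ _ _ _ _ _ _ gt) _.
  rewrite leq_add//; first by rewrite -/(number_waiting S N g%:R w j) -qg.
  apply: (arrivals_unit_interval (W := W) nn tg).
  - by move=> k kN H; apply: e3; exists k.
  - by move=> k kN H; apply: e4; exists k => //; exists j; rewrite /= ?mem_enum.
have c3 := measurableU _ _ m3 m4.
have c2 := measurableU _ _ m2 c3; have c1 := measurableU _ _ m1 c2.
have c0 := measurableU _ _ m0 c1.
have := le_pr P mmax c0 cover.
have := pr_setU_le P m0 c1; have := pr_setU_le P m1 c2; have := pr_setU_le P m2 c3.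
have := pr_setU_le P m3 m4.
rewrite (pr_nonneg_clocksC HS).
have := arrivals_fast HS lambda0 n0 0 N tau; rewrite -/(fast 0 N tau) -/E2.
have sumc (K : nat) (Y : R) : K%:R * Y = \sum_(k < K) Y by rewrite sumr_const card_ord mulr_natl.
have : pr E1 <= G.+1%:R * (n%:R * lambda ^+ m.+1).
  apply: le_trans (pr_bigcup_ord_le _ _) _.
    by move=> g _; exact: (measurable_max_queue_event HS _ [set k | (m < k)%N]).
  rewrite sumc; apply: ler_sum => g _.
  exact: pr_max_queue_gt.
have : pr E3 <= N%:R * (expR rate * 2^-1 ^+ W).
  apply: le_trans (pr_bigcup_ord_le _ _) _; first by move=> k _; exact: measurable_fast.
  rewrite sumc; apply: ler_sum => k _.
  by have := arrivals_fast HS lambda0 n0 k.+1 W 1; rewrite mulr1.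
have : pr E4 <= N%:R * (n%:R * (expR (- (theta * r%:R)) * (1 + (expR theta - 1) / n%:R) ^+ W.+1)).
  apply: le_trans (pr_bigcup_ord_le _ _) _ => //.
  rewrite sumc; apply: ler_sum => k _.
  apply: le_trans (pr_bigcup_le _ _) _; first by move=> j _; exact: measurable_crowded.
  rewrite big_enum/= sumc; apply: ler_sum => j _.
  exact: (choices_chernoff HS lambda0 n0).
lra.
Qed.

(** Each block is tested at time L after its start, and this time is at most tau if all Q B arrivals
    come before tau - L. Blocks are disjoint as sets of arrivals, even where the tested times fall
    in a later block. *)
Lemma pr_max_lt tau L B m Q : 0 <= tau -> 0 <= L -> (0 < B)%N ->
  pr [set w | max_max_queue S tau w < m%:R]
  <= (1 - pr (block S 0 @^-1` success n B m L)) ^+ Q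
     + expR (- (rate / 2 * (tau - L))) * 2 ^+ (Q * B).
Proof.
move=> tau0 L0 B0.
pose fail := ~` (success n B m L : set (block_data R)).
have sfail : <<s @rectangles R B >> fail.
  rewrite /fail -setTD; apply: sigma_algebraCD; exact: measurable_success.
pose E0 := ~` nonneg_clocks S.
pose E1 := \bigcap_(q in `I_Q) block S (q * B) @^-1` fail.
pose E2 := [set w | tau - L <= \sum_(i < Q * B) interarrival S (0 + i) w].
have m0 : measurable E0 by apply: measurableC; exact: measurable_nonneg_clocks HS.
have m1 : measurable E1.
  apply: fin_bigcap_measurable; first exact: finite_II.
  by move=> q _; apply: measurable_block sfail.
have m2 : measurable E2.
  rewrite -[X in measurable X]setTI; apply: measurable_fun_ler => //.
have mmax : measurable [set w | max_max_queue S tau w < m%:R].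
  rewrite -[X in measurable X]setTI; apply: measurable_fun_ltr => //.
  exact: (measurable_max_max_queue HS).
have cover : [set w | max_max_queue S tau w < m%:R] `<=` E0 `|` (E1 `|` E2).
  move=> w mw; have [|e0] := pselect (E0 w); first by left.
  have [|/negP] := pselect (E2 w); first by right; right.
  rewrite -ltNge => e2; right; left => q qQ; rewrite /fail/= => Hs.
  have nn : nonneg_clocks S w by exact: contrapT e0.
  have := success_max_queue HS nn L0 Hs; set t := _ + L => mt.
  move: mw => /=; apply/negP; rewrite -leNgt.
  apply: le_trans (_ : (max_queue S t w)%:R <= _); first by rewrite ler_nat.
  apply: (max_max_queue_ge HS); rewrite addr_ge0//=; last first.
    by apply: sumr_ge0 => i _; exact: nn_xi.
  rewrite /t -lerBrDr; apply: le_trans (ltW e2).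
  have qB : (q * B <= Q * B)%N by rewrite leq_mul2r (ltnW qQ) orbT.
  rewrite -(subnKC qB) [leRHS]big_split_ord/= lerDl.
  by apply: sumr_ge0 => i _; exact: nn_xi.
have c1 := measurableU _ _ m1 m2; have c0 := measurableU _ _ m0 c1.
have := le_pr P mmax c0 cover.
have := pr_setU_le P m0 c1; have := pr_setU_le P m1 m2.
rewrite (pr_nonneg_clocksC HS).
have := arrivals_slow HS lambda0 n0 0 (Q * B) (tau - L); rewrite -/E2.
have : pr E1 = (1 - pr (block S 0 @^-1` success n B m L)) ^+ Q.
  rewrite (block_independence HS _ (X := fun=> fail))// prodr_const card_ord.
  congr (_ ^+ _); rewrite -pr_setC//.
  by apply: measurable_block; exact: measurable_success.
lra.
Qed.

End extremal_bounds.

(** * Asymptotics *)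

Section powers_of_n.
Context {R : realType}.
Implicit Types (a b c x : R) (n : nat).

Lemma near_natr x : \forall n \near \oo, x <= n%:R :> R.
Proof. exact: nbhs_infty_ger. Qed.

Lemma near_gt0 : \forall n \near \oo, (0 < n)%N.
Proof. exact: nbhs_infty_gt. Qed.

Lemma near_ln x : \forall n \near \oo, x <= ln (n%:R : R).
Proof.
have := near_natr (expR x); have := near_gt0.
by apply: filterS2 => n n0; rewrite -ler_ln ?posrE ?expR_gt0 ?ltr0n// expRK.
Qed.

Lemma expR_ln_natr n : (0 < n)%N -> expR (ln n%:R) = n%:R :> R.
Proof. by move=> n0; rewrite lnK// posrE ltr0n. Qed.

Lemma natr_powR n a : (0 < n)%N -> (n%:R : R) `^ a = expR (a * ln n%:R).
Proof. by move=> n0; rewrite /powR pnatr_eq0 eqn0Ngt n0. Qed.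

(** Powers of n are written exp (a ln n), so that estimates of products reduce to linear arithmetic
    on exponents. *)
Lemma near_power a x : 0 < a -> \forall n \near \oo, x <= expR (a * ln (n%:R : R)).
Proof.
move=> a0; have := near_ln (x / a); apply: filterS => n.
rewrite ler_pdivrMr// mulrC => /le_trans; apply.
by apply: le_trans (expR_ge1Dx _); rewrite lerDr.
Qed.

Lemma expR_ge_sqr x : 0 <= x -> (x / 2) ^+ 2 <= expR x.
Proof.
move=> x0; have -> : expR x = expR (x / 2) ^+ 2.
  by rewrite expr2 -expRD; congr expR; lra.
have := expR_ge1Dx (x / 2) => h; have h0 := expR_ge0 (x / 2).
by rewrite ler_pXn2r ?nnegrE ?divr_ge0//; lra.
Qed.

Lemma near_power_exp a b c : 0 < a -> 0 < c ->
  \forall n \near \oo, expR (b * ln (n%:R : R)) * expR (- (c * expR (a * ln (n%:R : R))))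
    <= expR (- ln (n%:R : R)).
Proof.
(* With s = ln n, the bound exp (a s) >= (a s / 2)^2 leaves c a^2 s^2 / 4 against (|b| + 1) s. *)
move=> a0 c0; have := near_ln (4 * (`|b| + 1) / (c * a ^+ 2)).
have := near_ln 0; apply: filterS2 => n; set s := ln _ => s0 sb.
rewrite -expRD ler_expR.
have h : c * (a * s / 2) ^+ 2 <= c * expR (a * s).
  by rewrite ler_pM2l// expR_ge_sqr// mulr_ge0// ltW.
have h2 : 4 * (`|b| + 1) <= s * (c * a ^+ 2).
  by rewrite -ler_pdivrMr// mulr_gt0// exprn_gt0.
have h3 : 4 * (`|b| + 1) * s <= s * (c * a ^+ 2) * s by rewrite ler_wpM2r.
have h4 : b * s <= `|b| * s by rewrite ler_wpM2r// ler_norm.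
have hE : c * (a * s / 2) ^+ 2 = s * (c * a ^+ 2) * s / 4 by field.
rewrite hE in h; move: h h3 h4; set v := s * _ * s; set x := c * expR _.
set y := b * s; move=> h h3 h4; lra.
Qed.

(** One-sided: for nonnegative sequences this is convergence to 0, and upper bounds are enough to
    prove it. *)
Definition vanishing (f : nat -> R) := forall e, 0 < e -> \forall n \near \oo, f n <= e.

Lemma vanishing_le f g : vanishing g -> (\forall n \near \oo, f n <= g n) -> vanishing f.
Proof. by move=> vg fg e e0; have := vg e e0; apply: filterS2 fg => n; exact: le_trans. Qed.

Lemma vanishingD f g : vanishing f -> vanishing g -> vanishing (fun n => f n + g n).
Proof.
move=> vf vg e e0; have e2 : 0 < e / 2 by lra.
have := vg _ e2; have := vf _ e2; apply: filterS2 => n; lra.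
Qed.

Lemma vanishingZ c f : 0 <= c -> vanishing f -> vanishing (fun n => c * f n).
Proof.
move=> c0 vf e e0; have e1 : 0 < e / (c + 1) by rewrite divr_gt0// ltr_wpDl.
have := vf _ e1; apply: filterS => n fn.
apply: le_trans (ler_wpM2l c0 fn) _.
by rewrite mulrCA ler_piMr ?(ltW e0)// ler_pdivrMr ?mul1r ?lerDl// ltr_wpDl.
Qed.

Lemma vanishing_power a : 0 < a -> vanishing (fun n => expR (- (a * ln (n%:R : R)))).
Proof.
move=> a0 e e0; have := near_power e^-1 a0; apply: filterS => n.
by rewrite expRN => h; rewrite -[e]invrK lef_pV2 ?posrE ?expR_gt0 ?invr_gt0.
Qed.

Lemma vanishing_power_exp a b c : 0 < a -> 0 < c ->
  vanishing (fun n => expR (b * ln (n%:R : R)) * expR (- (c * expR (a * ln (n%:R : R))))).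
Proof.
move=> a0 c0; have v1 : vanishing (fun n => expR (- ln n%:R)).
  apply: (vanishing_le (vanishing_power ltr01)).
  by apply: nearW => n; rewrite mul1r.
by apply: (vanishing_le v1); exact: near_power_exp.
Qed.

End powers_of_n.

Section sequences_of_spaces.
Context (R : realType) (d : nat -> measure_display)
  (T : forall n, measurableType (d n)) (P : forall n, probability (T n) R).

Lemma cvg_pr (A : forall n, set (T n)) (l : R) :
  (forall n, (0 < n)%N -> measurable (A n)) ->
  ((fun n => P n (A n)) @ \oo --> l%:E <->
   forall e, 0 < e -> \forall n \near \oo, `|l - pr (P n) (A n)| <= e).
Proof.
move=> mA; split=> [/fine_cvgP[_ /cvgrPdist_le//]|H].
apply/fine_cvgP; split; last exact/cvgrPdist_le.
by have := near_gt0; apply: filterS => n n0; rewrite fin_num_measure//; exact: mA.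
Qed.

(** Lower deviations are required for e up to [e0] only, as a larger e gives a smaller event. This
    keeps 1 - e nonnegative in (b) and K - e nonnegative in (c). *)
Lemma cvg_in_probability_scaled (Z : forall n, T n -> R) (l c e0 : R) :
  0 < l -> 0 < e0 -> (forall n, (0 < n)%N -> measurable_fun setT (Z n)) ->
  (forall e, 0 < e -> exists2 a : nat -> R,
     forall n, (0 < n)%N -> a n <= (c + e) * (ln n%:R / l) &
     vanishing (fun n => pr (P n) [set w | a n < Z n w])) ->
  (forall e, 0 < e <= e0 -> exists2 b : nat -> R,
     forall n, (0 < n)%N -> (c - e) * (ln n%:R / l) <= b n &
     vanishing (fun n => pr (P n) [set w | Z n w < b n])) ->
  cvg_in_probability P (fun n w => Z n w * (l / ln n%:R)) c.
Proof.
move=> l0 e00 mZ up low e e_gt0.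
have mgt n r : (0 < n)%N -> measurable [set w | r < Z n w].
  move=> n0; rewrite -[X in measurable X]setTI.
  rewrite (_ : [set w | _] = Z n @^-1` `]r, +oo[); first exact: mZ.
  by apply/seteqP; split=> w; rewrite /= in_itv/= andbT.
have mlt n r : (0 < n)%N -> measurable [set w | Z n w < r].
  move=> n0; rewrite -[X in measurable X]setTI.
  rewrite (_ : [set w | _] = Z n @^-1` `]-oo, r[); first exact: mZ.
  by apply/seteqP; split=> w; rewrite /= in_itv.
have mA n : (0 < n)%N -> measurable [set w | e < `|Z n w * (l / ln n%:R) - c|].
  move=> n0; rewrite -[X in measurable X]setTI.
  have mY : measurable_fun setT (fun w => `|Z n w * (l / ln n%:R) - c|).
    apply: measurableT_comp => //; apply: measurable_funB => //.
    by apply: measurable_funM => //; exact: mZ.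
  rewrite (_ : [set w | _] = (fun w => `|Z n w * (l / ln n%:R) - c|) @^-1` `]e, +oo[).
    exact: mY.
  by apply/seteqP; split=> w; rewrite /= in_itv/= andbT.
have [a aL va] := up e e_gt0.
have [|b bL vb] := low (Num.min e e0); first by rewrite lt_min e_gt0 e00 ge_min lexx orbT.
have [_ cvgA] := cvg_pr 0 mA; refine (cvgA _) => x x0.
near=> n; have n0 : (0 < n)%N by near: n; exact: near_gt0.
have ln0 : 0 < ln n%:R :> R by apply: (@lt_le_trans _ _ 1) => //; near: n; exact: near_ln.
have abx : pr (P n) [set w | a n < Z n w] + pr (P n) [set w | Z n w < b n] <= x.
  by near: n; exact: vanishingD.
rewrite sub0r normrN ger0_norm ?pr_ge0//; apply: le_trans abx.
apply: le_trans (pr_setU_le (P n) (mgt _ _ n0) (mlt _ _ n0)).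
apply: le_pr; [exact: mA|exact: measurableU (mgt _ _ n0) (mlt _ _ n0)|move=> w /=].
have L0 : 0 < ln n%:R / l by rewrite divr_gt0.
have -> : Z n w * (l / ln n%:R) = Z n w / (ln n%:R / l) by rewrite invf_div.
rewrite ltr_normr => /orP[|] h; [left|right].
  by apply: le_lt_trans (aL n n0) _; rewrite -ltr_pdivlMr//; lra.
apply: lt_le_trans (bL n n0); apply: (@lt_le_trans _ _ ((c - e) * (ln n%:R / l))).
  by rewrite -ltr_pdivrMr//; lra.
by rewrite ler_wpM2r ?(ltW L0)// lerD2l lerN2 ge_min lexx.
Unshelve. all: by end_near.
Qed.

End sequences_of_spaces.

(** * The scale of the typical maximum *)

Section maximum_scale.
Context {R : realType} (lambda : R).
Hypotheses (lambda0 : 0 < lambda) (lambda1 : lambda < 1).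
Implicit Types (a x c : R) (m n : nat).
Local Notation ell := (ln lambda^-1).

Lemma ln_invr_gt0 : 0 < ell.
Proof. by rewrite ln_gt0// invf_gt1. Qed.

Lemma exprn_expR m : lambda ^+ m = expR (- (ell * m%:R)).
Proof. by rewrite mulrC -mulrN -lnV ?posrE ?invr_gt0// invrK expRM_natl lnK. Qed.

(** The mean number of queues of length at least m, in terms of the distance from m to ln n / ln
    (1/lambda); the two criteria in (a) are read from it. *)
Lemma natr_mul_exprn n m : (0 < n)%N ->
  n%:R * lambda ^+ m = expR (- (ell * (m%:R - ln n%:R / ell))).
Proof.
move=> n0; rewrite exprn_expR -{1}(expR_ln_natr n0) -expRD.
by congr expR; field; rewrite lt0r_neq0// ln_invr_gt0.
Qed.

Lemma exprn_le_power n m a : a * (ln n%:R / ell) <= m%:R ->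
  lambda ^+ m <= expR (- (a * ln n%:R)).
Proof.
rewrite exprn_expR ler_expR lerN2 mulrA ler_pdivrMr ?ln_invr_gt0// => h; lra.
Qed.

Lemma exprn_ge_power n m a : m%:R <= a * (ln n%:R / ell) ->
  expR (- (a * ln n%:R)) <= lambda ^+ m.
Proof.
rewrite exprn_expR ler_expR lerN2 mulrA ler_pdivlMr ?ln_invr_gt0// => h; lra.
Qed.

Lemma expr1B_le n x : x <= 1 -> (1 - x) ^+ n <= expR (- (n%:R * x)).
Proof.
move=> x1; rewrite -mulrN expRM_natl.
rewrite lerXn2r ?nnegrE ?expR_ge0 ?subr_ge0//; exact: expR_ge1Dx.
Qed.

(** The reciprocal of 1 - x is 1 + x / (1 - x), at most exp (x / (1 - c)). *)
Lemma expr1B_ge n x c : 0 <= x <= c -> c < 1 ->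
  expR (- (n%:R * x / (1 - c))) <= (1 - x) ^+ n.
Proof.
move=> /andP[x0 xc] c1; have x1 : 0 < 1 - x by lra.
rewrite -mulrA -mulrN expRM_natl.
rewrite lerXn2r ?nnegrE ?expR_ge0 ?(ltW x1)//.
rewrite expRN -[1 - x]invrK lef_pV2 ?posrE ?expR_gt0 ?invr_gt0//.
apply: le_trans (expR_ge1Dx _).
have -> : (1 - x)^-1 = 1 + x / (1 - x) by field; rewrite lt0r_neq0.
by rewrite lerD2l ler_wpM2l// lef_pV2 ?posrE//; lra.
Qed.

(** With x = lambda^m and m positive, (1 - x)^n lies between exp (- n x / (1 - lambda)) and exp (- n
    x), so it vanishes exactly when n x tends to infinity. *)
Lemma cvgr_ninfty_vanishing (m : nat -> nat) :
  vanishing (fun n => (1 - lambda ^+ m n) ^+ n) <->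
  (fun n => (m n)%:R - ln n%:R / ell) @ \oo --> -oo.
Proof.
have l0 := ln_invr_gt0; split=> [vm|/cvgrNyPle um e e0].
  apply/cvgrNyPle => A; have e0 : 0 < expR (- (expR (- (ell * A)) / (1 - lambda))).
    exact: expR_gt0.
  have := near_ln (- (A * ell)); have := vm _ e0; near_simpl.
  have := near_gt0; apply: filterS3 => n n0 vmn An.
  (* For m = 0 the number lambda^m = 1 is not bounded away from 1, but the difference to be bounded
     is then - ln n / ln (1/lambda). *)
  case: (posnP (m n)) => [->|m0].
    by rewrite sub0r lerNl ler_pdivlMr//; lra.
  have h : 0 <= lambda ^+ m n <= lambda.
    by rewrite exprn_ge0 ?(ltW lambda0)//= ler_iXnr// ?ltW.
  have := le_trans (expr1B_ge n h lambda1) vmn.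
  rewrite ler_expR lerN2 ler_pM2r ?invr_gt0 ?subr_gt0// natr_mul_exprn//.
  by rewrite ler_expR lerN2 ler_pM2l.
have := um ((1 + ln e) / ell); near_simpl.
have := near_gt0; apply: filterS2 => n n0 umn.
have h : lambda ^+ m n <= 1 by rewrite exprn_ile1// ltW.
apply: le_trans (expr1B_le n h) _; rewrite natr_mul_exprn//.
rewrite -[leRHS]lnK ?posrE// ler_expR lerNl.
apply: le_trans (expR_ge1Dx _).
have : ell * ((m n)%:R - ln n%:R / ell) <= 1 + ln e.
  by rewrite mulrC -ler_pdivlMr.
lra.
Unshelve. all: by end_near.
Qed.

(** With x = lambda^(m+1), the number 1 - (1 - x)^n lies between 1 - exp (- n x) and n x, so it
    vanishes exactly when n x does. *)
Lemma cvgr_pinfty_vanishing (m : nat -> nat) :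
  vanishing (fun n => 1 - (1 - lambda ^+ (m n).+1) ^+ n) <->
  (fun n => (m n)%:R - ln n%:R / ell) @ \oo --> +oo.
Proof.
have l0 := ln_invr_gt0; split=> [vm|/cvgryPge um e e0].
  apply/cvgryPge => A; have e0 : 0 < 1 - expR (- (lambda * expR (- (ell * A)))).
    by rewrite subr_gt0 expR_lt1 oppr_lt0 mulr_gt0 ?expR_gt0.
  have := vm _ e0; near_simpl.
  have := near_gt0; apply: filterS2 => n n0; rewrite lerD2l lerN2 => vmn.
  have h : lambda ^+ (m n).+1 <= 1 by rewrite exprn_ile1// ltW.
  have := le_trans vmn (expr1B_le n h).
  rewrite ler_expR lerN2 exprS mulrCA ler_pM2l// natr_mul_exprn//.
  by rewrite ler_expR lerN2 ler_pM2l.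
have := um (- ln e / ell); near_simpl.
have := near_gt0; apply: filterS2 => n n0 umn.
have h : 0 <= lambda ^+ (m n).+1 <= 1.
  by rewrite exprn_ge0 ?exprn_ile1// ltW.
have := bernoulli_ineq n h.
have : n%:R * lambda ^+ (m n).+1 <= n%:R * lambda ^+ m n.
  by rewrite ler_wpM2l// exprS ler_piMl ?exprn_ge0 ?ltW.
rewrite (natr_mul_exprn (m n) n0) => h1 h2.
suff : expR (- (ell * ((m n)%:R - ln n%:R / ell))) <= e by lra.
rewrite -[leRHS]lnK ?posrE// ler_expR lerNl.
by rewrite mulrC -ler_pdivrMr.
Qed.

End maximum_scale.

Section typical_maximum.
Context (R : realType) (lambda : R) (d : nat -> measure_display)
  (T : forall n, measurableType (d n)) (P : forall n, probability (T n) R)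
  (S : forall n, supermarket_input (P n) n).
Hypotheses (lambda0 : 0 < lambda) (lambda1 : lambda < 1)
  (HS : forall n, (0 < n)%N -> is_supermarket (S n) lambda)
  (stS : forall n, (0 < n)%N -> stationary (S n)).
Variables (m : nat -> nat) (t : R).
Hypothesis t0 : 0 <= t.

Lemma aas_max_queue_ge : aas P (fun n => [set w | (m n <= max_queue (S n) t w)%N]) <->
  (fun n => (m n)%:R - ln n%:R / ln lambda^-1) @ \oo --> -oo.
Proof.
have mA n : (0 < n)%N -> measurable [set w | (m n <= max_queue (S n) t w)%N].
  by move=> n0; exact: (measurable_max_queue_event (HS n0) t [set k | (m n <= k)%N]).
have prA n : (0 < n)%N ->
    1 - pr (P n) [set w | (m n <= max_queue (S n) t w)%N] = (1 - lambda ^+ m n) ^+ n.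
  move=> n0; rewrite -pr_setC; last exact: mA.
  case: (m n) => [|k].
    rewrite expr0 subrr expr0n eqn0Ngt n0/= (_ : ~` _ = set0) ?/pr ?measure0//.
    by rewrite -subset0 => w /=.
  rewrite -(pr_max_queue lambda0 lambda1 n0 (HS n0) (stS n0) k t0).
  by congr pr; apply/seteqP; split=> w /=; [move/negP; rewrite -leqNgt|rewrite leqNgt => /negP].
refine (iff_trans (iff_trans (cvg_pr P 1 mA) _) (cvgr_ninfty_vanishing lambda0 lambda1 m)).
split=> H e /H; have := near_gt0; apply: filterS2 => n n0; rewrite prA// ger0_norm//.
all: by rewrite exprn_ge0// subr_ge0 exprn_ile1// ltW.
Qed.

Lemma aas_max_queue_le : aas P (fun n => [set w | (max_queue (S n) t w <= m n)%N]) <->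
  (fun n => (m n)%:R - ln n%:R / ln lambda^-1) @ \oo --> +oo.
Proof.
have mA n : (0 < n)%N -> measurable [set w | (max_queue (S n) t w <= m n)%N].
  by move=> n0; exact: (measurable_max_queue_event (HS n0) t [set k | (k <= m n)%N]).
refine (iff_trans (iff_trans (cvg_pr P 1 mA) _) (cvgr_pinfty_vanishing lambda0 lambda1 m)).
split=> H e /H; have := near_gt0; apply: filterS2 => n n0;
  rewrite (pr_max_queue lambda0 lambda1 n0 (HS n0) (stS n0) (m n) t0) ger0_norm//.
all: rewrite subr_ge0 exprn_ile1 ?subr_ge0 ?exprn_ile1 ?(ltW lambda0) ?(ltW lambda1)//.
all: by rewrite lerBlDr lerDl exprn_ge0// ltW.
Qed.

End typical_maximum.

(** * Asymptotics of the extremes *)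

Section extremal_asymptotics.
Context (R : realType) (lambda : R) (d : nat -> measure_display)
  (T : forall n, measurableType (d n)) (P : forall n, probability (T n) R)
  (S : forall n, supermarket_input (P n) n).
Hypotheses (lambda0 : 0 < lambda) (lambda1 : lambda < 1)
  (HS : forall n, (0 < n)%N -> is_supermarket (S n) lambda)
  (stS : forall n, (0 < n)%N -> stationary (S n)).
Local Notation ell := (ln lambda^-1).
Let ell0 : 0 < ell := ln_invr_gt0 lambda0 lambda1.

Lemma half_exprn_le (N : nat) (x : R) : x <= N%:R -> 2^-1 ^+ N <= expR (- (x / 2)).
Proof.
move=> xN; apply: (@le_trans _ _ (expR (- 2^-1) ^+ N)).
  rewrite lerXn2r ?nnegrE ?expR_ge0//.
  by have := @expR_ge1Dx R (- 2^-1); lra.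
by rewrite -expRM_natl ler_expR; lra.
Qed.

(** As 2^-N is at most exp (- N / 2), this N compensates exp (n tau) and leaves exp (- n). *)
Lemma many_arrivals_le n (tau : R) (N : nat) : 0 <= tau -> 2 * n%:R * tau + 2 * n%:R <= N%:R ->
  expR (lambda * n%:R * tau) * 2^-1 ^+ N <= expR (- n%:R).
Proof.
move=> tau0 hN; apply: le_trans (ler_wpM2l (expR_ge0 _) (half_exprn_le hN)) _.
rewrite -expRD ler_expR -mulrA.
have : lambda * (n%:R * tau) <= n%:R * tau by rewrite ler_piMl ?(ltW lambda1)// mulr_ge0.
lra.
Qed.

Lemma vanishing_min_gt (tau : nat -> R) (e : R) : (forall n, 0 <= tau n) -> 0 < e ->
  exists2 a : nat -> R,
    forall n, (0 < n)%N -> a n <= (1 + e) * (ln n%:R / ell) &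
    vanishing (fun n => pr (P n) [set w | a n < min_max_queue (S n) (tau n) w]).
Proof.
move=> tau0 e0; pose m n := Num.truncn ((1 + e) * (ln (n%:R : R) / ell)).
have L0 n : (0 < n)%N -> 0 <= (1 + e) * (ln (n%:R : R) / ell).
  by move=> n0; rewrite mulr_ge0 ?divr_ge0 ?(ltW ell0) ?ln_ge0 ?ler1n// addr_ge0// ltW.
exists (fun n => (m n)%:R) => [n n0|]; first by have /andP[] := truncn_itv (L0 n n0).
apply: (vanishing_le (vanishing_power e0)); have := near_gt0; apply: filterS => n n0.
apply: le_trans (pr_min_gt lambda0 lambda1 n0 (HS n0) (stS n0) (m n) (tau0 n)) _.
have le_m : (1 + e) * (ln n%:R / ell) <= (m n).+1%:R.
  by have /andP[_ /ltW] := truncn_itv (L0 n n0).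
apply: le_trans (ler_wpM2l (ler0n _ _) (exprn_le_power lambda0 lambda1 le_m)) _.
by rewrite -{1}(expR_ln_natr n0) -expRD ler_expR; lra.
Qed.

(* The parameters [x] and [N] of [pr_min_lt]: with overwhelming probability no
   queue holds more than [n] initial customers and at most [N] customers arrive. *)
Lemma pr_min_lt_power n (tau e : R) (m := (Num.truncn ((1 - e) * (ln (n%:R : R) / ell))).+1) :
  (0 < n)%N -> 0 <= tau -> 0 < e <= 1 ->
  pr (P n) [set w | min_max_queue (S n) tau w < m%:R] <=
    7 * n%:R ^+ 3 * Num.max 1 tau ^+ 2 * expR (- (lambda ^+ 2 * expR (e * ln n%:R)))
    + expR (- n%:R) + n%:R^-1 + n%:R * expR (- (ell * n%:R)).
Proof.
move=> n0 tau0 /andP[e0 e1]; have nR0 : 0 < n%:R :> R by rewrite ltr0n.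
have nR1 : 1 <= n%:R :> R by rewrite ler1n.
pose N := (Num.truncn (2 * n%:R * tau + 2 * n%:R)).+1.
have N0 : 0 <= 2 * n%:R * tau + 2 * n%:R by rewrite addr_ge0 ?mulr_ge0// ltW.
have /andP[] := truncn_itv N0; rewrite -(lerD2r 1) natr1 -/N => N2 /ltW N1.
(* At most N + n^2 services matter; this mesh makes the probability that one of them is shorter than
   delta at most 1/n. *)
pose delta := ((N%:R + n%:R * n%:R) * n%:R)^-1 : R.
have Nn0 : 0 < N%:R + n%:R * n%:R :> R by rewrite ltr_pwDl// ?mulr_ge0 ?ltr0n.
have delta0 : 0 < delta by rewrite invr_gt0 mulr_gt0.
apply: le_trans (pr_min_lt lambda0 lambda1 n0 (HS n0) (stS n0) m N n tau0 delta0) _.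
have h1 := many_arrivals_le tau0 N1.
have h2 : N%:R * delta + n%:R * n%:R * delta = n%:R^-1.
  by rewrite -mulrDl /delta invfM mulrA divff ?mul1r// lt0r_neq0.
have h3 : n%:R * lambda ^+ n.+1 <= n%:R * expR (- (ell * n%:R)).
  rewrite ler_wpM2l// exprS (exprn_expR lambda0) ler_piMl ?expR_ge0// ltW//.
have h4 : (1 - lambda ^+ m.+1) ^+ n <= expR (- (lambda ^+ 2 * expR (e * ln n%:R))).
  apply: le_trans (expr1B_le _ _) _; first by rewrite exprn_ile1// ltW.
  rewrite ler_expR lerN2 /m; set k := Num.truncn _.
  (* One factor lambda comes from rounding m up, the other from the loss of one customer between
     mesh points. *)
  have -> : n%:R * lambda ^+ k.+2 = lambda ^+ 2 * (n%:R * lambda ^+ k).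
    by rewrite (_ : k.+2 = (2 + k)%N)// exprD mulrCA.
  rewrite ler_wpM2l ?exprn_ge0 ?(ltW lambda0)//.
  have k_le : k%:R <= (1 - e) * (ln n%:R / ell).
    have L0 : 0 <= (1 - e) * (ln n%:R / ell).
      by rewrite mulr_ge0 ?divr_ge0 ?(ltW ell0) ?ln_ge0 ?subr_ge0.
    by have /andP[] := truncn_itv L0.
  apply: le_trans (ler_wpM2l (ler0n _ _) (exprn_ge_power lambda0 lambda1 k_le)).
  by rewrite -{2}(expR_ln_natr n0) -expRD ler_expR; lra.
(* A crude count of the mesh points, polynomial in n and tau, is enough against the factor exp (-
   lambda^2 n^e). *)
have h5 : (Num.truncn (tau / delta)).+1%:R <= 7 * n%:R ^+ 3 * Num.max 1 tau ^+ 2.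
  have /andP[+ _] := truncn_itv (divr_ge0 tau0 (ltW delta0)).
  rewrite -(lerD2r 1) natr1 => /le_trans; apply; rewrite /delta invrK.
  set M := Num.max 1 tau; have M1 : 1 <= M by rewrite le_max lexx.
  have tM : tau <= M by rewrite le_max lexx orbT.
  pose u := n%:R ^+ 2 * M.
  have n2 : n%:R <= n%:R ^+ 2 :> R by rewrite expr2 ler_peMl// ltW.
  have nu : n%:R ^+ 2 <= u by rewrite ler_peMr// exprn_ge0// ltW.
  have nMu : n%:R * M <= u by rewrite ler_wpM2r//; lra.
  have ntM : n%:R * tau <= n%:R * M by rewrite ler_wpM2l// ltW.
  have Nu : N%:R + n%:R * n%:R <= 6 * u.
    by apply: le_trans (lerD N2 (lexx _)) _; rewrite -expr2; lra.
  have nu0 : 1 <= u * n%:R by rewrite mulr_ege1//; lra.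
  have h : tau * ((N%:R + n%:R * n%:R) * n%:R) <= M * (6 * u * n%:R).
    by rewrite ler_pM ?mulr_ge0 ?(ltW Nn0) ?(ltW nR0)// ler_wpM2r// ltW.
  have h' : 1 <= M * (u * n%:R) by rewrite mulr_ege1.
  have -> : 7 * n%:R ^+ 3 * M ^+ 2 = M * (6 * u * n%:R) + M * (u * n%:R).
    by rewrite /u; ring.
  exact: lerD.
rewrite -(addrA _ (N%:R * delta)) h2; apply: lerD h3; rewrite lerD2r.
apply: lerD h1; rewrite ler_pM ?exprn_ge0 ?subr_ge0 ?exprn_ile1//; exact: ltW.
Qed.

Lemma vanishing_min_lt (tau : nat -> R) (e : R) :
  (forall n, 0 <= tau n) -> subexponential tau -> 0 < e <= 1 ->
  exists2 b : nat -> R,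
    forall n, (0 < n)%N -> (1 - e) * (ln n%:R / ell) <= b n &
    vanishing (fun n => pr (P n) [set w | min_max_queue (S n) (tau n) w < b n]).
Proof.
move=> tau0 [eps [eps0 tau_eps]] /andP[e0 e1].
exists (fun n => (Num.truncn ((1 - e) * (ln (n%:R : R) / ell))).+1%:R) => [n n0|].
  have L0 : 0 <= (1 - e) * (ln (n%:R : R) / ell).
    by rewrite mulr_ge0 ?divr_ge0 ?(ltW ell0) ?ln_ge0 ?ler1n ?subr_ge0.
  by have /andP[_ /ltW] := truncn_itv L0.
pose f1 n := expR (3 * ln (n%:R : R)) * expR (- (lambda ^+ 2 / 2 * expR (e * ln (n%:R : R)))).
pose f2 n := expR (0 * ln (n%:R : R)) * expR (- (1 * expR (1 * ln (n%:R : R)))).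
pose f3 n := expR (- (1 * ln (n%:R : R))).
pose f4 n := expR (1 * ln (n%:R : R)) * expR (- (ell * expR (1 * ln (n%:R : R)))).
have l2 : 0 < lambda ^+ 2 / 2 by rewrite divr_gt0 ?exprn_gt0.
have v : vanishing (fun n => 7 * f1 n + f2 n + f3 n + f4 n).
  apply: vanishingD; last exact: vanishing_power_exp.
  apply: vanishingD; last exact: vanishing_power.
  apply: vanishingD; last exact: vanishing_power_exp.
  by apply: vanishingZ => //; exact: vanishing_power_exp.
apply: (vanishing_le v); near=> n.
have n0 : (0 < n)%N by near: n; exact: near_gt0.
have e01 : 0 < e <= 1 by rewrite e0.
apply: le_trans (pr_min_lt_power n0 (tau0 n) e01) _.
have -> : f3 n = n%:R^-1 by rewrite /f3 mul1r expRN expR_ln_natr.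
rewrite /f2 /f4 mul0r expR0 !mul1r expR_ln_natr// !lerD2r /f1.
have m7 (a b c : R) : 7 * a * b * c = 7 * (a * (b * c)) by ring.
rewrite m7 ler_pM2l//.
have -> : n%:R ^+ 3 = expR (3 * ln n%:R) :> R by rewrite expRM_natl expR_ln_natr.
rewrite ler_pM2l ?expR_gt0//.
(* With s = n^(e/2), tau is at most exp s once the exponent [eps n] is below e/2, and tau^2 then
   costs 2 s, at most half of lambda^2 s^2. *)
set s := expR (e / 2 * ln n%:R).
have tau_s : Num.max 1 (tau n) <= expR s.
  rewrite ge_max -{1}expR0 ler_expR expR_ge0/=.
  have h : tau n <= expR (n%:R `^ eps n) by near: n.
  apply: le_trans h _; rewrite ler_expR /s -natr_powR//.
  have he : eps n < e / 2.
    by near: n; have := cvgr_lt _ eps0; apply; rewrite divr_gt0.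
  by rewrite ler_powR ?ler1n// ltW.
have -> : expR (e * ln n%:R) = s ^+ 2 by rewrite -expRM_natl; congr expR; field.
apply: (@le_trans _ _ (expR s ^+ 2 * expR (- (lambda ^+ 2 * s ^+ 2)))).
  by rewrite ler_wpM2r ?expR_ge0// lerXn2r ?nnegrE ?expR_ge0// le_max ler01.
rewrite -expRM_natl -expRD ler_expR.
have s4 : 4 / lambda ^+ 2 <= s by rewrite /s; near: n; apply: near_power; rewrite divr_gt0.
have : 4 * s <= lambda ^+ 2 * s ^+ 2.
  rewrite (expr2 s) mulrA ler_wpM2r ?expR_ge0// [leRHS]mulrC -ler_pdivrMr//.
  by rewrite exprn_gt0.
lra.
Unshelve. all: by end_near.
Qed.

Theorem cvg_min_max_queue (tau : nat -> R) :
  (forall n, 0 <= tau n) -> subexponential tau ->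
  cvg_in_probability P (fun n w => min_max_queue (S n) (tau n) w * (ell / ln n%:R)) 1.
Proof.
move=> tau0 subtau; apply: (cvg_in_probability_scaled ell0 ltr01).
- by move=> n n0; apply: (measurable_min_max_queue (HS n0)); exact: tau0.
- by move=> e e0; exact: vanishing_min_gt.
- by move=> e e01; exact: vanishing_min_lt.
Qed.

Lemma many_arrivals_unit_time n :
  expR (lambda * n%:R) * 2^-1 ^+ (4 * n) <= expR (- n%:R).
Proof.
have := @many_arrivals_le n 1 (4 * n) ler01; rewrite !mulr1; apply.
by rewrite natrM; lra.
Qed.

(** The margin e is shared equally between the level at mesh points and the gain r between them.
    [theta] makes exp (- theta r) of order n^-(K + 3), which pays for about n^(K + 1) arrivals and n
    queues and leaves 1/n; with windows of 4 n + 1 choices of probability 1/n each, the remaining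
    factor stays bounded. *)
Lemma pr_max_gt_power n (K e : R)
    (m := Num.truncn ((K + 1 + e / 2) * (ln (n%:R : R) / ell)))
    (r := Num.truncn (e / 2 * (ln (n%:R : R) / ell)))
    (theta := 2 * ell * (K + 3) / e) : (0 < n)%N -> 0 < K -> 0 < e ->
  pr (P n) [set w | (m + r)%:R < max_max_queue (S n) (n%:R `^ K) w] <=
    2 * expR (- (e / 2 * ln n%:R)) + expR (- n%:R)
    + 5 * (expR ((K + 1) * ln n%:R) * expR (- n%:R))
    + 5 * expR theta * expR (5 * expR theta) * expR (- ln n%:R).
Proof.
move=> n0 K0 e0; have nR0 : 0 < n%:R :> R by rewrite ltr0n.
have nR1 : 1 <= n%:R :> R by rewrite ler1n.
have lnn : 0 <= ln n%:R :> R by rewrite ln_ge0.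
have L0 : 0 <= ln n%:R / ell by rewrite divr_ge0 ?(ltW ell0).
have theta0 : 0 <= theta by rewrite /theta divr_ge0 ?mulr_ge0 ?(ltW ell0) ?(ltW e0)//; lra.
set tau := n%:R `^ K.
have tauE : tau = expR (K * ln n%:R) by rewrite /tau natr_powR.
have tau1 : 1 <= tau by rewrite tauE -{1}expR0 ler_expR mulr_ge0// ltW.
have tau0 : 0 <= tau by lra.
pose N := (Num.truncn (2 * n%:R * tau + 2 * n%:R)).+1.
have N0 : 0 <= 2 * n%:R * tau + 2 * n%:R by rewrite addr_ge0 ?mulr_ge0// ltW.
have /andP[] := truncn_itv N0; rewrite -(lerD2r 1) natr1 -/N => N2 /ltW N1.
have N5 : N%:R <= 5 * (n%:R * tau).
  apply: le_trans N2 _.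
  have : n%:R <= n%:R * tau by rewrite ler_peMr// ltW.
  lra.
apply: le_trans (pr_max_gt lambda0 lambda1 n0 (HS n0) (stS n0) m N (4 * n) r tau0 theta0) _.
apply: lerD; first apply: lerD; first apply: lerD.
- have m_le : (K + 1 + e / 2) * (ln n%:R / ell) <= m.+1%:R.
    have M0 : 0 <= (K + 1 + e / 2) * (ln n%:R / ell) by rewrite mulr_ge0//; lra.
    by have /andP[_ /ltW] := truncn_itv M0.
  have /andP[+ _] := truncn_itv tau0; rewrite -(lerD2r 1) natr1 => h.
  have h2 : (Num.truncn tau).+1%:R <= 2 * tau by apply: le_trans h _; lra.
  have h3 := ler_wpM2l (ltW nR0) (exprn_le_power lambda0 lambda1 m_le).
  apply: le_trans (ler_pM _ _ h2 h3) _ => //; first by rewrite mulr_ge0 ?exprn_ge0 ?ltW.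
  rewrite -(mulrA 2) ler_pM2l// tauE -{2}(expR_ln_natr n0) -!expRD ler_expR.
  by rewrite le_eqVlt; apply/orP; left; apply/eqP; field.
- exact: many_arrivals_le.
- have -> : expR ((K + 1) * ln n%:R) = n%:R * tau.
    by rewrite tauE mulrDl mul1r expRD expR_ln_natr// mulrC.
  rewrite [leRHS]mulrA; apply: ler_pM N5 (many_arrivals_unit_time n); first by [].
  by rewrite mulr_ge0 ?expR_ge0 ?exprn_ge0.
have hr : expR (- (theta * r%:R)) <= expR theta * expR (- ((K + 3) * ln n%:R)).
  rewrite -expRD ler_expR.
  have r_ge : e / 2 * (ln n%:R / ell) <= r%:R + 1.
    have R0 : 0 <= e / 2 * (ln n%:R / ell) by rewrite mulr_ge0//; lra.
    by rewrite natr1; have /andP[_ /ltW] := truncn_itv R0.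
  have := ler_wpM2l theta0 r_ge.
  have -> : theta * (e / 2 * (ln n%:R / ell)) = (K + 3) * ln n%:R.
    by rewrite /theta; field; rewrite !lt0r_neq0.
  lra.
have hW : (1 + (expR theta - 1) / n%:R) ^+ (4 * n).+1 <= expR (5 * expR theta).
  have x0 : 0 <= expR theta - 1 by rewrite subr_ge0 -{1}expR0 ler_expR.
  apply: (@le_trans _ _ (expR ((expR theta - 1) / n%:R) ^+ (4 * n).+1)).
    rewrite lerXn2r ?nnegrE ?expR_ge0 ?addr_ge0 ?divr_ge0 ?(ltW nR0)//.
    exact: expR_ge1Dx.
  rewrite -expRM_natl ler_expR mulrCA [leRHS]mulrC.
  apply: ler_pM; [by []|by rewrite divr_ge0 ?(ltW nR0)|lra|].
  rewrite ler_pdivrMr// -natr1 natrM; lra.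
have h1 : expR (- (theta * r%:R)) * (1 + (expR theta - 1) / n%:R) ^+ (4 * n).+1 <=
    expR theta * expR (- ((K + 3) * ln n%:R)) * expR (5 * expR theta).
  rewrite ler_pM ?expR_ge0// exprn_ge0// addr_ge0 ?divr_ge0 ?(ltW nR0)//.
  by rewrite subr_ge0 -{1}expR0 ler_expR.
apply: le_trans (ler_pM _ _ N5 (ler_wpM2l (ltW nR0) h1)) _ => //.
  rewrite !mulr_ge0 ?(ltW nR0) ?expR_ge0// exprn_ge0// addr_ge0 ?divr_ge0 ?(ltW nR0)//.
  by rewrite subr_ge0 -{1}expR0 ler_expR.
have -> : expR (- ln n%:R) = n%:R * tau * (n%:R * expR (- ((K + 3) * ln n%:R))).
  by rewrite tauE -{2 4}(expR_ln_natr n0) -!expRD; congr expR; ring.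
set u := n%:R * tau; set v := expR (- _); set x := expR theta; set z := expR (5 * x).
by rewrite le_eqVlt; apply/orP; left; apply/eqP; ring.
Qed.

Lemma vanishing_max_gt (K e : R) : 0 < K -> 0 < e ->
  exists2 a : nat -> R,
    forall n, (0 < n)%N -> a n <= (K + 1 + e) * (ln n%:R / ell) &
    vanishing (fun n => pr (P n) [set w | a n < max_max_queue (S n) (n%:R `^ K) w]).
Proof.
move=> K0 e0.
exists (fun n => (Num.truncn ((K + 1 + e / 2) * (ln (n%:R : R) / ell)) +
                  Num.truncn (e / 2 * (ln (n%:R : R) / ell)))%:R) => [n n0|].
  have L0 : 0 <= ln (n%:R : R) / ell by rewrite divr_ge0 ?(ltW ell0) ?ln_ge0 ?ler1n.
  rewrite natrD.
  have M0 : 0 <= (K + 1 + e / 2) * (ln n%:R / ell) by rewrite mulr_ge0//; lra.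
  have R0 : 0 <= e / 2 * (ln n%:R / ell) by rewrite mulr_ge0//; lra.
  have /andP[h1 _] := truncn_itv M0; have /andP[h2 _] := truncn_itv R0.
  apply: le_trans (lerD h1 h2) _; rewrite -mulrDl.
  by have -> : K + 1 + e / 2 + e / 2 = K + 1 + e by field.
pose theta := 2 * ell * (K + 3) / e.
pose f1 n := expR (- (e / 2 * ln (n%:R : R))).
pose f2 n := expR (0 * ln (n%:R : R)) * expR (- (1 * expR (1 * ln (n%:R : R)))).
pose f3 n := expR ((K + 1) * ln (n%:R : R)) * expR (- (1 * expR (1 * ln (n%:R : R)))).
pose f4 n := expR (- (1 * ln (n%:R : R))).
have v : vanishing (fun n => 2 * f1 n + f2 n + 5 * f3 n
    + 5 * expR theta * expR (5 * expR theta) * f4 n).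
  apply: vanishingD; last first.
    by apply: vanishingZ; [rewrite !mulr_ge0 ?expR_ge0|exact: vanishing_power].
  apply: vanishingD; last by apply: vanishingZ => //; exact: vanishing_power_exp.
  apply: vanishingD; last exact: vanishing_power_exp.
  by apply: vanishingZ => //; apply: vanishing_power; rewrite divr_gt0.
apply: (vanishing_le v); have := near_gt0; apply: filterS => n n0.
apply: le_trans (pr_max_gt_power n0 K0 e0) _.
by rewrite /f1 /f2 /f3 /f4 mul0r expR0 !mul1r expR_ln_natr.
Qed.

Lemma expR1_ge2 : 2 <= expR 1 :> R.
Proof. by have := @expR_ge1Dx R 1; lra. Qed.

Lemma expr2_le (k : nat) : 2 ^+ k <= expR (k%:R : R).
Proof.
rewrite -[k%:R]mulr1 expRM_natl.
by rewrite lerXn2r ?nnegrE ?expR_ge0 ?expR1_ge2.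
Qed.

(* Per arrival, the choice of one queue weighted by [(1 - theta)^-1] grows more
   slowly than the interarrival factor decays, because [lambda < 1]. *)
Lemma tilted_factor_le n (theta := (1 - lambda) / 4) : (0 < n)%N ->
  lambda * n%:R / (lambda * n%:R + theta) * (n%:R^-1 / (1 - theta) + (1 - n%:R^-1))
    <= expR (- (2 * theta ^+ 2 / n%:R)).
Proof.
move=> n0; have nR0 : 0 < n%:R :> R by rewrite ltr0n.
have nR1 : 1 <= n%:R :> R by rewrite ler1n.
have t0 : 0 < theta by rewrite divr_gt0 ?subr_gt0.
have lE : lambda = 1 - 4 * theta by rewrite /theta; field.
have t4 : 0 < 1 - 4 * theta by rewrite -lE.
have ln0 : 0 < lambda * n%:R by rewrite mulr_gt0.
have h1 : lambda * n%:R / (lambda * n%:R + theta) <= expR (- (theta / (lambda * n%:R + theta))).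
  have -> : lambda * n%:R / (lambda * n%:R + theta) = 1 + - (theta / (lambda * n%:R + theta)).
    by field; rewrite lt0r_neq0//; lra.
  exact: expR_ge1Dx.
have h2 : n%:R^-1 / (1 - theta) + (1 - n%:R^-1) <= expR (theta / (1 - theta) / n%:R).
  have -> : n%:R^-1 / (1 - theta) + (1 - n%:R^-1) = 1 + theta / (1 - theta) / n%:R.
    by field; rewrite !lt0r_neq0//; lra.
  exact: expR_ge1Dx.
apply: le_trans (ler_pM _ _ h1 h2) _.
- by rewrite divr_ge0//; lra.
- rewrite addr_ge0 ?subr_ge0 ?invf_le1// divr_ge0 ?invr_ge0//; lra.
rewrite -expRD ler_expR.
have h3 : theta / (1 - 3 * theta) / n%:R <= theta / (lambda * n%:R + theta).
  rewrite -mulrA ler_pM2l// -invfM lef_pV2 ?posrE//; last 2 first.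
  - by rewrite mulr_gt0//; lra.
  - by lra.
  rewrite lE; have : theta <= theta * n%:R by rewrite ler_peMr// ltW.
  lra.
suff h4 : 2 * theta ^+ 2 <= theta / (1 - 3 * theta) - theta / (1 - theta).
  have : 2 * theta ^+ 2 / n%:R <= (theta / (1 - 3 * theta) - theta / (1 - theta)) / n%:R.
    by rewrite ler_wpM2r ?invr_ge0 ?(ltW nR0).
  rewrite mulrBl; lra.
have -> : theta / (1 - 3 * theta) - theta / (1 - theta)
    = 2 * theta ^+ 2 / ((1 - 3 * theta) * (1 - theta)).
  by field; rewrite !lt0r_neq0//; lra.
rewrite ler_pdivlMr; last by rewrite mulr_gt0; lra.
have : 0 <= theta ^+ 2 by rewrite exprn_ge0// ltW.
have : (1 - 3 * theta) * (1 - theta) <= 1 by rewrite mulr_ile1//; lra.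
move=> h h'; rewrite ler_piMr//; lra.
Qed.

(* With overwhelming probability more than [n C rho], and fewer than
   [10 n C rho], customers arrive in a time [4 C rho / lambda], and every queue
   has got rid of its initial customers when customer [n C rho] arrives. *)
Lemma success_probability_power n m (C rho : nat) (theta := (1 - lambda) / 4) :
  (0 < n)%N -> (0 < rho)%N -> (0 < C)%N -> 1 <= C%:R * theta ^+ 2 ->
  1 - (1 - lambda ^+ m) ^+ n - (n%:R * expR (- (ell * rho%:R)) + 4 * (n%:R * expR (- rho%:R)))
  <= pr (P n) (block (S n) 0 @^-1` success n (10 * (n * C * rho)) m (4 / lambda * (C * rho)%:R)).
Proof.
move=> n0 rho0 C0 Ctheta; set k := (n * C * rho)%N; set L := 4 / lambda * _.
have nR0 : 0 < n%:R :> R by rewrite ltr0n.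
have nR1 : 1 <= n%:R :> R by rewrite ler1n.
have theta0 : 0 < theta by rewrite divr_gt0 ?subr_gt0.
have theta1 : theta < 1 by have := lambda0; rewrite /theta; lra.
have L0 : 0 <= L by rewrite mulr_ge0// divr_ge0// ltW.
have t01 : 0 < theta < 1 by rewrite theta0.
apply: le_trans (success_probability_ge lambda0 lambda1 n0 (HS n0) (stS n0)
  (10 * k) m rho k L0 t01).
rewrite lerD2l lerN2.
have rk : expR (- k%:R) <= expR (- rho%:R) :> R.
  by rewrite ler_expR lerN2 ler_nat /k leq_pmull// muln_gt0 n0.
(* The mean number of arrivals in time L is 4 k, so the two Chernoff bounds become exp (- 2 k)
   2^(k+1) and exp (4 k) 2^(- 10 k), both small. *)
have rateL : lambda * n%:R * L = 4 * k%:R.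
  by rewrite /L /k !natrM; field; rewrite lt0r_neq0.
have e1 : n%:R * lambda ^+ rho.+1 <= n%:R * expR (- (ell * rho%:R)).
  by rewrite ler_wpM2l// -(exprn_expR lambda0) exprS ler_piMl ?exprn_ge0// ltW.
have e2 : n%:R * ((lambda * n%:R / (lambda * n%:R + theta)) ^+ k.+1 * (1 - theta)^-1 ^+ rho *
    (n%:R^-1 / (1 - theta) + (1 - n%:R^-1)) ^+ k) <= n%:R * expR (- rho%:R).
  rewrite ler_wpM2l//.
  set q1 := _ / (_ + theta); set q2 := _ + (1 - _).
  have rate0 : 0 < lambda * n%:R by exact: mulr_gt0.
  have q10 : 0 <= q1 by apply: divr_ge0; [exact: ltW|apply: addr_ge0; exact: ltW].
  have q11 : q1 <= 1.
    by rewrite /q1 ler_pdivrMr ?mul1r ?lerDl ?(ltW theta0)// addr_gt0.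
  have q20 : 0 <= q2.
    by rewrite /q2 addr_ge0 ?divr_ge0 ?subr_ge0 ?invf_le1 ?invr_ge0 ?subr_ge0 ?(ltW theta1) ?ler0n.
  have it0 : 0 <= (1 - theta)^-1 by rewrite invr_ge0 subr_ge0 ltW.
  have hth : (1 - theta)^-1 ^+ rho <= expR rho%:R.
    rewrite -[rho%:R]mulr1 expRM_natl lerXn2r ?nnegrE ?expR_ge0 ?invr_ge0 ?subr_ge0 ?(ltW theta1)//.
    apply: le_trans expR1_ge2; rewrite -[leRHS]invrK lef_pV2 ?posrE ?invr_gt0 ?subr_gt0//.
    by have := lambda0; rewrite /theta; lra.
  (* C is so large that the k = n C rho paired factors gain exp (- 2 rho), more than the exp rho
     lost to the initial customers. *)
  have hq : (q1 * q2) ^+ k <= expR (- (2 * rho%:R)).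
    apply: (@le_trans _ _ (expR (- (2 * theta ^+ 2 / n%:R)) ^+ k)).
      by apply: lerXn2r; [rewrite nnegrE mulr_ge0|rewrite nnegrE expR_ge0|exact: tilted_factor_le].
    rewrite -expRM_natl ler_expR mulrN lerN2.
    have -> : k%:R * (2 * theta ^+ 2 / n%:R) = 2 * (rho%:R * (C%:R * theta ^+ 2)).
      by rewrite /k !natrM; field; rewrite lt0r_neq0.
    by rewrite ler_pM2l// ler_peMr.
  (* Each choice factor is paired with an interarrival factor, as in [tilted_factor_le]; the one
     interarrival factor left over is at most 1. *)
  have mE (a b c : R) j : a ^+ j.+1 * b * c ^+ j = a * (b * (a * c) ^+ j).
    by rewrite exprS exprMn -!mulrA; congr (_ * _); exact: mulrCA.
  rewrite mE.
  apply: le_trans (ler_piMl _ q11) _.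
    by apply: mulr_ge0; apply: exprn_ge0 => //; exact: mulr_ge0.
  apply: le_trans (ler_pM (exprn_ge0 _ it0) (exprn_ge0 _ (mulr_ge0 q10 q20)) hth hq) _.
  by rewrite -expRD ler_expR; lra.
have e3 : expR (- (lambda * n%:R / 2 * L)) * 2 ^+ k.+1 <= 2 * expR (- rho%:R).
  have -> : lambda * n%:R / 2 * L = 2 * k%:R by rewrite mulrAC rateL; field.
  rewrite exprS mulrCA ler_pM2l//; apply: le_trans rk.
  apply: le_trans (ler_wpM2l (expR_ge0 _) (expr2_le k)) _.
  by rewrite -expRD ler_expR; lra.
have e4 : expR (lambda * n%:R * L) * 2^-1 ^+ (10 * k) <= expR (- rho%:R).
  rewrite rateL; apply: le_trans rk.
  have h : 10 * k%:R <= (10 * k)%:R :> R by rewrite natrM.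
  apply: le_trans (ler_wpM2l (expR_ge0 _) (half_exprn_le h)) _.
  by rewrite -expRD ler_expR; lra.
have : expR (- rho%:R) <= n%:R * expR (- rho%:R) :> R by rewrite ler_peMl ?expR_ge0.
by move: e1 e2 e3 e4; lra.
Qed.

Lemma expRN_le_half (y : R) : 0 <= y <= 1 -> expR (- y) <= 1 - y / 2.
Proof.
move=> /andP[y0 y1]; rewrite expRN -[leRHS]invrK lef_pV2 ?posrE ?invr_gt0 ?expR_gt0//; last by lra.
apply: le_trans (expR_ge1Dx y); rewrite -[leRHS]invrK lef_pV2 ?posrE ?invr_gt0//; [|by lra|by lra].
rewrite -div1r ler_pdivrMr; last by lra.
nra.
Qed.

(** The mean number of queues of length at least m is at least y = lambda n^-a, where lambda pays
    for rounding m up; since y is at most 1, such a queue exists with probability at least 1 - exp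
    (- y) >= y / 2. *)
Lemma pr_max_queue_gt_power n (a : R) (m := (Num.truncn ((a + 1) * (ln (n%:R : R) / ell))).+1) :
  (0 < n)%N -> 0 <= a -> lambda / 2 * expR (- (a * ln n%:R)) <= 1 - (1 - lambda ^+ m) ^+ n.
Proof.
move=> n0 a0; have lnn : 0 <= ln n%:R :> R by rewrite ln_ge0 ?ler1n.
have M0 : 0 <= (a + 1) * (ln n%:R / ell).
  by rewrite mulr_ge0 ?addr_ge0// divr_ge0// ltW.
have /andP[/(exprn_ge_power lambda0 lambda1) h _] := truncn_itv M0.
pose y := lambda * expR (- (a * ln n%:R)).
have y1 : 0 <= y <= 1.
  rewrite mulr_ge0 ?expR_ge0 ?(ltW lambda0)//= mulr_ile1 ?expR_ge0 ?(ltW lambda0) ?(ltW lambda1)//.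
  by rewrite -[leRHS]expR0 ler_expR oppr_le0 mulr_ge0.
have ym : y <= n%:R * lambda ^+ m.
  rewrite /m exprS mulrCA ler_wpM2l ?(ltW lambda0)//.
  apply: le_trans (ler_wpM2l (ler0n _ _) h).
  rewrite -{2}(expR_ln_natr n0) -expRD le_eqVlt; apply/orP; left.
  by apply/eqP; congr expR; ring.
have m1 : lambda ^+ m <= 1 by rewrite exprn_ile1// ltW.
have -> : lambda / 2 * expR (- (a * ln n%:R)) = y / 2 by rewrite /y mulrAC.
rewrite lerBrDl -lerBrDr; apply: le_trans (expr1B_le n m1) _.
by apply: le_trans (expRN_le_half y1); rewrite ler_expR lerN2.
Qed.

(** Exponents: one block succeeds with probability of order at least n^-(K - e) and lasts about
    n^(e/4). With n^(K - e/2) blocks the mean number of successes is of order at least n^(e/2),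
    while the total time, of order n^(K - e/4), stays below n^K. *)
Lemma vanishing_max_lt (K e : R) : 0 < e <= K ->
  exists2 b : nat -> R,
    forall n, (0 < n)%N -> (K + 1 - e) * (ln n%:R / ell) <= b n &
    vanishing (fun n => pr (P n) [set w | max_max_queue (S n) (n%:R `^ K) w < b n]).
Proof.
move=> /andP[e0 eK].
pose a := K - e; have a0 : 0 <= a by rewrite subr_ge0.
pose m n := (Num.truncn ((a + 1) * (ln (n%:R : R) / ell))).+1.
exists (fun n => (m n)%:R) => [n n0|].
  have M0 : 0 <= (a + 1) * (ln (n%:R : R) / ell).
    apply: mulr_ge0; first exact: addr_ge0.
    by rewrite divr_ge0 ?(ltW ell0)// ln_ge0 ?ler1n.
  have -> : K + 1 - e = a + 1 by rewrite addrAC.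
  by have /andP[_ /ltW] := truncn_itv M0.
pose theta := (1 - lambda) / 4.
have theta0 : 0 < theta by rewrite divr_gt0 ?subr_gt0.
pose C := (Num.truncn (theta ^- 2)).+1.
have Ctheta : 1 <= C%:R * theta ^+ 2.
  rewrite -ler_pdivrMr ?exprn_gt0// div1r.
  have t0 : 0 <= theta ^- 2 by rewrite invr_ge0 exprn_ge0// ltW.
  by have /andP[_ /ltW] := truncn_itv t0.
pose s n := expR (e / 4 * ln (n%:R : R)).
pose rho n := (Num.truncn (s n)).+1.
pose g1 n := expR ((1 + a) * ln (n%:R : R)) * expR (- (ell * s n)).
pose g2 n := expR ((1 + a) * ln (n%:R : R)) * expR (- (1 * s n)).
have e4 : 0 < e / 4 by rewrite divr_gt0.
have vg : vanishing (fun n => g1 n + 4 * g2 n).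
  apply: vanishingD; first exact: vanishing_power_exp.
  by apply: vanishingZ => //; exact: vanishing_power_exp.
pose f1 n := expR (0 * ln (n%:R : R)) * expR (- (lambda / 4 * expR (e / 2 * ln (n%:R : R)))).
pose f2 n := expR (0 * ln (n%:R : R)) * expR (- (lambda / 4 * expR ((K + 1) * ln (n%:R : R)))).
have l4 : 0 < lambda / 4 by rewrite divr_gt0.
(* The factor exp (lambda / 4) pays for rounding down the number [Q] of blocks. *)
have v : vanishing (fun n => expR (lambda / 4) * f1 n + f2 n).
  apply: vanishingD; last by apply: vanishing_power_exp => //; lra.
  apply: vanishingZ; first exact: expR_ge0.
  by apply: vanishing_power_exp => //; rewrite divr_gt0.
apply: (vanishing_le v); near=> n.
have n0 : (0 < n)%N by near: n; exact: near_gt0.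
have nR0 : 0 < n%:R :> R by rewrite ltr0n.
have lnn : 0 <= ln n%:R :> R by rewrite ln_ge0 ?ler1n.
have s1 : 1 <= s n by rewrite /s -{1}expR0 ler_expR mulr_ge0// ltW.
have /andP[rho_le rho_gt] := truncn_itv (le_trans ler01 s1).
pose L := 4 / lambda * (C * rho n)%:R; pose B := (10 * (n * C * rho n))%N.
pose y := lambda * expR (- (a * ln n%:R)).
pose p := pr (P n) (block (S n) 0 @^-1` success n B (m n) L).
have p_ge : y / 4 <= p.
  have := success_probability_power (m n) n0 (isT : (0 < rho n)%N)
    (isT : (0 < C)%N) Ctheta.
  have := pr_max_queue_gt_power n0 a0; rewrite -/(m n) -/B -/L -/p.
  (* The errors are measured relative to n^-a, so that half of the probability y / 2 of a long
     maximum survives as y / 4. *)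
  have err : g1 n + 4 * g2 n <= lambda / 4.
    by near: n; exact: vg.
  have r1 : n%:R * expR (- (ell * (rho n)%:R)) <= expR (- (a * ln n%:R)) * g1 n.
    rewrite /g1 mulrA -expRD -[X in X * _ <= _](expR_ln_natr n0).
    rewrite -!expRD ler_expR.
    have : ell * s n <= ell * (rho n)%:R by rewrite ler_pM2l// ltW.
    lra.
  have r2 : n%:R * expR (- (rho n)%:R) <= expR (- (a * ln n%:R)) * g2 n.
    rewrite /g2 mulrA -expRD -[X in X * _ <= _](expR_ln_natr n0).
    rewrite -!expRD ler_expR.
    have : s n <= (rho n)%:R by rewrite ltW.
    lra.
  have r3 : expR (- (a * ln n%:R)) * (g1 n + 4 * g2 n) <= y / 4.
    by rewrite /y mulrC mulrAC ler_pM2r ?expR_gt0.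
  rewrite mulrDr in r3; rewrite /y in r3 *.
  move: r1 r2 r3; lra.
have p1 : p <= 1.
  by apply: pr_le1; apply: measurable_block; exact: measurable_success.
pose Q := Num.truncn (expR ((K - e / 2) * ln n%:R)).
have /andP[Q_le Q_gt] := truncn_itv (expR_ge0 ((K - e / 2) * ln n%:R)).
have Q1 : (1 <= Q)%N.
  rewrite truncn_gt0 -{1}expR0 ler_expR mulr_ge0//; lra.
have tau0 : 0 <= n%:R `^ K by exact: powR_ge0.
have L0 : 0 <= L by rewrite mulr_ge0// divr_ge0// ltW.
have B0 : (0 < B)%N by rewrite !muln_gt0 n0.
have hmax := pr_max_lt lambda0 n0 (HS n0) (m n) Q tau0 L0 B0.
apply: le_trans hmax _.
rewrite -/p /f1 /f2 mul0r expR0 !mul1r; apply: lerD.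
  apply: (@le_trans _ _ ((1 - y / 4) ^+ Q)).
    by rewrite lerXn2r ?nnegrE ?lerD2l ?lerN2//; lra.
  have y4 : y / 4 <= 1 by exact: le_trans p1.
  apply: le_trans (expr1B_le Q y4) _.
  rewrite -expRD ler_expR.
  have h : (expR ((K - e / 2) * ln n%:R) - 1) * (y / 4) <= Q%:R * (y / 4).
    rewrite ler_wpM2r; [by []| |]; last by rewrite lerBlDr natr1 ltW.
    by rewrite divr_ge0// mulr_ge0 ?expR_ge0// ltW.
  have h2 : expR ((K - e / 2) * ln n%:R) * y = lambda * expR (e / 2 * ln n%:R).
    by rewrite /y mulrCA -expRD; congr (_ * expR _); rewrite /a; field.
  have h3 : y <= lambda.
    by rewrite /y ler_piMr ?(ltW lambda0)// -[leRHS]expR0 ler_expR oppr_le0 mulr_ge0.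
  have hE : (expR ((K - e / 2) * ln n%:R) - 1) * (y / 4) = (lambda * expR (e / 2 * ln n%:R) - y) / 4.
    by rewrite -h2 [LHS]mulrA mulrBl mul1r.
  rewrite hE in h; lra.
apply: le_trans (ler_wpM2l (expR_ge0 _) (expr2_le _)) _.
rewrite -expRD ler_expR natr_powR//.
set t := expR (K * ln n%:R); set k := (n * C * rho n)%N.
have rateL : lambda * n%:R / 2 * L = 2 * k%:R.
  by rewrite /L /k !natrM; field; rewrite lt0r_neq0.
have QB : (Q * B)%:R + 2 * k%:R <= 20 * (Q%:R * k%:R) :> R.
  have : k%:R <= Q%:R * k%:R :> R by rewrite ler_peMl// ler1n.
  have : 0 <= k%:R :> R by [].
  rewrite /B -/k !natrM; lra.
have tE : n%:R * t = expR ((K + 1) * ln n%:R).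
  by rewrite /t -{1}(expR_ln_natr n0) -expRD; congr expR; field.
have rho2 : (rho n)%:R <= 2 * s n by rewrite /rho -natr1; lra.
have Qk : Q%:R * k%:R <= 2 * C%:R * expR ((K + 1 - e / 4) * ln n%:R).
  have : Q%:R * k%:R <= expR ((K - e / 2) * ln n%:R) * (n%:R * C%:R * (2 * s n)).
    apply: ler_pM => //; rewrite /k !natrM ler_wpM2l ?mulr_ge0//.
  move=> /le_trans; apply; rewrite le_eqVlt; apply/orP; left; apply/eqP.
  have -> : expR ((K + 1 - e / 4) * ln n%:R) = expR ((K - e / 2) * ln n%:R) * n%:R * s n.
    by rewrite -{3}(expR_ln_natr n0) /s -!expRD; congr expR; field.
  ring.
(* The cost of the blocks in the exponent is of order n^(K + 1 - e/4); n^(e/4) eventually absorbs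
   the constants, and half of lambda n^(K + 1) / 2 is left. *)
have big : 40 * C%:R * expR ((K + 1 - e / 4) * ln n%:R) <= lambda / 4 * (n%:R * t).
  have hs : 160 * C%:R / lambda <= s n by rewrite /s; near: n; exact: near_power.
  have -> : n%:R * t = s n * expR ((K + 1 - e / 4) * ln n%:R).
    by rewrite tE /s -expRD; congr expR; field.
  rewrite mulrA ler_wpM2r ?expR_ge0//.
  move: hs; rewrite ler_pdivrMr//; lra.
rewrite mulrBr rateL -tE.
move: QB Qk big; set u := lambda * n%:R / 2 * t.
have -> : u = lambda / 2 * (n%:R * t) by rewrite /u; field.
lra.
Unshelve. all: by end_near.
Qed.

Theorem cvg_max_max_queue (K : R) : 0 < K ->
  cvg_in_probability P
    (fun n w => max_max_queue (S n) (n%:R `^ K) w * (ell / ln n%:R)) (K + 1).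
Proof.
move=> K0; apply: (cvg_in_probability_scaled ell0 K0).
- by move=> n n0; apply: (measurable_max_max_queue (HS n0)); exact: powR_ge0.
- by move=> e e0; exact: vanishing_max_gt.
- by move=> e e0; exact: vanishing_max_lt.
Qed.

End extremal_asymptotics.

Theorem theorem1p2 (R : realType) (lambda : R) (d : nat -> measure_display)
    (T : forall n : nat, measurableType (d n))
    (P : forall n : nat, probability (T n) R)
    (S : forall n : nat, supermarket_input (P n) n) :
  0 < lambda -> lambda < 1 ->
  (forall n : nat, (0 < n)%N -> is_supermarket (S n) lambda) ->
  (forall n : nat, (0 < n)%N -> stationary (S n)) ->
  [/\ (* (a) *)
      (forall (n m : nat) (t : R), (0 < n)%N -> 0 <= t ->
         P n [set w | (max_queue (S n) t w <= m)%N]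
         = ((1 - lambda ^+ m.+1) ^+ n)%:E)
      /\
      (forall (m : nat -> nat) (t : R), 0 <= t ->
         (aas P (fun n => [set w | (m n <= max_queue (S n) t w)%N]) <->
          (fun n => (m n)%:R - ln n%:R / ln (lambda^-1)) @ \oo --> -oo) /\
         (aas P (fun n => [set w | (max_queue (S n) t w <= m n)%N]) <->
          (fun n => (m n)%:R - ln n%:R / ln (lambda^-1)) @ \oo --> +oo)),
      (* (b) *)
      (forall tau : nat -> R, (forall n, 0 <= tau n) -> subexponential tau ->
         cvg_in_probability P
           (fun n w => min_max_queue (S n) (tau n) w
                       * (ln (lambda^-1) / ln n%:R)) 1)
    & (* (c) *)
      (forall K : R, 0 < K ->
         cvg_in_probability P
           (fun n w => max_max_queue (S n) (n%:R `^ K) w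
                       * (ln (lambda^-1) / ln n%:R)) (K + 1))].
Proof.
move=> lambda0 lambda1 HS stS; split; first split.
- move=> n m t n0 t0; rewrite prE.
    congr (_%:E); exact: (pr_max_queue lambda0 lambda1 n0 (HS n n0) (stS n n0) m t0).
  exact: (measurable_max_queue_event (HS n n0) t [set k | (k <= m)%N]).
- move=> m t t0; split.
    exact: aas_max_queue_ge.
  exact: aas_max_queue_le.
- by move=> tau tau0 subtau; exact: cvg_min_max_queue.
- by move=> K K0; exact: cvg_max_max_queue.
Qed.
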